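(* Consider a sequence of experiments as described in the context (independent groups $i=1,\dots,m$, the $i$-th consisting of $n_i$ i.i.d. observations with mean $\mu_i$ and variance $\sigma_i^2$; $n=\max_i n_i$, $m=m_n$, $m,n\to\infty$). Assume the following, where all constants are fixed along the sequence. (1) There exist $0<c_L\le 1\le c_U$ such that $c_L\le \sigma_i^2/\sigma_j^2\le c_U$ and $c_L\le n_i/n_j\le c_U$ for all $1\le i\ne j\le m$. (2) For some constants $r,C,\nu,K>0$, $m\le C n^r$ and $\max_{1\le i\le m}\mathbb{E}\left|(X_{1i}-\mu_i)/\sigma_i\right|^{2+4r+\nu}\le K$. (3) For all $i<j$, the reference null distribution functions $F_{ij}$ (possibly depending on $m,n_1,\dots,n_m$) are monotone increasing distribution functions with $F_{ij}(t)=1-F_{ij}(-t)$ for $t\ge 0$, and for some $c>0$, $$\max_{1\le i<j\le m}\ \sup_{0\le t\le 2\sqrt{\log m}}\left|\frac{1-F_{ij}(t)}{\bar\Phi(t)}-1\right|=O(n^{-c})\quad\text{as } m,n\to\infty.$$ Then, as $m,n\to\infty$, $$\sup_{0\le t\le\sqrt{2\log m}}\left|\frac{\sum_{(i,j)\in\mathcal{H}_+\cup\mathcal{H}_0}\mathbf{1}_{(\bar\Phi^{-1}(\bar p_{ij,L})\ge t)}+\sum_{(i,j)\in\mathcal{H}_-\cup\mathcal{H}_0}\mathbf{1}_{(\bar\Phi^{-1}(\bar p_{ij,U})\ge t)}}{\bar\Phi(t)(q+q_0)}-1\right|\longrightarrow 0\quad\text{in probability.}$$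
   Context: Setting. For each experiment in a sequence there are $m$ independent groups of observations $\{X_{ki}:1\le k\le n_i\}$, $1\le i\le m$; within group $i$ the $X_{ki}$ are i.i.d. with mean $\mu_i$ and variance $\sigma_i^2>0$, and $n_i\ge2$. Put $n=\max_i n_i$; $m=m_n$ depends on $n$, and asymptotics are as $m,n\to\infty$. The quantities $n_i,\mu_i,\sigma_i$ and the distributions may vary along the sequence. Notation. $\Phi$ is the standard normal c.d.f., $\bar\Phi=1-\Phi$, with $\bar\Phi^{-1}(0)=+\infty$ and $\bar\Phi^{-1}(1)=-\infty$. $\bar X_i=n_i^{-1}\sum_{k=1}^{n_i}X_{ki}$, $\hat\sigma_i^2=(n_i-1)^{-1}\sum_{k=1}^{n_i}(X_{ki}-\bar X_i)^2$. The centered two-sample t-statistics are $$\bar T_{ij}=\frac{(\bar X_i-\bar X_j)-(\mu_i-\mu_j)}{\sqrt{\hat\sigma_i^2/n_i+\hat\sigma_j^2/n_j}},\quad i\ne j$$ (set to $0$ if the denominator vanishes). For $i<j$, $\bar p_{ij,L}=F_{ij}(\bar T_{ij})$ and $\bar p_{ij,U}=1-F_{ij}(\bar T_{ij})$. Also $\mathcal{H}_0=\{(i,j):i<j,\ \mu_i-\mu_j=0\}$, $\mathcal{H}_+=\{(i,j):i<j,\ \mu_i-\mu_j>0\}$, $\mathcal{H}_-=\{(i,j):i<j,\ \mu_i-\mu_j<0\}$ (indices in $\{1,\dots,m\}$), $q=m(m-1)/2$ and $q_0=|\mathcal{H}_0|$. *)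

(* Defs.v *)
From HB Require Import structures.
From mathcomp Require Export all_boot all_order all_algebra.
From mathcomp Require Export all_classical all_reals all_analysis.

Set Implicit Arguments.
Unset Strict Implicit.
Unset Printing Implicit Defensive.

Export Order.TTheory GRing.Theory Num.Theory.
Export numFieldNormedType.Exports.

Local Open Scope classical_set_scope.
Local Open Scope ring_scope.

Section normal_tail.
Context {R : realType}.

Definition Phi (t : R) : R := fine (normal_prob 0 1 `]-oo, t]).

Definition barPhi (t : R) : R := 1 - Phi t.

(* barPhi is a decreasing bijection from R onto ]0, 1[, so for 0 < p < 1 the
   set below is a singleton; only arguments in [0, 1] are meaningful. *)
Definition barPhi_inv (p : R) : \bar R :=
  if p == 0 then +oo%E
  else if p == 1 then -oo%E
  else (xget 0 [set x : R | barPhi x = p])%:E.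

End normal_tail.

Section probability_notions.
Context {d : measure_display} {T : measurableType d} {R : realType}.
Variable P : probability T R.

Definition mutually_independent (I : finType) (X : I -> {RV P >-> R}) : Prop :=
  forall (J : {set I}) (B : I -> set R), (forall a, measurable (B a)) ->
    P (\bigcap_(a in [set` J]) (X a @^-1` B a)) =
    (\prod_(a in J) P (X a @^-1` B a))%E.

Definition identically_distributed (X Y : {RV P >-> R}) : Prop :=
  forall B : set R, measurable B -> distribution P X B = distribution P Y B.

End probability_notions.

Definition distribution_function (R : realType) (F : R -> R) : Prop :=
  [/\ {homo F : x y / x <= y}, right_continuous F,
      F x @[x --> -oo%R] --> (0 : R) & F x @[x --> +oo%R] --> (1 : R)].

(* Convergence to 0 in probability; the variables Z l may live on different
   probability spaces. *)
Definition cvg0_in_probability (R : realType) (d : nat -> measure_display)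
    (T : forall l, measurableType (d l)) (P : forall l, probability (T l) R)
    (Z : forall l, T l -> R) : Prop :=
  forall eps : R, 0 < eps ->
    P l [set w | eps < `|Z l w|] @[l --> \oo] --> (0 : \bar R)%E.

(* The observation X_{ki} is [obs i k], with i and k numbered from 0. *)
Record experiment (R : realType) := Experiment {
  disp : measure_display ;
  space : measurableType disp ;
  prob : probability space R ;
  ngroups : nat ;
  gsize : 'I_ngroups -> nat ;
  mean : 'I_ngroups -> R ;
  sd : 'I_ngroups -> R ;
  obs : forall i : 'I_ngroups, 'I_(gsize i) -> {RV prob >-> R} ;
  gsize_ge2 : forall i, (2 <= gsize i)%N ;
  sd_gt0 : forall i, 0 < sd i ;
  obs_independent :
    mutually_independent (fun a : {i : 'I_ngroups & 'I_(gsize i)} =>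
                            obs (tagged a)) ;
  obs_identical : forall i (k k' : 'I_(gsize i)),
    identically_distributed (obs k) (obs k') ;
  obs_mean : forall i (k : 'I_(gsize i)), 'E_prob[obs k]%E = (mean i)%:E ;
  obs_variance : forall i (k : 'I_(gsize i)),
    'V_prob[obs k]%E = (sd i ^+ 2)%:E
}.

Section statistics.
Context {R : realType}.
Variable E : experiment R.
Notation m := (ngroups E).

Definition maxsize : nat := \max_(i < m) gsize i.

Definition obs1 (i : 'I_m) : {RV prob E >-> R} :=
  obs (Ordinal (ltnW (gsize_ge2 i))).

Definition sample_mean (i : 'I_m) (w : space E) : R :=
  (gsize i)%:R^-1 * \sum_(k < gsize i) obs k w.

Definition sample_var (i : 'I_m) (w : space E) : R :=
  ((gsize i)%:R - 1)^-1 *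
  \sum_(k < gsize i) (obs k w - sample_mean i w) ^+ 2.

(* Division by 0 yields 0, which is the required convention here. *)
Definition barT (i j : 'I_m) (w : space E) : R :=
  ((sample_mean i w - sample_mean j w) - (mean i - mean j)) /
  Num.sqrt (sample_var i w / (gsize i)%:R + sample_var j w / (gsize j)%:R).

Definition H0 : {set 'I_m * 'I_m} :=
  [set ij : 'I_m * 'I_m | (ij.1 < ij.2)%N && (mean ij.1 - mean ij.2 == 0)]%SET.
Definition Hplus : {set 'I_m * 'I_m} :=
  [set ij : 'I_m * 'I_m | (ij.1 < ij.2)%N && (mean ij.1 - mean ij.2 > 0)]%SET.
Definition Hminus : {set 'I_m * 'I_m} :=
  [set ij : 'I_m * 'I_m | (ij.1 < ij.2)%N && (mean ij.1 - mean ij.2 < 0)]%SET.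

Definition q : R := m%:R * (m%:R - 1) / 2.
Definition q0 : nat := #|H0|.

Variable F : 'I_m -> 'I_m -> R -> R.

Definition barpL (i j : 'I_m) (w : space E) : R := F i j (barT i j w).
Definition barpU (i j : 'I_m) (w : space E) : R := 1 - F i j (barT i j w).

(* Here and in [sup_relative_error] the sup ranges over a bounded set, since
   barPhi is bounded below by a positive constant on a compact interval and
   the F i j take their values in [0, 1]. *)
Definition null_approx_error : R :=
  \big[Num.max/0]_(ij : 'I_m * 'I_m | (ij.1 < ij.2)%N)
    sup [set `|(1 - F ij.1 ij.2 t) / barPhi t - 1| |
          t in `[0, 2 * Num.sqrt (ln m%:R)]].

Definition rejections (t : R) (w : space E) : R :=
  \sum_(ij in (Hplus :|: H0)%SET)
     ((t%:E <= barPhi_inv (barpL ij.1 ij.2 w))%E : nat)%:R +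
  \sum_(ij in (Hminus :|: H0)%SET)
     ((t%:E <= barPhi_inv (barpU ij.1 ij.2 w))%E : nat)%:R.

Definition sup_relative_error (w : space E) : R :=
  sup [set `|rejections t w / (barPhi t * (q + q0%:R)) - 1| |
        t in `[0, Num.sqrt (2 * ln m%:R)]].

End statistics.

(* Main.v *)
From HB Require Import structures.
Require Import Defs.
From mathcomp Require Import measurable_realfun ring lra.

Set Implicit Arguments.
Unset Strict Implicit.
Unset Printing Implicit Defensive.

Local Open Scope classical_set_scope.
Local Open Scope ring_scope.

(** Orient every pair of groups so that its first mean is the smaller one, keeping
    both orientations when the means agree.  There are q + q0 oriented pairs x, and
    the numerator counts those with 1 - F_x(T_x) <= barPhi t.

    Put u = sqrt (2 ln m) + 4 and p = 2 + 4r + nu.  Truncating the standardized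
    observations at n^(1/2 - nu/(4p)) and replacing the estimated variances by the
    true ones changes T_x by a factor 1 + O(u^-4), outside an event whose probability
    vanishes by Chernoff bounds.  The statistics S_x obtained in this way are sums of
    bounded independent variables.  Lindeberg's replacement along the heat flow
    G(v, x) = Phi(x / sqrt v), with every error weighted by exp(lx + l^2 v/2) at l = t,
    gives P(S_x >= t) = barPhi t (1 + o(1)) uniformly on -1 <= t <= u - 1.

    The number of x with S_x >= t concentrates: disjoint pairs are independent, and
    pairs sharing a group have correlation at most some rho < 1, so that a Chernoff
    bound for S_x + S_y bounds their joint tail by a multiple of exp(- t^2/(1 + rho)).
    Chebyshev's inequality on a grid of thresholds of step u^-2 and monotonicity in t
    conclude. *)

(** * Taylor bounds and the normal tail *)

Section taylor.
Context {R : realType}.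
Implicit Types (f g : R -> R) (a b c x z M : R).

Definition between a b : interval R := `[Num.min a b, Num.max a b].

Lemma betweenC a b : between a b = between b a.
Proof. by rewrite /between minC maxC. Qed.

Lemma le_between a b : a <= b -> between a b = `[a, b].
Proof. by move=> ab; rewrite /between min_l ?max_r. Qed.

Lemma between_dist a b z : z \in between a b -> `|z - a| <= `|b - a|.
Proof.
rewrite in_itv/= ge_min le_max => /andP[/orP[] ? /orP[] ?];
  by do 2![case: ger0P => ?]; lra.
Qed.

Lemma between_sub a b c : c \in between a b -> {subset between a c <= between a b}.
Proof.
rewrite in_itv/= => /andP[abc cab]; apply: subitvP.
by rewrite subitvE !bnd_simp/= le_min ge_max abc cab ge_min le_max lexx.
Qed.

Lemma is_derive1_ext f g x df :
  f =1 g -> is_derive x 1 f df -> is_derive x 1 g df.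
Proof. by move=> /funext ->. Qed.

Lemma is_derive1_continuous f x df : is_derive x 1 f df -> {for x, continuous f}.
Proof. by move=> ?; apply/differentiable_continuous/derivable1_diffP. Qed.

Lemma MVT_between f (f' : R -> R) a b :
  {in between a b, forall z, is_derive z 1 f (f' z)} ->
  exists2 c, c \in between a b & f b - f a = f' c * (b - a).
Proof.
wlog ab : a b / a <= b => [wlog_ab|].
  case/orP: (le_total a b) => [|ba]; first exact: wlog_ab.
  rewrite betweenC => /(wlog_ab _ _ ba)[c cab e]; exists c => //.
  by rewrite -opprB e; ring.
rewrite le_between// => df.
have [x /subset_itv_oo_cc xab||c cab ->] := @MVT_segment R f f' a b ab.
- exact: df.
- by apply: derivable_within_continuous => x /df.
- by exists c.
Qed.

Lemma taylor1_bound f (f1 f2 : R -> R) a b M :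
  {in between a b, forall z, is_derive z 1 f (f1 z)} ->
  {in between a b, forall z, is_derive z 1 f1 (f2 z)} ->
  {in between a b, forall z, `|f2 z| <= M} ->
  `|f b - f a - f1 a * (b - a)| <= M * `|b - a| ^+ 2.
Proof.
move=> df df1 f2M; have [c cab ->] := MVT_between df.
have [x /(between_sub cab) xab e] := MVT_between (sub_in1 (between_sub cab) df1).
by rewrite -mulrBl e !normrM expr2 mulrA ler_wpM2r// ler_pM// ?f2M// between_dist.
Qed.

Lemma taylor2_bound f (f1 f2 f3 : R -> R) a b M :
  {in between a b, forall z, is_derive z 1 f (f1 z)} ->
  {in between a b, forall z, is_derive z 1 f1 (f2 z)} ->
  {in between a b, forall z, is_derive z 1 f2 (f3 z)} ->
  {in between a b, forall z, `|f3 z| <= M} ->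
  `|f b - f a - f1 a * (b - a) - f2 a * (b - a) ^+ 2 / 2| <= M * `|b - a| ^+ 3.
Proof.
move=> df df1 df2 f3M.
pose g z := f z - f1 a * (z - a) - f2 a * (z - a) ^+ 2 / 2.
pose g1 z := f1 z - f1 a - f2 a * (z - a).
have dg : {in between a b, forall z, is_derive z 1 g (g1 z)}.
  move=> z /df dfz.
  apply: (@is_derive1_ext (f - (f1 a \*: (id - cst a)) -
      ((f2 a / 2) \*: ((id - cst a) ^+ 2)))).
    by move=> y; rewrite /g !fctE/= /GRing.scale/=; ring.
  by apply: is_derive_eq; rewrite /g1 /GRing.scale/= !fctE; field.
have [c cab e] := MVT_between dg.
have sub := between_sub cab.
rewrite (_ : _ - _ = g b - g a); last by rewrite /g; field.
rewrite e normrM exprSr mulrA ler_wpM2r//.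
apply: le_trans (taylor1_bound (sub_in1 sub df1) (sub_in1 sub df2) (sub_in1 sub f3M)) _.
rewrite ler_wpM2l ?(le_trans _ (f3M c cab))//.
by rewrite lerXn2r ?nnegrE// between_dist.
Qed.

End taylor.

Section normal.
Context {R : realType}.
Implicit Types a b k p s t u : R.

Definition phi t : R := normal_pdf 0 1 t.

Lemma normal_peak1_gt0 : 0 < normal_peak 1 :> R.
Proof. exact: normal_peak_gt0. Qed.

Lemma normal_peak1_le1 : normal_peak 1 <= 1 :> R.
Proof.
have pi2 := @pi_ge2 R; have pi2n : 1 <= pi *+ 2 :> R by rewrite mulr2n; lra.
rewrite /normal_peak expr1n mul1r invf_le1 ?sqrtr_gt0; last exact: lt_le_trans pi2n.
by rewrite -[leLHS]sqrtr1 ler_wsqrtr.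
Qed.

Lemma phiE t : phi t = normal_peak 1 * expR (- t ^+ 2 / 2).
Proof. by rewrite /phi normal_pdfE//= /normal_fun subr0 expr1n. Qed.

Lemma phi_gt0 t : 0 < phi t.
Proof. by rewrite phiE mulr_gt0 ?expR_gt0 ?normal_peak1_gt0. Qed.

Lemma phi_le_expR t : phi t <= expR (- t ^+ 2 / 2).
Proof. by rewrite phiE ler_piMl ?expR_ge0 ?normal_peak1_le1. Qed.

Global Instance is_derive_phi t : is_derive t 1 phi (- t * phi t).
Proof.
apply: (@is_derive1_ext _ (normal_peak 1 \*: (expR \o ((- 2^-1) \*: (id ^+ 2))))).
  by move=> y; rewrite phiE !fctE/= /GRing.scale/=; congr (_ * expR _); lra.
apply: is_derive_eq; rewrite phiE /GRing.scale/= !fctE/=.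
rewrite /GRing.scale/= (_ : - 2^-1 * t ^+ 2 = - t ^+ 2 / 2); last by lra.
by rewrite expr1; lra.
Qed.

Global Instance is_derive_Phi t : is_derive t 1 Phi (phi t).
Proof.
have [] := @continuous_FTC1 R phi -oo%O t (t + 1).
- by rewrite ltrDl.
- by apply: (integrableS measurableT) => //; exact: integrable_normal_pdf.
- by rewrite ltNyr.
- exact: continuous_normal_pdf.
by move=> dPhi ePhi; apply: DeriveDef; [exact: dPhi|rewrite -derive1E -ePhi].
Qed.

Global Instance is_derive_barPhi t : is_derive t 1 barPhi (- phi t).
Proof.
apply: (@is_derive1_ext _ (cst 1 - Phi)) => //.
by apply: is_derive_eq; rewrite sub0r.
Qed.

Lemma continuous_barPhi : continuous (@barPhi R).
Proof. by move=> t; exact: is_derive1_continuous (is_derive_barPhi t). Qed.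

Lemma Phi_ge0 t : 0 <= Phi t :> R.
Proof. by rewrite fine_ge0. Qed.

Lemma Phi_le1 t : Phi t <= 1 :> R.
Proof. by rewrite -lee_fin /Phi fineK ?probability_le1 ?fin_num_measure. Qed.

Lemma barPhi_ge0 t : 0 <= barPhi t.
Proof. by rewrite subr_ge0 Phi_le1. Qed.

Lemma barPhi_le1 t : barPhi t <= 1.
Proof. by rewrite lerBlDr lerDl Phi_ge0. Qed.

Lemma barPhi_MVT a b : a <= b ->
  exists2 c, a <= c <= b & barPhi a - barPhi b = phi c * (b - a).
Proof.
move=> ab; have [z _|c] := @MVT_between R barPhi (fun t => - phi t) a b.
  exact: is_derive_barPhi.
by rewrite le_between// in_itv/= => cab e; exists c => //; lra.
Qed.

Lemma decreasing_barPhi a b : a < b -> barPhi b < barPhi a.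
Proof.
move=> ab; have [c _ e] := barPhi_MVT (ltW ab).
by rewrite -subr_gt0 e mulr_gt0 ?phi_gt0// subr_gt0.
Qed.

Lemma nonincreasing_barPhi a b : a <= b -> barPhi b <= barPhi a.
Proof. by rewrite le_eqVlt => /predU1P[->//|/decreasing_barPhi/ltW]. Qed.

Lemma barPhi_gt0 t : 0 < barPhi t.
Proof.
by apply: le_lt_trans (barPhi_ge0 (t + 1)) _; rewrite decreasing_barPhi// ltrDl.
Qed.

Lemma barPhi_lt1 t : barPhi t < 1.
Proof.
by apply: lt_le_trans (barPhi_le1 (t - 1)); rewrite decreasing_barPhi// gtrBl.
Qed.

Let idR : measurableTypeR R -> R := idfun.

#[local] HB.instance Definition _ :=
  @isMeasurableFun.Build _ _ _ _ idR (@measurable_id _ _ setT).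

Lemma cvg_Phi_pinfty : Phi x @[x --> +oo%R] --> (1 : R).
Proof.
have := cvg_cdfy1 (idR : {RV (normal_prob 0 1 : probability _ R) >-> R}).
by move/fine_cvg => /=; apply: cvg_trans.
Qed.

Lemma cvg_Phi_ninfty : Phi x @[x --> -oo%R] --> (0 : R).
Proof.
have := cvg_cdfNy0 (idR : {RV (normal_prob 0 1 : probability _ R) >-> R}).
by move/fine_cvg => /=; apply: cvg_trans.
Qed.

Lemma cvg_barPhi_pinfty : barPhi x @[x --> +oo%R] --> (0 : R).
Proof. by rewrite -(subrr 1); apply: cvgB; [exact: cvg_cst|exact: cvg_Phi_pinfty]. Qed.

Lemma cvg_barPhi_ninfty : barPhi x @[x --> -oo%R] --> (1 : R).
Proof.
rewrite -[X in _ --> X](subr0 1); apply: cvgB; first exact: cvg_cst.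
exact: cvg_Phi_ninfty.
Qed.

Lemma barPhiN t : barPhi (- t) = Phi t.
Proof.
pose f x : R := barPhi (- x) - Phi x.
have df (x : R) : is_derive x 1 f 0.
  apply: (@is_derive1_ext _ ((barPhi \o -%R) - Phi)) => //.
  by apply: is_derive_eq; rewrite !phiE sqrrN; lra.
have cvg_f0 : f x @[x --> +oo%R] --> (0 : R).
  rewrite -(subrr (1 : R)); apply: cvgB; last exact: cvg_Phi_pinfty.
  by have := cvg_barPhi_ninfty; rewrite cvgNy_compNP; exact: cvg_trans.
have cvg_ft : f x @[x --> +oo%R] --> f t.
  rewrite (_ : f = cst (f t)); first exact: cvg_cst.
  by apply/funext => x; exact: (@is_derive_0_is_cst _ _ x t).
by apply/eqP; rewrite -subr_eq0 -/(f t); apply/eqP; exact: cvg_unique cvg_ft cvg_f0.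
Qed.

Lemma barPhi0 : barPhi 0 = 2^-1 :> R.
Proof. by have := barPhiN 0; rewrite oppr0 {1 2}/barPhi; lra. Qed.

Lemma barPhi_surj p : 0 < p < 1 -> exists x : R, barPhi x = p.
Proof.
move=> /andP[p0 p1].
have [b bp] : exists b, barPhi b < p.
  have [M [_ hM]] := cvgr_lt _ cvg_barPhi_pinfty _ p0.
  by exists (M + 1); apply: hM; rewrite ltrDl.
have [a ap] : exists a, p < barPhi a.
  have [M [_ hM]] := cvgr_gt _ cvg_barPhi_ninfty _ p1.
  by exists (M - 1); apply: hM; rewrite gtrBl.
have ab : a <= b by rewrite leNgt; apply/negP => /decreasing_barPhi; lra.
have [||c _ <-] := @IVT R barPhi a b p ab; last by exists c.
- exact: continuous_subspaceT continuous_barPhi.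
- by rewrite minEge maxEle; case: ifPn; case: ifPn; lra.
Qed.

Lemma barPhi_inj : injective (@barPhi R).
Proof.
move=> a b e.
by have [/decreasing_barPhi|/decreasing_barPhi|//] := ltgtP a b; rewrite e ltxx.
Qed.

Lemma le_barPhi_inv t p : 0 <= p <= 1 ->
  (t%:E <= barPhi_inv p)%E = (p <= barPhi t).
Proof.
move=> /andP[p0 p1]; rewrite /barPhi_inv; case: eqVneq => [->|pn0].
  by rewrite leey barPhi_ge0.
case: eqVneq => [->|pn1]; first by rewrite leNgt ltNyr leNgt barPhi_lt1.
have [|x xp] := @barPhi_surj p; first by rewrite !lt_neqAle eq_sym pn0 p0 pn1 p1.
rewrite (_ : xget 0 _ = x); last first.
  by case: xgetP => [y -> /= yp|/(_ x)//]; apply: barPhi_inj; rewrite yp xp.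
rewrite lee_fin -xp; apply/idP/idP => [|]; first exact: nonincreasing_barPhi.
by apply: contraTT; rewrite -!ltNge; exact: decreasing_barPhi.
Qed.

Lemma barPhi_le_expR t : 0 <= t -> barPhi t <= expR (- t ^+ 2 / 2).
Proof.
move=> t0.
pose f s := barPhi (t + s) - expR (- t ^+ 2 / 2) * barPhi s.
pose f' s := expR (- t ^+ 2 / 2) * phi s - phi (t + s).
have df (s : R) : is_derive s 1 f (f' s).
  apply: (@is_derive1_ext _ ((barPhi \o (cst t + id)) -
      expR (- t ^+ 2 / 2) \*: barPhi)) => //.
  by apply: is_derive_eq; rewrite /f' /GRing.scale/= !fctE; lra.
have f_ge s : 0 <= s -> f 0 <= f s.
  move=> s0; have [z _|c] := @MVT_between R f f' 0 s; first exact: df.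
  rewrite le_between// in_itv/= => /andP[c0 _] e.
  rewrite -subr_ge0 e mulr_ge0 ?subr_ge0// !phiE mulrCA.
  by rewrite ler_pM2l ?normal_peak1_gt0// -expRD ler_expR; nra.
have cvg_f : f x @[x --> +oo%R] --> (0 : R).
  rewrite -[X in _ --> X](subrr (expR (- t ^+ 2 / 2) * 0)) {1}mulr0.
  apply: cvgB; last by apply: cvgMl_tmp; exact: cvg_barPhi_pinfty.
  apply: (cvg_comp (fun x => t + x) barPhi); last exact: cvg_barPhi_pinfty.
  exact: cvg_addrl.
have : f 0 <= 0.
  rewrite -[leRHS](cvg_lim _ cvg_f)//; apply: limr_ge; first by apply/cvg_ex; exists 0.
  by near=> s; apply: f_ge; near: s; exact: nbhs_pinfty_ge.
by rewrite /f addr0 barPhi0; have := expR_ge0 (- t ^+ 2 / 2); lra.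
Unshelve. all: by end_near. Qed.

Definition mills_const : R := expR (3 / 2) / normal_peak 1.

Lemma mills_const_gt0 : 0 < mills_const.
Proof. by rewrite divr_gt0 ?expR_gt0 ?normal_peak1_gt0. Qed.

Lemma expR_le_mills t u : 1 <= u -> -1 <= t <= u ->
  expR (- t ^+ 2 / 2) <= mills_const * u * barPhi t.
Proof.
move=> u1 /andP[t1 tu]; have u0 : 0 < u by lra.
have iu0 : 0 < u^-1 by rewrite invr_gt0.
have iu1 : u^-1 <= 1 by rewrite invf_le1.
have uV : u * u^-1 = 1 by rewrite divff// gt_eqF.
have [|c /andP[tc cu] e] := @barPhi_MVT t (t + u^-1); first by lra.
rewrite (addrC t) addrK (addrC _ t) in e.
apply: (@le_trans _ _ (mills_const * u * (phi c * u^-1))); last first.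
  apply: ler_wpM2l; first by rewrite mulr_ge0 ?(ltW mills_const_gt0) ?(ltW u0).
  by rewrite -e lerBlDr lerDl barPhi_ge0.
have -> : mills_const * u * (phi c * u^-1) = mills_const * phi c.
  by field; rewrite gt_eqF.
rewrite phiE /mills_const -mulrA mulKf ?gt_eqF ?normal_peak1_gt0// -expRD ler_expR.
nra.
Qed.

Definition hazard_lb : R := normal_peak 1 * expR (- 2^-1).

Lemma hazard_lb_gt0 : 0 < hazard_lb.
Proof. by rewrite mulr_gt0 ?expR_gt0 ?normal_peak1_gt0. Qed.

Lemma hazard_lb_le1 : hazard_lb <= 1.
Proof.
by rewrite mulr_ile1 ?normal_peak1_le1 ?expR_ge0 ?(ltW normal_peak1_gt0)// -expR0 ler_expR oppr_le0.
Qed.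

Lemma barPhi_shift_lb t k : -1 <= t -> 0 <= k <= 1 ->
  (1 + hazard_lb * k) * barPhi (t + k) <= barPhi t.
Proof.
move=> t1 /andP[k0 k1].
have [|c /andP[tc ctk] e] := @barPhi_MVT t (t + k); first by lra.
rewrite (addrC t) addrK (addrC _ t) in e.
suff : hazard_lb * barPhi (t + k) <= phi c by nra.
rewrite /hazard_lb phiE -mulrA ler_pM2l ?normal_peak1_gt0//.
have [tk1|tk1] := leP (t + k) 1.
  apply: (@le_trans _ _ (expR (- 2^-1))); first by rewrite ler_piMr ?expR_ge0 ?barPhi_le1.
  by rewrite ler_expR; nra.
apply: (@le_trans _ _ (barPhi (t + k))).
  by rewrite ler_piMl ?barPhi_ge0// -expR0 ler_expR; lra.
by apply: le_trans (barPhi_le_expR _) _; [lra|rewrite ler_expR; nra].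
Qed.

Definition hazard_ub : R := expR 1 * mills_const.

Lemma hazard_ub_gt0 : 0 < hazard_ub.
Proof. by rewrite mulr_gt0 ?expR_gt0 ?mills_const_gt0. Qed.

Lemma barPhi_shift_ub t k u : 1 <= u -> -1 <= t <= u -> 0 <= k -> k * u <= 1 ->
  barPhi (t - k) <= (1 + hazard_ub * (k * u)) * barPhi t.
Proof.
move=> u1 /[dup] tu /andP[t1 tu'] k0 ku.
have [|c /andP[tc ctk] e] := @barPhi_MVT (t - k) t; first by lra.
rewrite (_ : t - (t - k) = k) in e; last by lra.
suff : phi c <= hazard_ub * u * barPhi t by nra.
apply: le_trans (phi_le_expR _) _; rewrite /hazard_ub -2!mulrA.
apply: (@le_trans _ _ (expR 1 * expR (- t ^+ 2 / 2))); last first.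
  by rewrite ler_pM2l ?expR_gt0// mulrA expR_le_mills.
by rewrite -expRD ler_expR; have [?|?] := leP 0 t; nra.
Qed.

End normal.

(** * The heat flow *)

Section heat.
Context {R : realType}.
Implicit Types l s u v x y z K : R.

Definition rsqrt v : R := (Num.sqrt v)^-1.

Definition heat v x : R := Phi (x * rsqrt v).
Definition heat_dx v x : R := rsqrt v * phi (x * rsqrt v).
Definition heat_dxx v x : R := - (rsqrt v ^+ 3 * x * phi (x * rsqrt v)).
Definition heat_dxxx v x : R :=
  (rsqrt v ^+ 5 * x ^+ 2 - rsqrt v ^+ 3) * phi (x * rsqrt v).
Definition heat_dvv v x : R :=
  4^-1 * (3 * rsqrt v ^+ 5 * x - rsqrt v ^+ 7 * x ^+ 3) * phi (x * rsqrt v).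

Lemma rsqrt_gt0 v : 0 < v -> 0 < rsqrt v.
Proof. by move=> v0; rewrite invr_gt0 sqrtr_gt0. Qed.

Lemma rsqrt_nonincreasing u v : 0 < u -> u <= v -> rsqrt v <= rsqrt u.
Proof.
move=> u0 uv; rewrite /rsqrt lef_pV2 ?posrE ?sqrtr_gt0 ?ler_wsqrtr//.
exact: lt_le_trans uv.
Qed.

Lemma rsqrt_sqr x : 0 < x -> rsqrt (x ^+ 2) = x^-1.
Proof. by move=> x0; rewrite /rsqrt sqrtr_sqr gtr0_norm. Qed.

Lemma rsqrt1D_le1 v : 0 <= v -> rsqrt (1 + v) <= 1.
Proof.
move=> v0; rewrite -[leRHS]invr1 -[X in _ <= X^-1]sqrtr1.
by apply: rsqrt_nonincreasing => //; rewrite lerDl.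
Qed.

Lemma rsqrt1D_ge v : 0 <= v -> 1 - v <= rsqrt (1 + v).
Proof.
move=> v0; have k1 := rsqrt1D_le1 v0.
have k0 : 0 < rsqrt (1 + v) by apply: rsqrt_gt0; lra.
have : rsqrt (1 + v) ^+ 2 * (1 + v) = 1.
  by rewrite /rsqrt exprVn sqr_sqrtr ?mulVf ?gt_eqF//; lra.
nra.
Qed.

Lemma heat_derive_x v x : is_derive x 1 (heat v) (heat_dx v x).
Proof.
apply: (@is_derive1_ext _ (Phi \o (rsqrt v \*: id))).
  by move=> y; rewrite /heat/= /GRing.scale/= mulrC.
by apply: is_derive_eq; rewrite /heat_dx /GRing.scale/= mulr1 mulrC (mulrC x).
Qed.

Lemma heat_dx_derive_x v x : is_derive x 1 (heat_dx v) (heat_dxx v x).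
Proof.
apply: (@is_derive1_ext _ (rsqrt v \*: (phi \o (rsqrt v \*: id)))).
  by move=> y; rewrite /heat_dx/= /GRing.scale/= (mulrC y).
apply: is_derive_eq.
by rewrite /heat_dxx /GRing.scale/= /GRing.scale/= !mulr1 (mulrC x); ring.
Qed.

Lemma heat_dxx_derive_x v x : is_derive x 1 (heat_dxx v) (heat_dxxx v x).
Proof.
apply: (@is_derive1_ext _
  ((- rsqrt v ^+ 3) \*: (id * (phi \o (rsqrt v \*: id))))).
  by move=> y; rewrite /heat_dxx/= !fctE/= /GRing.scale/= (mulrC y (rsqrt v)); ring.
apply: is_derive_eq.
by rewrite /heat_dxxx /GRing.scale/= /GRing.scale/= !mulr1 (mulrC x (rsqrt v)); ring.
Qed.

Lemma rsqrt_derive v : 0 < v -> is_derive v 1 rsqrt (- 2^-1 * rsqrt v ^+ 3).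
Proof.
move=> v0; have nz : Num.sqrt v != 0 by rewrite gt_eqF// sqrtr_gt0.
have := @is_deriveV _ _ _ _ _ nz (is_derive1_sqrt v0).
rewrite (_ : _ *: _ = - 2^-1 * rsqrt v ^+ 3)//.
by rewrite /rsqrt /GRing.scale/=; field.
Qed.

Lemma heat_derive_v v x : 0 < v ->
  is_derive v 1 (heat ^~ x) (2^-1 * heat_dxx v x).
Proof.
move=> /rsqrt_derive drsqrt.
apply: (@is_derive1_ext _ (Phi \o (x \*: rsqrt))) => //.
by apply: is_derive_eq; rewrite /heat_dxx /GRing.scale/= /GRing.scale/=; ring.
Qed.

Lemma heat_dv_derive_v v x : 0 < v ->
  is_derive v 1 (fun v => 2^-1 * heat_dxx v x) (heat_dvv v x).
Proof.
move=> /rsqrt_derive drsqrt.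
apply: (@is_derive1_ext _
  ((- 2^-1 * x) \*: (rsqrt ^+ 3 * (phi \o (x \*: rsqrt))))).
  by move=> y; rewrite /heat_dxx/= !fctE /GRing.scale/= /GRing.scale/=; ring.
apply: is_derive_eq; rewrite /heat_dvv /= !fctE /GRing.scale/= /GRing.scale/=.
by field.
Qed.

Lemma heat_ge0 v x : 0 <= heat v x. Proof. exact: Phi_ge0. Qed.

Lemma heat_le1 v x : heat v x <= 1. Proof. exact: Phi_le1. Qed.

Lemma heat_barPhi v x : heat v (- x) = barPhi (x * rsqrt v).
Proof. by rewrite /heat -barPhiN mulNr opprK. Qed.

Lemma measurable_heat v : measurable_fun setT (heat v).
Proof.
by apply: continuous_measurable_fun => x; exact: is_derive1_continuous (heat_derive_x v x).
Qed.

(* gauss_mgf l v x is the mean of exp (l y) for y normal of mean x and variance v;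
   up to constants it dominates the derivatives of heat for every l. *)
Definition gauss_mgf l v x : R := expR (l * x + l ^+ 2 * v / 2).

Lemma gauss_mgf_ge0 l v x : 0 <= gauss_mgf l v x. Proof. exact: expR_ge0. Qed.

Lemma gauss_mgfD l v x z : gauss_mgf l v (x + z) = gauss_mgf l v x * expR (l * z).
Proof. by rewrite /gauss_mgf -expRD; congr expR; ring. Qed.

Lemma gauss_mgf_shift l v x z : `|l| * `|z| <= 1 ->
  gauss_mgf l v (x + z) <= expR 1 * gauss_mgf l v x.
Proof.
move=> lz; rewrite gauss_mgfD mulrC ler_wpM2r ?expR_ge0// ler_expR.
by rewrite (le_trans (ler_norm _))// normrM.
Qed.

Lemma gauss_mgf_nondecreasing l u v x : u <= v -> gauss_mgf l u x <= gauss_mgf l v x.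
Proof. by move=> uv; rewrite /gauss_mgf ler_expR; have := sqr_ge0 l; nra. Qed.

Lemma cube_le_expR z : 0 <= z -> (1 + z) ^+ 3 <= 64 * expR (z ^+ 2 / 2).
Proof.
move=> z0; have z2 : 0 <= z ^+ 2 / 2 by nra.
have -> : expR (z ^+ 2 / 2) = expR (z ^+ 2 / 4) ^+ 2.
  by rewrite -expRM_natl; congr expR; field.
apply: (@le_trans _ _ (64 * (1 + z ^+ 2 / 4) ^+ 2)); first by have [|] := leP z 1; nra.
by rewrite ler_pM2l// lerXn2r ?nnegrE ?expR_ge0 ?expR_ge1Dx//; nra.
Qed.

Lemma cube_norm1D_le y z : (1 + `|y|) ^+ 3 <= (1 + `|z|) ^+ 3 * (1 + `|y + z|) ^+ 3.
Proof.
rewrite -exprMn lerXn2r ?nnegrE ?mulr_ge0 ?addr_ge0//.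
have : `|y| <= `|y + z| + `|z| by rewrite -{1}(addrK z y) ler_normB.
by have := normr_ge0 z; have := normr_ge0 (y + z); nra.
Qed.

Lemma cube_phi_le l v x : 0 < v <= 2 ->
  (1 + `|x * rsqrt v|) ^+ 3 * phi (x * rsqrt v) <=
  512 * (1 + `|l|) ^+ 3 * gauss_mgf l v x.
Proof.
move=> /andP[v0 v2]; set y := x * rsqrt v.
have s0 : 0 < Num.sqrt v by rewrite sqrtr_gt0.
have s2 : Num.sqrt v ^+ 2 = v by rewrite sqr_sqrtr// ltW.
pose z := l * Num.sqrt v.
have lx : l * x = z * y by rewrite /z /y /rsqrt; field; rewrite gt_eqF.
have lv : l ^+ 2 * v = z ^+ 2 by rewrite /z exprMn s2.
have zl : 1 + `|z| <= 2 * (1 + `|l|).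
  have : Num.sqrt v <= 2 by nra.
  by rewrite /z normrM (gtr0_norm s0); have := normr_ge0 l; nra.
have z3 : (1 + `|z|) ^+ 3 <= 8 * (1 + `|l|) ^+ 3.
  have -> : 8 * (1 + `|l|) ^+ 3 = (2 * (1 + `|l|)) ^+ 3 by ring.
  by rewrite lerXn2r ?nnegrE ?mulr_ge0 ?addr_ge0.
have y3 : (1 + `|y|) ^+ 3 <= 8 * (1 + `|l|) ^+ 3 * (64 * expR ((y + z) ^+ 2 / 2)).
  apply: le_trans (cube_norm1D_le y z) _; apply: ler_pM z3 _.
  - by rewrite exprn_ge0 ?addr_ge0.
  - by rewrite exprn_ge0 ?addr_ge0.
  - by rewrite -(real_normK (num_real (y + z))) cube_le_expR.
have phi0 : 0 <= phi y by rewrite ltW ?phi_gt0.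
apply: le_trans (ler_pM _ phi0 y3 (phi_le_expR y)) _; first by rewrite exprn_ge0 ?addr_ge0.
have -> : gauss_mgf l v x = expR ((y + z) ^+ 2 / 2) * expR (- y ^+ 2 / 2).
  by rewrite /gauss_mgf lx lv -expRD; congr expR; field.
by rewrite le_eqVlt; apply/orP; left; apply/eqP; ring.
Qed.

Definition heat_const l K : R := 512 * (1 + `|l|) ^+ 3 * K ^+ 4.

Lemma heat_const_ge0 l K : 0 <= heat_const l K.
Proof.
by apply: mulr_ge0; [rewrite mulr_ge0 ?exprn_ge0 ?addr_ge0|exact: exprn_even_ge0].
Qed.

Lemma heat_scale_ge0 l K v x : 0 <= heat_const l K * gauss_mgf l v x.
Proof. exact: mulr_ge0 (heat_const_ge0 l K) (gauss_mgf_ge0 l v x). Qed.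

Lemma heat_const_le l u : 1 <= u -> `|l| <= 2 * u ->
  heat_const l (u ^+ 4) <= 512 * 27 * u ^+ 19.
Proof.
move=> u1 lu; rewrite /heat_const.
have -> : 512 * 27 * u ^+ 19 = 512 * (3 * u) ^+ 3 * (u ^+ 4) ^+ 4 by ring.
apply: ler_wpM2r; first by rewrite !exprn_ge0//; lra.
by apply: ler_wpM2l; [exact: ler0n|rewrite lerXn2r ?nnegrE ?addr_ge0//; lra].
Qed.

Section derivative_bounds.
Variables (l v x K : R).
Hypotheses (v02 : 0 < v <= 2) (rsqrtK : rsqrt v <= K).

(* The polynomial factors of the derivatives are rsqrt v ^+ n * y, where y is a
   polynomial in x * rsqrt v of degree at most 3. *)
Let poly_phi_bound n (y : R) : (n <= 4)%N -> 1 <= K ->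
  `|y| <= (1 + `|x * rsqrt v|) ^+ 3 ->
  `|rsqrt v ^+ n * y * phi (x * rsqrt v)| <= heat_const l K * gauss_mgf l v x.
Proof.
move=> n4 K1 y3; have [v0 _] := andP v02; have r0 := rsqrt_gt0 v0.
have phi0 := phi_gt0 (x * rsqrt v).
have rK : rsqrt v ^+ n <= K ^+ 4.
  apply: (@le_trans _ _ (K ^+ n)); last by rewrite ler_weXn2l.
  by rewrite lerXn2r ?nnegrE ?(ltW r0)// (le_trans ler01).
rewrite !normrM (gtr0_norm phi0) ger0_norm ?exprn_ge0 ?(ltW r0)//.
apply: (@le_trans _ _ (K ^+ 4 * ((1 + `|x * rsqrt v|) ^+ 3 * phi (x * rsqrt v)))).
  by rewrite mulrA ler_wpM2r ?(ltW phi0)// ler_pM ?exprn_ge0// ltW.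
rewrite /heat_const [leRHS]mulrAC [leRHS]mulrC.
by apply: ler_wpM2l; [exact: exprn_even_ge0|exact: cube_phi_le].
Qed.

Hypothesis K1 : 1 <= K.

Lemma heat_dx_bound : `|heat_dx v x| <= heat_const l K * gauss_mgf l v x.
Proof.
have := @poly_phi_bound 1 1 isT K1; rewrite expr1 mulr1; apply.
by rewrite normr1; have := normr_ge0 (x * rsqrt v); set a := `|_ * _|; nra.
Qed.

Lemma heat_dxx_bound : `|heat_dxx v x| <= heat_const l K * gauss_mgf l v x.
Proof.
rewrite /heat_dxx -mulNr.
have -> : - (rsqrt v ^+ 3 * x) = rsqrt v ^+ 2 * - (x * rsqrt v) by ring.
apply: poly_phi_bound => //; rewrite normrN.
by have := normr_ge0 (x * rsqrt v); set a := `|_ * _|; nra.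
Qed.

Lemma heat_dxxx_bound : `|heat_dxxx v x| <= heat_const l K * gauss_mgf l v x.
Proof.
rewrite /heat_dxxx.
have -> : rsqrt v ^+ 5 * x ^+ 2 - rsqrt v ^+ 3 =
  rsqrt v ^+ 3 * ((x * rsqrt v) ^+ 2 - 1) by ring.
apply: poly_phi_bound => //; apply: le_trans (ler_normB _ _) _.
by rewrite normr1 normrX; have := normr_ge0 (x * rsqrt v); set a := `|_ * _|; nra.
Qed.

Lemma heat_dvv_bound : `|heat_dvv v x| <= heat_const l K * gauss_mgf l v x.
Proof.
rewrite /heat_dvv.
have -> : 4^-1 * (3 * rsqrt v ^+ 5 * x - rsqrt v ^+ 7 * x ^+ 3) =
  rsqrt v ^+ 4 * (4^-1 * (3 * (x * rsqrt v) - (x * rsqrt v) ^+ 3)) by ring.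
apply: poly_phi_bound => //; rewrite normrM gtr0_norm//.
apply: (@le_trans _ _ (4^-1 * (3 * `|x * rsqrt v| + `|x * rsqrt v| ^+ 3))).
  rewrite ler_wpM2l//; apply: le_trans (ler_normB _ _) _.
  by rewrite normrM normrX gtr0_norm.
by have := normr_ge0 (x * rsqrt v); set a := `|_ * _|; nra.
Qed.

End derivative_bounds.

Lemma heat_taylor_x l v x K z : 0 < v <= 2 -> 1 <= K -> rsqrt v <= K ->
  `|l| * `|z| <= 1 ->
  `|heat v (x + z) - (heat v x + heat_dx v x * z + 2^-1 * heat_dxx v x * z ^+ 2)| <=
    expR 1 * (heat_const l K * gauss_mgf l v x) * `|z| ^+ 3.
Proof.
move=> v02 K1 rK lz.
have xzK : x + z - x = z by rewrite (addrC x) addrK.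
have := @taylor2_bound _ (heat v) (heat_dx v) (heat_dxx v) (heat_dxxx v) x (x + z)
  (expR 1 * (heat_const l K * gauss_mgf l v x)).
rewrite xzK (_ : heat v (x + z) - (_ + _ + _) = heat v (x + z) - heat v x -
  heat_dx v x * z - heat_dxx v x * z ^+ 2 / 2); last by field.
apply=> y yxz; [exact: heat_derive_x|exact: heat_dx_derive_x|exact: heat_dxx_derive_x|].
apply: le_trans (heat_dxxx_bound l y v02 rK K1) _.
rewrite mulrCA ler_wpM2l ?heat_const_ge0// -(subrK x y) addrC.
apply: gauss_mgf_shift; apply: le_trans lz; rewrite ler_wpM2l//.
by rewrite -[X in _ <= `|X|]xzK between_dist.
Qed.

Lemma heat_taylor_v l v x K s : 0 < v -> 0 <= s -> v + s <= 2 -> 1 <= K ->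
  rsqrt v <= K ->
  `|heat (v + s) x - (heat v x + 2^-1 * heat_dxx v x * s)| <=
    heat_const l K * gauss_mgf l (v + s) x * s ^+ 2.
Proof.
move=> v0 s0 vs2 K1 rK.
have vs : v <= v + s by rewrite lerDl.
have := @taylor1_bound _ (heat ^~ x) (fun v => 2^-1 * heat_dxx v x) (heat_dvv ^~ x)
  v (v + s) (heat_const l K * gauss_mgf l (v + s) x).
rewrite (addrC v) addrK (addrC s) opprD addrA (ger0_norm s0) le_between//.
apply=> y; rewrite in_itv/= => /andP[vy ys]; have y0 := lt_le_trans v0 vy.
- exact: heat_derive_v.
- exact: heat_dv_derive_v.
have y02 : 0 < y <= 2 by rewrite y0 (le_trans ys).
apply: le_trans (heat_dvv_bound l x y02 (le_trans (rsqrt_nonincreasing v0 vy) rK) K1) _.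
by rewrite ler_wpM2l ?heat_const_ge0 ?gauss_mgf_nondecreasing.
Qed.

End heat.

(** * Bounded random variables and independence *)

Section measurable_inequalities.
Context {d : measure_display} {T : measurableType d} {R : realType}.
Implicit Types f g : T -> R.

Lemma measurable_set_le f g : measurable_fun setT f -> measurable_fun setT g ->
  measurable [set w | f w <= g w].
Proof.
by move=> mf mg; rewrite -[X in measurable X]setTI; exact: measurable_fun_le.
Qed.

Lemma measurable_set_lt f g : measurable_fun setT f -> measurable_fun setT g ->
  measurable [set w | f w < g w].
Proof.
move=> mf mg; rewrite (_ : [set w | _] = ~` [set w | g w <= f w]).
  by apply: measurableC; exact: measurable_set_le.
by apply/seteqP; split=> w /=; rewrite ltNge => /negP.
Qed.

Lemma measurable_exists_fin (J : finType) (A : J -> set T) :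
  (forall j, measurable (A j)) -> measurable [set w | exists j, A j w].
Proof.
move=> mA; rewrite (_ : [set w | _] = \bigcup_(j in [set: J]) A j).
  by apply: fin_bigcup_measurable => //; exact: finite_finset.
by apply/seteqP; split=> w [j]; [exists j|exists j].
Qed.

End measurable_inequalities.

Section bounded_mfun.
Context {d : measure_display} {T : measurableType d} {R : realType}.
Implicit Types (f g : T -> R) (A : set T) (c : R).

Definition bounded_mfun f : Prop :=
  measurable_fun setT f /\ exists M : R, forall w, `|f w| <= M.

Lemma bounded_mfun_measurable f : bounded_mfun f -> measurable_fun setT f.
Proof. by case. Qed.

Lemma bounded_mfun_cst c : bounded_mfun (cst c).
Proof. by split => //; exists `|c|. Qed.

Lemma bounded_mfunD f g :
  bounded_mfun f -> bounded_mfun g -> bounded_mfun (fun w => f w + g w).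
Proof.
move=> [mf [M fM]] [mg [N gN]]; split; first exact: measurable_funD.
by exists (M + N) => w; rewrite (le_trans (ler_normD _ _))// lerD.
Qed.

Lemma bounded_mfunM f g :
  bounded_mfun f -> bounded_mfun g -> bounded_mfun (fun w => f w * g w).
Proof.
move=> [mf [M fM]] [mg [N gN]]; split; first exact: measurable_funM.
by exists (M * N) => w; rewrite normrM ler_pM.
Qed.

Lemma bounded_mfunZ c f : bounded_mfun f -> bounded_mfun (fun w => c * f w).
Proof. by move=> bf; apply: bounded_mfunM => //; exact: bounded_mfun_cst. Qed.

Lemma bounded_mfunB f g :
  bounded_mfun f -> bounded_mfun g -> bounded_mfun (fun w => f w - g w).
Proof.
move=> bf bg; apply: bounded_mfunD => //.
by under eq_fun do rewrite -mulN1r; exact: bounded_mfunZ.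
Qed.

Lemma bounded_mfunX f n : bounded_mfun f -> bounded_mfun (fun w => f w ^+ n).
Proof.
move=> bf; elim: n => [|n ih]; first exact: bounded_mfun_cst.
by under eq_fun do rewrite exprS; exact: bounded_mfunM.
Qed.

Lemma bounded_mfun_norm f : bounded_mfun f -> bounded_mfun (fun w => `|f w|).
Proof.
move=> [mf [M fM]]; split; first exact: measurableT_comp.
by exists M => w; rewrite normr_id.
Qed.

Lemma bounded_mfun_expR f : bounded_mfun f -> bounded_mfun (fun w => expR (f w)).
Proof.
move=> [mf [M fM]]; split; first exact: measurableT_comp.
exists (expR M) => w; rewrite ger0_norm ?expR_ge0// ler_expR.
exact: le_trans (ler_norm _) (fM w).
Qed.

Lemma bounded_mfun_indic A : measurable A -> bounded_mfun (\1_A).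
Proof.
move=> mA; split; first exact: measurable_indic.
by exists 1 => w; rewrite ger0_norm// indicE lern1 leq_b1.
Qed.

Lemma bounded_mfun_sum (I : Type) (s : seq I) (Q : pred I) (F : I -> T -> R) :
  (forall i, bounded_mfun (F i)) -> bounded_mfun (fun w => \sum_(i <- s | Q i) F i w).
Proof.
move=> bF; elim: s => [|i s ih].
  by under eq_fun do rewrite big_nil; exact: bounded_mfun_cst.
by under eq_fun do rewrite big_cons; case: (Q i) => //; exact: bounded_mfunD.
Qed.

End bounded_mfun.

Section expectation.
Context {d : measure_display} {T : measurableType d} {R : realType}.
Variable P : probability T R.
Implicit Types (f g : T -> R) (A : set T) (c : R).

Definition Rexpectation f : R := (\int[P]_w f w)%R.

Local Notation Ex := Rexpectation.

Lemma bounded_mfun_integrable f : bounded_mfun f -> P.-integrable setT (EFin \o f).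
Proof.
move=> [mf [M fM]]; apply: measurable_bounded_integrable => //.
  by rewrite (le_lt_trans (probability_le1 _ _))// ltry.
exists M; split; first exact: num_real.
by move=> y My w _; exact: le_trans (fM w) (ltW My).
Qed.

Lemma Rexpectation_cst c : Ex (cst c) = c.
Proof. by rewrite /Ex Rintegral_cst//= probability_setT/= mulr1. Qed.

Lemma RexpectationD f g : bounded_mfun f -> bounded_mfun g ->
  Ex (fun w => f w + g w) = Ex f + Ex g.
Proof. by move=> bf bg; rewrite /Ex RintegralD//; exact: bounded_mfun_integrable. Qed.

Lemma RexpectationB f g : bounded_mfun f -> bounded_mfun g ->
  Ex (fun w => f w - g w) = Ex f - Ex g.
Proof. by move=> bf bg; rewrite /Ex RintegralB//; exact: bounded_mfun_integrable. Qed.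

Lemma RexpectationZ c f : bounded_mfun f -> Ex (fun w => c * f w) = c * Ex f.
Proof. by move=> bf; rewrite /Ex RintegralZl//; exact: bounded_mfun_integrable. Qed.

Lemma Rexpectation_quadratic (c0 c1 c2 : R) f : bounded_mfun f ->
  Ex (fun w => c0 + c1 * f w + c2 * f w ^+ 2) =
  c0 + c1 * Ex f + c2 * Ex (fun w => f w ^+ 2).
Proof.
move=> bf; have bf1 := bounded_mfunZ c1 bf; have b0 := @bounded_mfun_cst _ T _ c0.
have bf2 := bounded_mfunX 2 bf.
rewrite RexpectationD ?(RexpectationZ c2 bf2); last exact: bounded_mfunZ.
- by rewrite (RexpectationD b0 bf1) (Rexpectation_cst c0) RexpectationZ.
- exact: bounded_mfunD.
Qed.

Lemma le_Rexpectation f g : bounded_mfun f -> bounded_mfun g ->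
  (forall w, f w <= g w) -> Ex f <= Ex g.
Proof.
by move=> bf bg fg; apply: le_Rintegral => //; exact: bounded_mfun_integrable.
Qed.

Lemma Rexpectation_ge0 f : (forall w, 0 <= f w) -> 0 <= Ex f.
Proof. by move=> f0; apply: Rintegral_ge0 => w _. Qed.

Lemma norm_Rexpectation_le f : bounded_mfun f -> `|Ex f| <= Ex (fun w => `|f w|).
Proof.
by move=> bf; apply: le_normr_Rintegral => //; exact: bounded_mfun_integrable.
Qed.

Lemma Rexpectation_sum (I : Type) (s : seq I) (Q : pred I) (F : I -> T -> R) :
  (forall i, bounded_mfun (F i)) ->
  Ex (fun w => \sum_(i <- s | Q i) F i w) = \sum_(i <- s | Q i) Ex (F i).
Proof.
move=> bF; elim: s => [|i s ih].
  by under eq_fun do rewrite big_nil; rewrite big_nil Rexpectation_cst.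
under eq_fun do rewrite big_cons; rewrite big_cons; case: (Q i) => //.
by rewrite RexpectationD ?ih//; exact: bounded_mfun_sum.
Qed.

Lemma Rexpectation_indic A : measurable A -> Ex (\1_A) = fine (P A).
Proof. by move=> mA; rewrite /Ex /Rintegral integral_indic// setIT. Qed.

Lemma EFin_Rexpectation f : bounded_mfun f -> (Ex f)%:E = (\int[P]_w (f w)%:E)%E.
Proof.
move=> bf; rewrite /Ex /Rintegral fineK//.
by apply: integrable_fin_num => //; exact: bounded_mfun_integrable.
Qed.

Lemma Rexpectation_markov f A c : bounded_mfun f -> (forall w, 0 <= f w) ->
  measurable A -> (forall w, A w -> c <= f w) -> 0 < c -> fine (P A) <= Ex f / c.
Proof.
move=> bf f0 mA Af c0; have bA := bounded_mfun_indic (R := R) mA.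
rewrite ler_pdivlMr// mulrC -Rexpectation_indic// -RexpectationZ//.
apply: le_Rexpectation => //; first exact: bounded_mfunZ.
move=> w; rewrite indicE; case: (boolP (w \in A)) => [|_]; last by rewrite mulr0.
by rewrite inE mulr1; exact: Af.
Qed.

Lemma prob_le A B : measurable A -> measurable B -> A `<=` B ->
  fine (P A) <= fine (P B).
Proof.
move=> mA mB AB; apply: fine_le; rewrite ?fin_num_measure//.
by apply: le_measure; rewrite ?inE.
Qed.

Lemma prob_le1 A : measurable A -> fine (P A) <= 1.
Proof. by move=> mA; rewrite -lee_fin fineK ?fin_num_measure// probability_le1. Qed.

Lemma prob_setU_le A B : measurable A -> measurable B ->
  fine (P (A `|` B)) <= fine (P A) + fine (P B).
Proof.
move=> mA mB; rewrite -lee_fin EFinD !fineK ?fin_num_measure//; last exact: measurableU.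
exact: measureU2.
Qed.

Lemma prob_exists_le (J : finType) (A : J -> set T) :
  (forall j, measurable (A j)) ->
  fine (P [set w | exists j, A j w]) <= \sum_j fine (P (A j)).
Proof.
move=> mA; have mU := measurable_exists_fin mA.
have bA j := bounded_mfun_indic (R := R) (mA j).
rewrite -Rexpectation_indic//.
under eq_bigr do rewrite -Rexpectation_indic//.
rewrite -(Rexpectation_sum (index_enum J) xpredT bA).
apply: le_Rexpectation; [exact: bounded_mfun_indic|exact: bounded_mfun_sum|].
move=> w; rewrite indicE; case: (boolP (w \in _)) => [|_]; last exact: sumr_ge0.
rewrite inE => -[j Ajw]; rewrite (bigD1 j)//= indicE mem_set//= lerDl.
exact: sumr_ge0.
Qed.

Section event_count.
Variables (J : finType) (A : {set J}) (I_ : J -> set T).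
Hypothesis mI : forall x, measurable (I_ x).

Definition event_count w : R := \sum_(x in A) \1_(I_ x) w.

Let Pr B := fine (P B).

Lemma bounded_mfun_event_count : bounded_mfun event_count.
Proof. by apply: bounded_mfun_sum => x; exact: bounded_mfun_indic. Qed.

Lemma event_covariance B C : measurable B -> measurable C ->
  Ex (fun w => (\1_B w - Pr B) * (\1_C w - Pr C)) = Pr (B `&` C) - Pr B * Pr C.
Proof.
move=> mB mC; have mBC := measurableI _ _ mB mC.
rewrite (_ : (fun w => _) = (fun w => \1_(B `&` C) w -
    Pr B * \1_C w - Pr C * \1_B w + Pr B * Pr C)); last first.
  apply/funext => w; rewrite !indicE in_setI.
  by case: (w \in B); case: (w \in C); rewrite /=; ring.
have bB := bounded_mfun_indic (R := R) mB; have bC := bounded_mfun_indic (R := R) mC.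
have bBC := bounded_mfun_indic (R := R) mBC.
have bPC := bounded_mfunZ (Pr B) bC; have bPB := bounded_mfunZ (Pr C) bB.
have bBCB := bounded_mfunB bBC bPC.
rewrite (RexpectationD (bounded_mfunB bBCB bPB) (bounded_mfun_cst _)).
rewrite (Rexpectation_cst (Pr B * Pr C)).
rewrite (RexpectationB bBCB bPB) (RexpectationB bBC bPC) !RexpectationZ//.
by rewrite !Rexpectation_indic// -/(Pr _) -/(Pr _) -/(Pr _); ring.
Qed.

Lemma event_count_variance :
  Ex (fun w => (event_count w - \sum_(x in A) Pr (I_ x)) ^+ 2) =
  \sum_(x in A) \sum_(y in A) (Pr (I_ x `&` I_ y) - Pr (I_ x) * Pr (I_ y)).
Proof.
rewrite (_ : (fun w => _) = (fun w => \sum_(x in A) \sum_(y in A)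
   (\1_(I_ x) w - Pr (I_ x)) * (\1_(I_ y) w - Pr (I_ y)))); last first.
  apply/funext => w; rewrite /event_count -sumrB expr2 mulr_suml.
  by apply: eq_bigr => x _; rewrite mulr_sumr.
have b_centered x : bounded_mfun (fun w => \1_(I_ x) w - Pr (I_ x)).
  by apply: bounded_mfunB; [exact: bounded_mfun_indic|exact: bounded_mfun_cst].
rewrite Rexpectation_sum; last first.
  by move=> x; apply: bounded_mfun_sum => y; exact: bounded_mfunM.
apply: eq_bigr => x _; rewrite Rexpectation_sum; last by move=> y; exact: bounded_mfunM.
by apply: eq_bigr => y _; exact: event_covariance.
Qed.

Lemma measurable_event_count_dev c delta :
  measurable [set w | delta <= `|event_count w - c|].
Proof.
apply: measurable_set_le => //; apply: bounded_mfun_measurable.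
apply/bounded_mfun_norm/bounded_mfunB; first exact: bounded_mfun_event_count.
exact: bounded_mfun_cst.
Qed.

Lemma event_count_chebyshev delta : 0 < delta ->
  Pr [set w | delta <= `|event_count w - \sum_(x in A) Pr (I_ x)|] <=
  (\sum_(x in A) \sum_(y in A) (Pr (I_ x `&` I_ y) - Pr (I_ x) * Pr (I_ y))) /
    delta ^+ 2.
Proof.
move=> delta0; rewrite -event_count_variance.
apply: Rexpectation_markov; last exact: exprn_gt0.
- apply/bounded_mfunX/bounded_mfunB; first exact: bounded_mfun_event_count.
  exact: bounded_mfun_cst.
- by move=> w; exact: sqr_ge0.
- exact: measurable_event_count_dev.
- move=> w /= dev; rewrite -[leRHS]real_normK ?num_real//.
  by rewrite lerXn2r ?nnegrE// ltW.
Qed.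

End event_count.
End expectation.

Section independence.
Context {d : measure_display} {T : measurableType d} {R : realType}.
Variable P : probability T R.

Local Notation Ex := (Rexpectation P).

Definition independent_pair (U V : T -> R) : Prop := forall A B : set R,
  measurable A -> measurable B ->
  P (U @^-1` A `&` V @^-1` B) = (P (U @^-1` A) * P (V @^-1` B))%E.

Section fubini.
Variables (U V : T -> R).
Hypotheses (mU : measurable_fun setT U) (mV : measurable_fun setT V).
Hypothesis indepUV : independent_pair U V.

#[local] HB.instance Definition _ := isMeasurableFun.Build _ _ _ _ U mU.
#[local] HB.instance Definition _ := isMeasurableFun.Build _ _ _ _ V mV.

Let UV (w : T) : R * R := (U w, V w).
Let mUV : measurable_fun setT UV. Proof. exact: measurable_fun_pair. Qed.
#[local] HB.instance Definition _ := isMeasurableFun.Build _ _ _ _ UV mUV.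

Let lawU := distribution P (U : {RV P >-> R}).
Let lawV := distribution P (V : {RV P >-> R}).

Let joint_law (f : R * R -> R) : measurable_fun setT f -> (forall z, 0 <= f z) ->
  (\int[P]_w (f (U w, V w))%:E = \int[lawU \x lawV]_z (f z)%:E)%E.
Proof.
move=> /measurable_EFinP mf f0.
transitivity (\int[distribution P (UV : {RV P >-> _})]_z (f z)%:E)%E.
  by rewrite ge0_integral_distribution// => z; rewrite /= lee_fin.
apply: eq_measure_integral => A mA _.
by apply/esym/product_measure_unique => // A' B' mA' mB'; exact: indepUV.
Qed.

Let integral_lawV (f : R * R -> R) x : measurable_fun setT f -> (forall z, 0 <= f z) ->
  (\int[lawV]_y (f (x, y))%:E = \int[P]_w (f (x, V w))%:E)%E.
Proof.
move=> mf f0.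
rewrite (ge0_integral_distribution (V : {RV P >-> R}) (f := fun y => (f (x, y))%:E))//.
  by apply/measurable_EFinP; apply: measurableT_comp => //; exact: pair1_measurable.
by move=> y; rewrite lee_fin.
Qed.

Let ge0_independent_fubini (f : R * R -> R) :
  measurable_fun setT f -> (forall z, 0 <= f z) ->
  (\int[P]_w (f (U w, V w))%:E = \int[P]_w \int[P]_w' (f (U w, V w'))%:E)%E /\
  @measurable_fun _ _ T (\bar R) setT (fun w => \int[P]_w' (f (U w, V w'))%:E)%E.
Proof.
move=> mf f0; have /measurable_EFinP mf' := mf.
have f0' z : (0 <= (EFin \o f) z)%E by rewrite lee_fin.
have fubiniE x : fubini_F lawV (EFin \o f) x = (\int[P]_w' (f (x, V w'))%:E)%E.
  by rewrite /fubini_F -integral_lawV.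
have mF : @measurable_fun _ _ R (\bar R) setT (fun x => \int[P]_w' (f (x, V w'))%:E)%E.
  have : measurable_fun setT (fubini_F lawV (EFin \o f)).
    exact: measurable_fun_fubini_tonelli_F.
  by apply: eq_measurable_fun => x _.
split; last exact: (measurableT_comp mF mU).
rewrite joint_law// fubini_tonelli1//; under eq_integral do rewrite fubiniE.
by apply: ge0_integral_distribution => // x; apply: integral_ge0 => w _; rewrite lee_fin.
Qed.

Lemma independent_pair_fubini (f : R * R -> R) (M : R) : measurable_fun setT f ->
  (forall z, 0 <= f z) -> (forall w w', f (U w, V w') <= M) ->
  bounded_mfun (fun w => Ex (fun w' => f (U w, V w'))) /\
  Ex (fun w => f (U w, V w)) = Ex (fun w => Ex (fun w' => f (U w, V w'))).
Proof.
move=> mf f0 fM.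
have b_inner w : bounded_mfun (fun w' => f (U w, V w')).
  split; last by exists M => w'; rewrite ger0_norm.
  by apply: measurableT_comp => //; exact: measurable_fun_pair.
have b_diag : bounded_mfun (fun w => f (U w, V w)).
  split; last by exists M => w; rewrite ger0_norm.
  exact: measurableT_comp mUV.
have [fubini m_outer] := ge0_independent_fubini mf f0.
have b_outer : bounded_mfun (fun w => Ex (fun w' => f (U w, V w'))).
  split.
    apply/measurable_EFinP; apply: eq_measurable_fun m_outer => w _ /=.
    by rewrite EFin_Rexpectation.
  exists M => w; rewrite ger0_norm; last exact: Rexpectation_ge0.
  by rewrite -[leRHS](Rexpectation_cst P) le_Rexpectation//; exact: bounded_mfun_cst.
split => //; apply: EFin_inj; rewrite !EFin_Rexpectation// fubini.
by apply: eq_integral => w _; rewrite EFin_Rexpectation.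
Qed.

End fubini.

Section measurable_wrt.
Variables (I : finType) (X : I -> {RV P >-> R}).
Implicit Types (J : {set I}) (U V : T -> R).

(* A pi-system generating the sigma-algebra of the X a, a in J. *)
Definition cylinder J : set (set T) :=
  [set A | exists2 B : I -> set R, (forall a, measurable (B a)) &
     A = \bigcap_(a in [set` J]) X a @^-1` B a].

Lemma cylinder_measurable J : cylinder J `<=` measurable.
Proof.
move=> _ [B mB ->]; apply: fin_bigcap_measurable; first exact: finite_finset.
by move=> a _; exact: measurable_funPTI.
Qed.

Lemma cylinder_setI_closed J : setI_closed (cylinder J).
Proof.
move=> _ _ [B mB ->] [C mC ->]; exists (fun a => B a `&` C a).
  by move=> a; exact: measurableI.
by rewrite -bigcapI.
Qed.

Lemma cylinder_setT J : cylinder J setT.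
Proof. by exists (fun=> setT) => //; apply/seteqP; split. Qed.

Lemma cylinder_sub J1 J2 : J1 \subset J2 -> cylinder J1 `<=` cylinder J2.
Proof.
move=> /fintype.subsetP J12 _ [B mB ->].
exists (fun a => if a \in J1 then B a else setT); first by move=> a; case: ifP.
apply/seteqP; split=> w h a /= aJ; first by case: ifP => // /h.
by have := h a (J12 _ aJ); rewrite /= aJ.
Qed.

Lemma sigma_cylinder_measurable J : <<s cylinder J >> `<=` measurable.
Proof.
by apply: smallest_sub; [exact: sigma_algebra_measurable|exact: cylinder_measurable].
Qed.

Definition measurable_wrt J U : Prop :=
  @measurable_fun _ _ (g_sigma_algebraType (cylinder J)) R setT U.

Lemma measurable_wrt_measurable J U : measurable_wrt J U -> measurable_fun setT U.
Proof. by move=> mU _ B mB; exact: sigma_cylinder_measurable (mU measurableT B mB). Qed.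

Lemma measurable_wrt_sub J1 J2 U :
  J1 \subset J2 -> measurable_wrt J1 U -> measurable_wrt J2 U.
Proof.
move=> J12 mU _ B mB; apply: sub_smallest2r (mU measurableT B mB).
  exact: smallest_sigma_algebra.
exact: cylinder_sub J12.
Qed.

Lemma measurable_wrt_comp (g : R -> R) a :
  measurable_fun setT g -> measurable_wrt [set a]%SET (g \o X a).
Proof.
move=> mg; apply: (measurableT_comp mg) => _ B mB; rewrite setTI.
apply: sub_sigma_algebra; exists (fun=> B) => //.
by apply/seteqP; split=> [w Bw b /set1P ->//|w]; apply; rewrite /= inE.
Qed.

Lemma measurable_wrt_sum J (s : seq I) (F : I -> T -> R) :
  (forall a, a \in s -> measurable_wrt J (F a)) ->
  measurable_wrt J (fun w => \sum_(a <- s) F a w).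
Proof.
elim: s => [|a s ih] mF.
  by under eq_fun do rewrite big_nil; exact: measurable_cst.
under eq_fun do rewrite big_cons.
apply: measurable_funD; first by apply: mF; rewrite mem_head.
by apply: ih => b bs; apply: mF; rewrite inE bs orbT.
Qed.

Hypothesis X_indep : mutually_independent X.

Lemma cylinder_indep J1 J2 A B : [disjoint J1 & J2]%bool -> cylinder J1 A ->
  cylinder J2 B -> P (A `&` B) = (P A * P B)%E.
Proof.
move=> J12 [B1 mB1 ->] [B2 mB2 ->].
pose B12 a := if a \in J1 then B1 a else B2 a.
have B12_1 a : a \in J1 -> B12 a = B1 a by rewrite /B12 => ->.
have B12_2 a : a \in J2 -> B12 a = B2 a.
  by rewrite /B12; case: ifP => // /(fintype.disjointFr J12) ->.
have mB12 a : measurable (B12 a) by rewrite /B12; case: ifP.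
rewrite (_ : _ `&` _ = \bigcap_(a in [set` (J1 :|: J2)%SET]) X a @^-1` B12 a).
  rewrite !X_indep// (eq_bigl [predU J1 & J2]); last by move=> a; rewrite !inE.
  rewrite bigU//; congr (_ * _)%E.
    by apply: eq_bigr => a /B12_1 ->.
  by apply: eq_bigr => a /B12_2 ->.
apply/seteqP; split=> [w [h1 h2] a /=|w h].
  by rewrite inE => /orP[aJ|aJ]; rewrite ?(B12_1 _ aJ) ?(B12_2 _ aJ); [exact: h1|exact: h2].
split=> a /= aJ; [rewrite -(B12_1 _ aJ)|rewrite -(B12_2 _ aJ)];
  by apply: h; rewrite /= inE aJ ?orbT.
Qed.

Let indep_sigma_ext J (B : set T) : measurable B ->
  (forall A, cylinder J A -> P (A `&` B) = (P A * P B)%E) ->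
  forall A, <<s cylinder J >> A -> P (A `&` B) = (P A * P B)%E.
Proof.
move=> mB indepB A sA.
have r0 : 0 <= fine (P B) by rewrite fine_ge0.
have mscaleE A' : mscale (NngNum r0) P A' = (P A' * P B)%E.
  by rewrite /mscale/= fineK ?fin_num_measure// muleC.
rewrite -mscaleE; apply: (@g_sigma_algebra_measure_unique _ R T (cylinder J)
  (@cylinder_measurable J) (fun=> setT) (fun=> @cylinder_setT J) _
  (mrestr P mB) (mscale (NngNum r0) P) (@cylinder_setI_closed J)) => //.
- by rewrite bigcup_const.
- by move=> A' cA'; exact: etrans (indepB _ cA') (esym (mscaleE _)).
- move=> _; change (P (setT `&` B) < +oo)%E.
  by rewrite setTI (le_lt_trans (probability_le1 _ _)) ?ltry.
Qed.

Lemma sigma_cylinder_indep J1 J2 A B : [disjoint J1 & J2]%bool ->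
  <<s cylinder J1 >> A -> <<s cylinder J2 >> B -> P (A `&` B) = (P A * P B)%E.
Proof.
move=> J12 sA sB; apply: indep_sigma_ext sA; first exact: sigma_cylinder_measurable sB.
move=> A' cA'; rewrite setIC muleC; apply: indep_sigma_ext sB.
  exact: cylinder_measurable cA'.
by move=> B' cB'; rewrite setIC muleC; exact: cylinder_indep cA' cB'.
Qed.

Lemma measurable_wrt_independent J1 J2 U V : [disjoint J1 & J2]%bool ->
  measurable_wrt J1 U -> measurable_wrt J2 V -> independent_pair U V.
Proof.
move=> J12 mU mV A B mA mB; apply: (sigma_cylinder_indep J12).
  by have := mU measurableT A mA; rewrite setTI.
by have := mV measurableT B mB; rewrite setTI.
Qed.

End measurable_wrt.
End independence.

(** * Lindeberg replacement *)

Section lindeberg_constants.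
Context {R : realType}.

Definition mgf_const : R := 1 + expR 1.
Definition replacement_const : R := 3 + expR 1.

Lemma mgf_const_ge1 : 1 <= mgf_const.
Proof. by rewrite /mgf_const lerDl expR_ge0. Qed.

Lemma replacement_const_ge0 : 0 <= replacement_const.
Proof. by rewrite addr_ge0 ?expR_ge0. Qed.

End lindeberg_constants.

Section single_summand.
Context {d : measure_display} {T : measurableType d} {R : realType}.
Variable P : probability T R.

Local Notation Ex := (Rexpectation P).

Record lindeberg_summand (b s e : R) (xi : T -> R) : Prop := LindebergSummand {
  summand_measurable : measurable_fun setT xi ;
  summand_le : forall w, `|xi w| <= b ;
  summand_mean : `|Ex xi| <= e ;
  summand_var : `|Ex (fun w => xi w ^+ 2) - s| <= e ;
  summand_cube : b * Ex (fun w => xi w ^+ 2) <= e ;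
  summand_var_ge0 : 0 <= s ;
  summand_var_sqr : s ^+ 2 <= e
}.

Lemma summand_bounded b s e xi : lindeberg_summand b s e xi -> bounded_mfun xi.
Proof. by move=> ls; split; [exact: summand_measurable ls|exists b; exact: summand_le ls]. Qed.

Variables (xi : T -> R) (b s e l : R).
Hypotheses (xi_ls : lindeberg_summand b s e xi) (lb : `|l| * b <= 1).

Let b_xi : bounded_mfun xi := summand_bounded xi_ls.

Let b_cube : bounded_mfun (fun w => `|xi w| ^+ 3).
Proof. exact/bounded_mfunX/bounded_mfun_norm. Qed.

Let xi_small w : `|l| * `|xi w| <= 1.
Proof. by apply: le_trans lb; rewrite ler_wpM2l// (summand_le xi_ls). Qed.

Lemma summand_err_ge0 : 0 <= e.
Proof. exact: le_trans (summand_mean xi_ls). Qed.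

Lemma summand_third_moment c : 0 <= c -> Ex (fun w => c * `|xi w| ^+ 3) <= c * e.
Proof.
move=> c0; rewrite RexpectationZ// ler_wpM2l//; apply: le_trans (summand_cube xi_ls).
rewrite -RexpectationZ; last exact: bounded_mfunX.
apply: le_Rexpectation => //; first exact/bounded_mfunZ/bounded_mfunX.
by move=> w; rewrite exprS real_normK ?num_real// ler_wpM2r ?sqr_ge0// (summand_le xi_ls).
Qed.

Lemma bounded_mfun_heat v x : bounded_mfun (fun w => heat v (x + xi w)).
Proof.
split; last by exists 1 => w; rewrite ger0_norm ?heat_ge0 ?heat_le1.
apply: (measurableT_comp (measurable_heat v)).
by apply: measurable_funD => //; exact: bounded_mfun_measurable.
Qed.

Let heat_mean_taylor v x K : 0 < v <= 2 -> 1 <= K -> rsqrt v <= K ->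
  `|Ex (fun w => heat v (x + xi w)) -
    (heat v x + heat_dx v x * Ex xi + 2^-1 * heat_dxx v x * Ex (fun w => xi w ^+ 2))| <=
  expR 1 * (heat_const l K * gauss_mgf l v x) * e.
Proof.
move=> v02 K1 rK; have b_heat := bounded_mfun_heat v x.
have b_taylor : bounded_mfun
    (fun w => heat v x + heat_dx v x * xi w + 2^-1 * heat_dxx v x * xi w ^+ 2).
  apply: bounded_mfunD; last exact/bounded_mfunZ/bounded_mfunX.
  by apply: bounded_mfunD; [exact: bounded_mfun_cst|exact: bounded_mfunZ].
have c0 : 0 <= expR 1 * (heat_const l K * gauss_mgf l v x).
  exact: mulr_ge0 (expR_ge0 _) (heat_scale_ge0 l K v x).
rewrite -Rexpectation_quadratic// -RexpectationB//.
have b_remainder := bounded_mfunB b_heat b_taylor.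
apply: le_trans (norm_Rexpectation_le P b_remainder) _.
apply: le_trans (summand_third_moment c0).
apply: le_Rexpectation; [exact: bounded_mfun_norm b_remainder|exact: bounded_mfunZ|].
by move=> w; exact: heat_taylor_x.
Qed.

Lemma heat_replacement v x K : 0 < v -> v + s <= 2 -> 1 <= K -> rsqrt v <= K ->
  `|Ex (fun w => heat v (x + xi w)) - heat (v + s) x| <=
    replacement_const * heat_const l K * e * gauss_mgf l (v + s) x.
Proof.
move=> v0 vs K1 rK; have s0 := summand_var_ge0 xi_ls; have e0 := summand_err_ge0.
have v02 : 0 < v <= 2 by lra.
have vvs : v <= v + s by lra.
pose D := heat_const l K * gauss_mgf l (v + s) x.
have D0 : 0 <= D := heat_scale_ge0 l K (v + s) x.
have leD : heat_const l K * gauss_mgf l v x <= D.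
  by rewrite ler_wpM2l ?heat_const_ge0 ?gauss_mgf_nondecreasing.
have dx_le : `|heat_dx v x * Ex xi| <= D * e.
  rewrite normrM ler_pM ?(summand_mean xi_ls)//.
  exact: le_trans (heat_dx_bound l x v02 rK K1) leD.
have dxx_le : `|heat_dxx v x * (Ex (fun w => xi w ^+ 2) - s)| <= D * e.
  rewrite normrM ler_pM ?(summand_var xi_ls)//.
  exact: le_trans (heat_dxx_bound l x v02 rK K1) leD.
have dv_le : `|heat (v + s) x - (heat v x + 2^-1 * heat_dxx v x * s)| <= D * e.
  apply: le_trans (heat_taylor_v l x v0 s0 vs K1 rK) _.
  by rewrite ler_wpM2l ?(summand_var_sqr xi_ls).
have space_le : `|Ex (fun w => heat v (x + xi w)) - (heat v x + heat_dx v x * Ex xi +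
    2^-1 * heat_dxx v x * Ex (fun w => xi w ^+ 2))| <= expR 1 * D * e.
  apply: le_trans (heat_mean_taylor x v02 K1 rK) _.
  by rewrite ler_wpM2r// ler_wpM2l ?expR_ge0.
rewrite (_ : replacement_const * heat_const l K * e * _ = expR 1 * D * e + 3 * (D * e));
  last by rewrite /replacement_const /D; ring.
have /ler_normlP[? ?] := space_le; have /ler_normlP[? ?] := dv_le.
have /ler_normlP[? ?] := dx_le; have /ler_normlP[? ?] := dxx_le.
have De0 := mulr_ge0 D0 e0; rewrite ler_norml; apply/andP; split; lra.
Qed.

Let expR_le_cubic w : expR (l * xi w) <=
  (1 + l * xi w + l ^+ 2 / 2 * xi w ^+ 2) + expR 1 * `|l| ^+ 3 * `|xi w| ^+ 3.
Proof.
have lxi : `|l * xi w| <= 1 by rewrite normrM.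
have d_expR : {in between 0 (l * xi w), forall z : R, is_derive z 1 expR (expR z)}.
  by move=> z _; exact: is_derive_expR.
have expR_le : {in between 0 (l * xi w), forall z, `|expR z| <= expR 1}.
  move=> z /between_dist; rewrite !subr0 => zl.
  by rewrite ger0_norm ?expR_ge0// ler_expR (le_trans (ler_norm z)) ?(le_trans zl).
have := taylor2_bound d_expR d_expR d_expR expR_le.
rewrite expR0 subr0 normrM exprMn mulrA !mul1r => /ler_normlP[_].
rewrite exprMn; lra.
Qed.

Lemma mgf_bound : Ex (fun w => expR (l * xi w)) <=
  expR (l ^+ 2 * s / 2 + mgf_const * (1 + `|l|) ^+ 3 * e).
Proof.
have e0 := summand_err_ge0; have l0 := normr_ge0 l.
pose c := expR 1 * `|l| ^+ 3.
have c0 : 0 <= c by rewrite mulr_ge0 ?expR_ge0 ?exprn_ge0.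
have b_quad : bounded_mfun (fun w => 1 + l * xi w + l ^+ 2 / 2 * xi w ^+ 2).
  apply: bounded_mfunD; last exact/bounded_mfunZ/bounded_mfunX.
  by apply: bounded_mfunD; [exact: bounded_mfun_cst|exact: bounded_mfunZ].
have b_third := bounded_mfunZ c b_cube.
have b_exp : bounded_mfun (fun w => expR (l * xi w)).
  exact/bounded_mfun_expR/bounded_mfunZ.
apply: le_trans (le_Rexpectation P b_exp (bounded_mfunD b_quad b_third) expR_le_cubic) _.
rewrite RexpectationD// Rexpectation_quadratic//.
apply: le_trans (expR_ge1Dx _).
have third := summand_third_moment c0.
have mean_le : l * Ex xi <= `|l| * e.
  apply: le_trans (ler_norm _) _; rewrite normrM ler_wpM2l//.
  exact: summand_mean xi_ls.
have var_le : l ^+ 2 * (Ex (fun w => xi w ^+ 2) - s) <= `|l| ^+ 2 * e.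
  rewrite real_normK ?num_real// ler_wpM2l ?sqr_ge0//.
  exact: le_trans (ler_norm _) (summand_var xi_ls).
have : (`|l| + `|l| ^+ 2 / 2 + c) * e <= mgf_const * (1 + `|l|) ^+ 3 * e.
  rewrite ler_wpM2r// /mgf_const /c; have := expR_ge0 (1 : R); nra.
lra.
Qed.

End single_summand.

Section independent_sum.
Context {d : measure_display} {T : measurableType d} {R : realType}.
Variable P : probability T R.
Variables (I : finType) (X : I -> {RV P >-> R}) (xi : I -> T -> R).
Variables (b : R) (s e : I -> R).
Hypothesis X_indep : mutually_independent X.
Hypothesis xi_wrt : forall a, measurable_wrt X [set a]%SET (xi a).
Hypothesis xi_ls : forall a, lindeberg_summand P b (s a) (e a) (xi a).
Implicit Types (a : I) (r : seq I) (w : T).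

Local Notation Ex := (Rexpectation P).

Definition partial_sum r w : R := \sum_(a <- r) xi a w.

Let b_xi a : bounded_mfun (xi a) := summand_bounded (xi_ls a).

Lemma partial_sum_cons a r w : partial_sum (a :: r) w = xi a w + partial_sum r w.
Proof. by rewrite /partial_sum big_cons. Qed.

Lemma bounded_mfun_partial_sum r : bounded_mfun (partial_sum r).
Proof. exact: bounded_mfun_sum. Qed.

Lemma partial_sum_independent a r :
  a \notin r -> independent_pair P (xi a) (partial_sum r).
Proof.
move=> a_r; have disj : [disjoint [set a]%SET & [set x in r]%SET]%bool.
  by rewrite disjoints1 inE.
apply: (measurable_wrt_independent X_indep disj (@xi_wrt a)).
apply: measurable_wrt_sum => x xr; apply: measurable_wrt_sub (@xi_wrt x).
by rewrite finset.sub1set inE.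
Qed.

Section heat_of_sum.
Variables (l K v : R).
Hypotheses (lb : `|l| * b <= 1) (K1 : 1 <= K) (v0 : 0 < v) (rK : rsqrt v <= K).

Definition replacement_err (eps vr x : R) : R :=
  replacement_const * heat_const l K * eps *
  expR (mgf_const * (1 + `|l|) ^+ 3 * eps) * gauss_mgf l vr x.

Let replacement_scale_ge0 : 0 <= replacement_const * heat_const l K.
Proof. exact: mulr_ge0 replacement_const_ge0 (heat_const_ge0 l K). Qed.

Lemma replacement_err_ge0 eps vr x : 0 <= eps -> 0 <= replacement_err eps vr x.
Proof.
by move=> eps0; do 2?[apply: mulr_ge0; last exact: expR_ge0]; exact: mulr_ge0.
Qed.

Lemma replacement_errD eps1 eps2 vr s2 x : 0 <= eps1 -> 0 <= eps2 ->
  replacement_err eps1 vr x *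
    expR (l ^+ 2 * s2 / 2 + mgf_const * (1 + `|l|) ^+ 3 * eps2) +
  replacement_const * heat_const l K * eps2 * gauss_mgf l (vr + s2) x <=
  replacement_err (eps1 + eps2) (vr + s2) x.
Proof.
move=> eps1_ge0 eps2_ge0; have : 0 <= mgf_const * (1 + `|l|) ^+ 3.
  by rewrite mulr_ge0 ?exprn_ge0 ?addr_ge0// (le_trans ler01) ?mgf_const_ge1.
have := replacement_scale_ge0; rewrite /replacement_err.
move: (replacement_const * _) (mgf_const * _) => Q M Q0 M0.
have -> : Q * (eps1 + eps2) * expR (M * (eps1 + eps2)) * gauss_mgf l (vr + s2) x =
    Q * eps1 * (expR (M * (eps1 + eps2)) * gauss_mgf l (vr + s2) x) +
    Q * eps2 * expR (M * (eps1 + eps2)) * gauss_mgf l (vr + s2) x by ring.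
apply: lerD; last first.
  apply: ler_wpM2r; first exact: gauss_mgf_ge0.
  apply: ler_peMr; first exact: mulr_ge0.
  by rewrite -[leLHS]expR0 ler_expR mulr_ge0 ?addr_ge0.
rewrite -!mulrA; apply: ler_wpM2l => //; apply: ler_wpM2l => //.
by rewrite /gauss_mgf -!expRD ler_expR; lra.
Qed.

(* One more independent summand: the error of the sum of the others is averaged
   against exp (l * xi a), the rest is the replacement of xi a alone. *)
Lemma heat_replacement_cons a (S : T -> R) eps vr : bounded_mfun S ->
  independent_pair P (xi a) S -> v <= vr -> vr + s a <= 2 -> 0 <= eps ->
  (forall x, `|Ex (fun w => heat v (x + S w)) - heat vr x| <= replacement_err eps vr x) ->
  forall x, `|Ex (fun w => heat v (x + (xi a w + S w))) - heat (vr + s a) x| <=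
    replacement_err (eps + e a) (vr + s a) x.
Proof.
move=> bS indepS vvr vrs eps0 errS x; under eq_fun do rewrite addrA.
have [] := independent_pair_fubini (f := fun z => heat v (x + z.1 + z.2)) (M := 1)
  (bounded_mfun_measurable (b_xi a)) (bounded_mfun_measurable bS) indepS.
- apply: (measurableT_comp (measurable_heat v)).
  by apply: measurable_funD => //; exact: measurable_funD.
- by move=> z; exact: heat_ge0.
- by move=> w w'; exact: heat_le1.
move=> /= b_inner ->.
have vr0 : 0 < vr by exact: lt_le_trans vvr.
have rKvr : rsqrt vr <= K by exact: le_trans (rsqrt_nonincreasing v0 vvr) rK.
have b_heat := bounded_mfun_heat (xi_ls a) vr x.
have b_mgf : bounded_mfun (fun w => expR (l * xi a w)) by exact/bounded_mfun_expR/bounded_mfunZ.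
have inner_le : `|Ex (fun w => Ex (fun w' => heat v (x + xi a w + S w'))) -
    Ex (fun w => heat vr (x + xi a w))| <= replacement_err eps vr x *
    expR (l ^+ 2 * s a / 2 + mgf_const * (1 + `|l|) ^+ 3 * e a).
  rewrite -RexpectationB//.
  apply: le_trans (norm_Rexpectation_le P (bounded_mfunB b_inner b_heat)) _.
  apply: (@le_trans _ _ (Ex (fun w => replacement_err eps vr x * expR (l * xi a w)))).
    apply: le_Rexpectation; [exact/bounded_mfun_norm/bounded_mfunB|exact: bounded_mfunZ|].
    by move=> w; rewrite -mulrA -gauss_mgfD; exact: errS.
  by rewrite RexpectationZ// ler_wpM2l ?replacement_err_ge0// (mgf_bound (xi_ls a)).
have outer_le := heat_replacement (xi_ls a) lb x vr0 vrs K1 rKvr.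
apply: le_trans (replacement_errD _ _ _ eps0 (summand_err_ge0 (xi_ls a))).
apply: le_trans (lerD inner_le outer_le).
by apply: le_trans (ler_normD _ _); rewrite addrA subrK.
Qed.

Lemma heat_partial_sum r x : uniq r -> v + \sum_(a <- r) s a <= 2 ->
  `|Ex (fun w => heat v (x + partial_sum r w)) - heat (v + \sum_(a <- r) s a) x| <=
  replacement_err (\sum_(a <- r) e a) (v + \sum_(a <- r) s a) x.
Proof.
elim: r x => [|a r ih] x /=.
  move=> _ _; rewrite !big_nil !addr0.
  under eq_fun do rewrite /partial_sum big_nil addr0.
  by rewrite Rexpectation_cst subrr normr0 replacement_err_ge0.
move=> /andP[a_r r_uniq]; rewrite !big_cons (addrC (s a)) (addrC (e a)) addrA => vs2.
have s_ge0 : 0 <= \sum_(j <- r) s j.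
  by apply: sumr_ge0 => j _; exact: summand_var_ge0 (xi_ls j).
have sa := summand_var_ge0 (xi_ls a).
under eq_fun do rewrite partial_sum_cons.
apply: heat_replacement_cons => //.
- exact: bounded_mfun_partial_sum.
- exact: partial_sum_independent.
- by rewrite lerDl.
- by apply: sumr_ge0 => j _; exact: summand_err_ge0 (xi_ls j).
- by move=> y; apply: ih => //; lra.
Qed.

End heat_of_sum.

Lemma mgf_partial_sum l r : `|l| * b <= 1 -> uniq r ->
  Ex (fun w => expR (l * partial_sum r w)) <=
  expR (l ^+ 2 * (\sum_(a <- r) s a) / 2 +
    mgf_const * (1 + `|l|) ^+ 3 * \sum_(a <- r) e a).
Proof.
move=> lb; elim: r => [_|a r ih /= /andP[a_r r_uniq]].
  rewrite !big_nil !mulr0 mul0r addr0 expR0.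
  by under eq_fun do rewrite /partial_sum big_nil mulr0 expR0; rewrite Rexpectation_cst.
have bS := bounded_mfun_partial_sum r; have [mS [M SM]] := bS.
have b_exp : bounded_mfun (fun w => expR (l * partial_sum r w)).
  exact/bounded_mfun_expR/bounded_mfunZ.
have b_exp_xi : bounded_mfun (fun w => expR (l * xi a w)).
  exact/bounded_mfun_expR/bounded_mfunZ.
under eq_fun do rewrite partial_sum_cons mulrDr.
have [] := independent_pair_fubini (f := fun z => expR (l * z.1 + l * z.2))
  (M := expR (1 + `|l| * M)) (bounded_mfun_measurable (b_xi a)) mS
  (partial_sum_independent a_r).
- by apply: measurableT_comp => //; apply: measurable_funD; exact: measurable_funM.
- by move=> z; exact: expR_ge0.
- move=> w w' /=; rewrite ler_expR lerD// (le_trans (ler_norm _))// normrM.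
    by apply: le_trans lb; rewrite ler_wpM2l// (summand_le (xi_ls a)).
  by rewrite ler_wpM2l.
move=> /= _ ->.
have -> : (fun w => Ex (fun w' => expR (l * xi a w + l * partial_sum r w'))) =
    (fun w => Ex (fun w' => expR (l * partial_sum r w')) * expR (l * xi a w)).
  apply/funext => w; rewrite [RHS]mulrC -RexpectationZ//; congr (Rexpectation P _).
  by apply/funext => w'; rewrite expRD.
rewrite RexpectationZ// !big_cons.
apply: le_trans (ler_pM _ _ (ih r_uniq) (mgf_bound (xi_ls a) lb)) _.
- by apply: Rexpectation_ge0 => w; exact: expR_ge0.
- by apply: Rexpectation_ge0 => w; exact: expR_ge0.
by rewrite -expRD ler_expR; lra.
Qed.

End independent_sum.

Section smoothing.
Context {d : measure_display} {T : measurableType d} {R : realType}.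
Variable P : probability T R.
Implicit Types (S : T -> R) (t h k : R).

Local Notation Ex := (Rexpectation P).

Let bounded_heat S v t : measurable_fun setT S -> bounded_mfun (fun w => heat v (S w - t)).
Proof.
move=> mS; split; last by exists 1 => w; rewrite ger0_norm ?heat_ge0 ?heat_le1.
by apply: (measurableT_comp (measurable_heat v)); exact: measurable_funB.
Qed.

Lemma prob_ge_le_heat S t h k : measurable_fun setT S -> 0 < h ->
  fine (P [set w | t <= S w]) * (1 - barPhi k) <=
  Ex (fun w => heat (h ^+ 2) (S w - (t - h * k))).
Proof.
move=> mS h0; have mA : measurable [set w | t <= S w] by exact: measurable_set_le.
have bA := bounded_mfun_indic (R := R) mA.
rewrite -Rexpectation_indic// mulrC -RexpectationZ//.
apply: le_Rexpectation; [exact: bounded_mfunZ|exact: bounded_heat|].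
move=> w; rewrite indicE; case: (boolP (w \in _)) => [|_]; last by rewrite mulr0 heat_ge0.
rewrite inE/= mulr1 {1}/barPhi opprB addrC subrK /heat rsqrt_sqr// -!barPhiN => tS.
by apply: nonincreasing_barPhi; rewrite lerN2 ler_pdivlMr// mulrC; lra.
Qed.

Lemma heat_le_prob_ge S t h k : measurable_fun setT S -> 0 < h ->
  Ex (fun w => heat (h ^+ 2) (S w - (t + h * k))) <=
  fine (P [set w | t <= S w]) + barPhi k.
Proof.
move=> mS h0; have mA : measurable [set w | t <= S w] by exact: measurable_set_le.
have bA := bounded_mfun_indic (R := R) mA; have bk := @bounded_mfun_cst _ T _ (barPhi k).
rewrite -Rexpectation_indic// -(Rexpectation_cst P (barPhi k)) -RexpectationD//.
apply: le_Rexpectation; [exact: bounded_heat|exact: bounded_mfunD|].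
move=> w; rewrite indicE; case: (boolP (w \in _)) => [_|].
  by apply: (le_trans (heat_le1 _ _)); rewrite lerDl barPhi_ge0.
rewrite notin_setE/= => /negP; rewrite -ltNge add0r /heat rsqrt_sqr// -barPhiN => tS.
by apply: nonincreasing_barPhi; rewrite -mulNr ler_pdivlMr// mulrC; lra.
Qed.

End smoothing.

Section tail_arithmetic.
Context {R : realType}.
Implicit Types t u s x y z v eta : R.

Lemma inv_ge4 u : 4 <= u -> [/\ 0 < u^-1, u^-1 <= 4^-1 & u * u^-1 = 1].
Proof.
move=> u4; have u0 : 0 < u by apply: lt_le_trans u4.
by rewrite invr_gt0 lef_pV2 ?posrE// divff ?gt_eqF.
Qed.

Lemma pow_absorb u z n k j : 4 <= u -> 0 <= z -> u ^+ n * z <= 1 -> (k + j <= n)%N ->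
  4 ^+ j * (u ^+ k * z) <= 1.
Proof.
move=> u4 z0 uz kj; have u1 : 1 <= u by apply: le_trans u4; rewrite ler1n.
have u0 : 0 <= u by exact: le_trans u1.
apply: le_trans uz; rewrite mulrA ler_wpM2r//.
apply: (@le_trans _ _ (u ^+ (k + j))); last by rewrite ler_weXn2l.
by rewrite exprD mulrC ler_wpM2l ?exprn_ge0// lerXn2r ?nnegrE.
Qed.

Lemma mul_rsqrt1D_dist t v : 0 <= v -> `|t * rsqrt (1 + v) - t| <= `|t| * v.
Proof.
move=> v0; rewrite -{2}(mulr1 t) -mulrBr normrM ler_wpM2l// ler_norml.
by have := rsqrt1D_le1 v0; have := rsqrt1D_ge v0; lra.
Qed.

Lemma sqr_shift_le t s u : 4 <= u -> -1 <= t <= u -> `|s - t| <= 2 * u^-1 ^+ 3 ->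
  - s ^+ 2 / 2 + 2^-1 <= 1 + - t ^+ 2 / 2.
Proof.
move=> /[dup] u4 /inv_ge4[i0 i4 ui] tu.
set z := u^-1 ^+ 3; rewrite ler_norml => /andP[st1 st2].
have z0 : 0 < z by rewrite exprn_gt0.
have uz : u * z <= 16^-1 by rewrite /z exprS mulrA ui mul1r; nra.
have cross : - (2 * (u * z)) <= (s - t) * t.
  case/andP: tu => t1 tu; have zt : z * t <= z * u by rewrite ler_pM2l.
  have [t0|t0] := leP 0 t.
    by apply: (@le_trans _ _ (- (2 * z) * t)); [lra|rewrite ler_wpM2r].
  have tz : - z <= z * t by rewrite -mulrN1 ler_pM2l.
  have zu : z * 4 <= z * u by rewrite ler_pM2l.
  by apply: (@le_trans _ _ ((2 * z) * t)); [lra|rewrite ler_wnM2r// ltW].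
have -> : s ^+ 2 = t ^+ 2 + 2 * ((s - t) * t) + (s - t) ^+ 2 by ring.
by have := sqr_ge0 (s - t); clear - uz cross; lra.
Qed.

Lemma barPhi_double u : 4 <= u ->
  barPhi (2 * u) <= mills_const * u^-1 * barPhi u /\ barPhi (2 * u) <= u^-1 / 2.
Proof.
move=> /[dup] u4 /inv_ge4[i0 i4 ui].
have e0 : 0 <= expR (- u ^+ 2) by exact: expR_ge0.
have i1 : u^-1 <= 1 by lra.
have tail_sqr : barPhi (2 * u) <= expR (- u ^+ 2) * expR (- u ^+ 2).
  apply: le_trans (barPhi_le_expR _) _; first lra.
  by rewrite -expRD ler_expR; lra.
have e_le : expR (- u ^+ 2) <= u^-1 ^+ 2.
  have u2 : 0 < u ^+ 2 by rewrite exprn_gt0//; lra.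
  rewrite -(ler_pM2r u2) -exprMn mulVf ?expr1n ?gt_eqF//; last lra.
  have <- : expR (- u ^+ 2) * expR (u ^+ 2) = 1 by rewrite -expRD addNr expR0.
  by rewrite ler_wpM2l// (le_trans _ (expR_ge1Dx _))// lerDr.
split.
  apply: (le_trans tail_sqr).
  apply: (@le_trans _ _ (u^-1 ^+ 2 * (mills_const * u * barPhi u))).
    apply: ler_pM => //; apply: (@le_trans _ _ (expR (- u ^+ 2 / 2))).
      by rewrite ler_expR; nra.
    by apply: expR_le_mills; lra.
  have -> : u^-1 ^+ 2 * (mills_const * u * barPhi u) =
    (u * u^-1) * (mills_const * u^-1 * barPhi u) by ring.
  by rewrite ui mul1r.
have i2 : u^-1 ^+ 2 <= u^-1 / 4 by rewrite expr2 ler_wpM2l// ltW.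
have e_le1 : expR (- u ^+ 2) <= 1 by apply: (le_trans e_le); lra.
by apply: (le_trans tail_sqr); have := ler_pM e0 e0 (le_trans e_le i2) e_le1; lra.
Qed.

Lemma barPhi_le_shift u t s : 4 <= u -> -1 <= t <= u -> t - 4 * u^-1 ^+ 3 <= s ->
  barPhi s <= (1 + 4 * hazard_ub * u^-1 ^+ 2) * barPhi t.
Proof.
move=> /[dup] u4 /inv_ge4[i0 i4 ui] tu ts.
apply: le_trans (nonincreasing_barPhi ts) _.
have ku : 4 * u^-1 ^+ 3 * u = 4 * u^-1 ^+ 2.
  by rewrite exprSr -2!mulrA (mulrC _ u) ui mulr1.
have -> : 4 * hazard_ub * u^-1 ^+ 2 = hazard_ub * (4 * u^-1 ^+ 3 * u) by rewrite ku; ring.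
apply: barPhi_shift_ub tu _ _; [lra|by rewrite mulr_ge0 ?exprn_ge0 ?ltW|].
by rewrite ku; nra.
Qed.

Lemma barPhi_ge_shift u t s : 4 <= u -> -1 <= t <= u - 1 -> s <= t + 4 * u^-1 ^+ 3 ->
  (1 - 4 * hazard_ub * u^-1 ^+ 2) * barPhi t <= barPhi s.
Proof.
move=> /[dup] u4 /inv_ge4[i0 i4 ui] /andP[t1 tu] ts.
set k := 4 * u^-1 ^+ 3 in ts *.
have k0 : 0 <= k by rewrite mulr_ge0 ?exprn_ge0 ?ltW.
have k1 : k <= 1.
  have : u^-1 ^+ 3 <= u^-1 by rewrite -[leRHS]expr1 ler_wiXn2l//; lra.
  by rewrite /k; lra.
have := @barPhi_le_shift u (t + k) t u4.
rewrite addrK => /(_ _ (lexx _)) shift.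
have {}shift := shift ltac:(lra).
set a := 4 * hazard_ub * u^-1 ^+ 2 in shift *.
have a0 : 0 <= a by rewrite mulr_ge0 ?exprn_ge0 ?(ltW i0)// mulr_ge0// ltW ?hazard_ub_gt0.
have le_t : barPhi (t + k) <= barPhi t by apply: nonincreasing_barPhi; lra.
have le_s := nonincreasing_barPhi ts.
have := ler_wpM2l a0 le_t; lra.
Qed.

Lemma relative_error_of_bracket x y u eta a0 b0 c0 : 0 < y -> 0 <= x -> 4 <= u ->
  0 <= eta -> 0 <= a0 -> 0 <= b0 -> 0 <= c0 ->
  x * (1 - u^-1 / 2) <= (1 + 4 * a0 * u^-1 ^+ 2 + b0 * eta) * y ->
  (1 - 4 * a0 * u^-1 ^+ 2 - b0 * eta - c0 * u^-1) * y <= x ->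
  `|x - y| <= (1 + 8 * a0 + 2 * b0 + c0) * (u^-1 + eta) * y.
Proof.
move=> y0 x0 /inv_ge4[]; set i := u^-1 => i0 i4 _ eta0 a_ge0 b_ge0 c_ge0 up lo.
have ai : 0 <= a0 * i by rewrite mulr_ge0// ltW.
have ai2 : a0 * i ^+ 2 <= a0 * i * 4^-1 by rewrite expr2 mulrA ler_wpM2l.
have ci : 0 <= c0 * i by rewrite mulr_ge0// ltW.
have bi : 0 <= b0 * i by rewrite mulr_ge0// ltW.
have be : 0 <= b0 * eta by rewrite mulr_ge0.
have ae : 0 <= a0 * eta by rewrite mulr_ge0.
have ce : 0 <= c0 * eta by rewrite mulr_ge0.
rewrite ler_norml; apply/andP; split.
  suff : (1 - (1 + 8 * a0 + 2 * b0 + c0) * (i + eta)) * y <= x by lra.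
  by apply: le_trans lo; rewrite ler_wpM2r ?(ltW y0)//; lra.
have x_le : x <= (1 + i) * ((1 + 4 * a0 * i ^+ 2 + b0 * eta) * y).
  apply: le_trans (ler_wpM2l _ up); last by lra.
  by have : 0 <= x * (i * (1 - i)) by [rewrite !mulr_ge0//; lra]; lra.
suff : x <= (1 + (1 + 8 * a0 + 2 * b0 + c0) * (i + eta)) * y by lra.
apply: (le_trans x_le); rewrite mulrA ler_wpM2r ?(ltW y0)//.
have : b0 * eta * i <= b0 * eta by rewrite ler_piMr//; lra.
have : a0 * i ^+ 2 * i <= a0 * i ^+ 2 by rewrite ler_piMr ?mulr_ge0 ?sqr_ge0//; lra.
lra.
Qed.

Definition replacement_tail_const : R :=
  replacement_const * (512 * 27) * expR mgf_const * hazard_ub.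

Definition tail_const : R :=
  1 + 8 * hazard_ub + 2 * replacement_tail_const + mills_const.

Lemma replacement_tail_const_ge0 : 0 <= replacement_tail_const.
Proof.
rewrite /replacement_tail_const; apply: mulr_ge0; last exact/ltW/hazard_ub_gt0.
apply: mulr_ge0; last exact: expR_ge0.
by apply: mulr_ge0; [exact: replacement_const_ge0|rewrite mulr_ge0].
Qed.

Lemma tail_const_ge0 : 0 <= tail_const.
Proof.
have := replacement_tail_const_ge0; have := @hazard_ub_gt0 R; have := @mills_const_gt0 R.
by rewrite /tail_const; lra.
Qed.

End tail_arithmetic.

Section sum_tail.
Context {d : measure_display} {T : measurableType d} {R : realType}.
Variable P : probability T R.
Variables (I : finType) (X : I -> {RV P >-> R}) (xi : I -> T -> R).
Variables (b : R) (s e : I -> R).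
Hypothesis X_indep : mutually_independent X.
Hypothesis xi_wrt : forall a, measurable_wrt X [set a]%SET (xi a).
Hypothesis xi_ls : forall a, lindeberg_summand P b (s a) (e a) (xi a).

Local Notation Ex := (Rexpectation P).
Local Notation S := (fun w => \sum_a xi a w).
Local Notation err := (\sum_a e a).

Let bS : bounded_mfun S := bounded_mfun_partial_sum xi_ls (index_enum I).

Let err0 : 0 <= err.
Proof. by apply: sumr_ge0 => a _; exact: summand_err_ge0 (xi_ls a). Qed.

Lemma sum_chernoff (l t : R) : 0 <= l -> l * b <= 1 ->
  fine (P [set w | t <= S w]) <=
  expR (- (l * t) + l ^+ 2 * (\sum_a s a) / 2 + mgf_const * (1 + l) ^+ 3 * err).
Proof.
move=> l0 lb; have mS : measurable [set w | t <= S w].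
  by apply: measurable_set_le => //; exact: bounded_mfun_measurable.
have b_exp : bounded_mfun (fun w => expR (l * S w)) by exact/bounded_mfun_expR/bounded_mfunZ.
apply: le_trans (Rexpectation_markov P b_exp (fun w => expR_ge0 _) mS _ (expR_gt0 (l * t))) _.
  by move=> w /= tS; rewrite ler_expR ler_wpM2l.
rewrite -expRN mulrC -addrA expRD ler_wpM2l ?expR_ge0//.
have := mgf_partial_sum X_indep xi_wrt xi_ls (l := l) (r := index_enum I).
by rewrite (ger0_norm l0); apply => //; exact: index_enum_uniq.
Qed.

Variable u : R.
Hypotheses (s1 : \sum_a s a = 1) (u4 : 4 <= u) (u_err : u ^+ 20 * err <= 1).

Let u1 : 1 <= u. Proof. by apply: le_trans u4; rewrite ler1n. Qed.

Let u0 : 0 < u. Proof. exact: lt_le_trans u1. Qed.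

Let pow_err k j : (k + j <= 20)%N -> 4 ^+ j * (u ^+ k * err) <= 1.
Proof. exact: pow_absorb u4 err0 u_err. Qed.

Let summand_bound (l : R) : `|l| <= 2 * u -> `|l| * b <= 1.
Proof.
move=> lu; have [b0|b0] := leP 0 b; last first.
  by apply: (@le_trans _ _ 0); rewrite ?ler01// mulr_ge0_le0// ltW.
have cube : b * (1 - err) <= err.
  apply: (@le_trans _ _ (\sum_a b * Ex (fun w => xi a w ^+ 2))); last first.
    by apply: ler_sum => a _; exact: summand_cube (xi_ls a).
  rewrite -mulr_sumr ler_wpM2l// -s1 -sumrB; apply: ler_sum => a _.
  by have /ler_normlP[] := summand_var (xi_ls a); lra.
have err_small := @pow_err 0 2 isT; have uerr_small := @pow_err 1 2 isT.
rewrite expr0 expr1 mul1r in err_small uerr_small.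
have b_le : b <= 2 * err.
  have : b * err <= b * 16^-1 by rewrite ler_wpM2l//; lra.
  by lra.
have : `|l| * b <= (2 * u) * (2 * err) by rewrite ler_pM.
by lra.
Qed.

(* The smoothing scale: up to barPhi (2 * u), the indicator of t <= S is bracketed
   by heat (h ^+ 2) (S - t1) with t1 = t - 2 * u * h and t1 = t + 2 * u * h. *)
Local Notation h := (u^-1 ^+ 4).

Let rsqrt_h : rsqrt (h ^+ 2) = u ^+ 4.
Proof.
have [i0 _ _] := inv_ge4 u4.
by rewrite rsqrt_sqr ?exprn_gt0// exprVn invrK.
Qed.

Let h_small : 2 * u * h ^+ 2 <= 2 * u^-1 ^+ 3 /\ (2 * u) ^+ 2 * h ^+ 2 <= 1.
Proof.
have [i0 i4 ui] := inv_ge4 u4; have i1 : u^-1 <= 1 by lra.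
have -> : 2 * u * h ^+ 2 = 2 * (u^-1 ^+ 7 * (u * u^-1)) by ring.
have -> : (2 * u) ^+ 2 * h ^+ 2 = 4 * (u^-1 ^+ 6 * (u * u^-1) ^+ 2) by ring.
rewrite ui expr1n !mulr1; split; first by rewrite ler_wpM2l// ler_wiXn2l// ltW.
have : u^-1 ^+ 6 <= u^-1 by rewrite -[leRHS]expr1 ler_wiXn2l// ltW.
lra.
Qed.

Let replacement_err_le (t t1 : R) : -1 <= t <= u -> `|t1 - t| <= 2 * u^-1 ^+ 3 ->
  `|t1| <= 2 * u ->
  replacement_err t1 (u ^+ 4) err (1 + h ^+ 2) (- t1) <=
  replacement_tail_const * (u ^+ 20 * err) * barPhi t.
Proof.
move=> tu tt1 t1u.
have const_le := heat_const_le u1 t1u.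
have exp_le : expR (mgf_const * (1 + `|t1|) ^+ 3 * err) <= expR mgf_const.
  rewrite ler_expR -mulrA ler_piMr// ?(le_trans ler01 mgf_const_ge1)//.
  have := @pow_err 3 3 isT; apply: le_trans; rewrite mulrA ler_wpM2r// -exprMn.
  by rewrite lerXn2r ?nnegrE ?addr_ge0 ?mulr_ge0 ?(ltW u0)//; have := u1; lra.
have mgf_le : gauss_mgf t1 (1 + h ^+ 2) (- t1) <= hazard_ub * u * barPhi t.
  apply: (@le_trans _ _ (expR (1 + - t ^+ 2 / 2))).
    rewrite ler_expR; have := sqr_shift_le u4 tu tt1.
    have t1_sqr : t1 ^+ 2 <= (2 * u) ^+ 2.
      by rewrite -[leLHS]real_normK ?num_real// lerXn2r ?nnegrE ?mulr_ge0 ?(ltW u0).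
    have := ler_wpM2r (sqr_ge0 h) t1_sqr; case: h_small => _.
    lra.
  have -> : hazard_ub * u * barPhi t = expR 1 * (mills_const * u * barPhi t).
    by rewrite /hazard_ub; ring.
  by rewrite expRD ler_wpM2l ?expR_ge0 ?expR_le_mills.
have -> : replacement_tail_const * (u ^+ 20 * err) * barPhi t =
    replacement_const * (512 * 27 * u ^+ 19) * err * expR mgf_const *
    (hazard_ub * u * barPhi t) by rewrite /replacement_tail_const; ring.
have r0 := @replacement_const_ge0 R; have c0 := heat_const_ge0 t1 (u ^+ 4).
apply: ler_pM mgf_le; [|exact: gauss_mgf_ge0|].
  by apply: mulr_ge0; [exact: mulr_ge0 (mulr_ge0 r0 c0) err0|exact: expR_ge0].
apply: ler_pM exp_le; [exact: mulr_ge0 (mulr_ge0 r0 c0) err0|exact: expR_ge0|].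
by rewrite ler_wpM2r// ler_wpM2l.
Qed.

Let heat_sum_approx (t t1 : R) : -1 <= t <= u -> `|t1 - t| <= 2 * u^-1 ^+ 3 ->
  exists t2, [/\ `|t2 - t1| <= 2 * u^-1 ^+ 3 &
    `|Ex (fun w => heat (h ^+ 2) (S w - t1)) - barPhi t2| <=
    replacement_tail_const * (u ^+ 20 * err) * barPhi t].
Proof.
move=> tu tt1; have [i0 i4 ui] := inv_ge4 u4; have [h_dist h_sqr] := h_small.
have t1u : `|t1| <= 2 * u.
  have : u^-1 ^+ 3 <= u^-1 by rewrite -[leRHS]expr1 ler_wiXn2l//; lra.
  have /ler_normlP[] := tt1; have /andP[] := tu; have := u4.
  by rewrite ler_norml; lra.
have u41 : 1 <= u ^+ 4 by rewrite exprn_ege1.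
have h20 : 0 < h ^+ 2 by rewrite !exprn_gt0.
exists (t1 * rsqrt (1 + h ^+ 2)); split.
  apply: le_trans (mul_rsqrt1D_dist t1 (ltW h20)) _.
  by apply: le_trans h_dist; rewrite ler_wpM2r// ltW.
apply: le_trans (replacement_err_le tu tt1 t1u).
have := heat_partial_sum X_indep xi_wrt xi_ls (summand_bound t1u) u41 h20 _ (- t1)
  (index_enum_uniq I).
rewrite rsqrt_h s1 (addrC (h ^+ 2)) heat_barPhi => /(_ (lexx _)).
under [X in Rexpectation _ X]eq_fun do rewrite addrC.
apply; move: h_sqr; nra.
Qed.

Lemma sum_tail (t : R) : -1 <= t <= u - 1 ->
  `|fine (P [set w | t <= S w]) - barPhi t| <=
  tail_const * (u^-1 + u ^+ 20 * err) * barPhi t.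
Proof.
move=> tu; have /andP[tm tu1] := tu; have [i0 i4 ui] := inv_ge4 u4.
have tu' : -1 <= t <= u by lra.
have mS := bounded_mfun_measurable bS.
have h0 : 0 < h by rewrite exprn_gt0.
have hk : h * (2 * u) = 2 * u^-1 ^+ 3 by rewrite -[RHS]mulr1 -ui; ring.
have i3 : 0 <= u^-1 ^+ 3 by rewrite exprn_ge0// ltW.
have [bar_mills bar_small] := barPhi_double u4.
have B0 := barPhi_gt0 t.
have eta0 : 0 <= u ^+ 20 * err by rewrite mulr_ge0// exprn_ge0 ?ltW.
apply: (relative_error_of_bracket B0 (fine_ge0 (measure_ge0 P _)) u4 eta0
  (ltW hazard_ub_gt0) replacement_tail_const_ge0 (ltW mills_const_gt0)).
- have [|t2 [t2_near approx]] := @heat_sum_approx t (t - h * (2 * u)) tu'.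
    by rewrite hk addrAC subrr sub0r normrN ger0_norm// mulr_ge0.
  have := prob_ge_le_heat P t (2 * u) mS h0.
  have := @barPhi_le_shift _ u t t2 u4 tu'; move: t2_near approx; rewrite hk.
  move=> /ler_normlP[t2_lo _] /ler_normlP[_ approx] shift.
  have {}shift := shift ltac:(lra).
  have := ler_wpM2l (fine_ge0 (measure_ge0 P [set w | t <= S w])) bar_small.
  by lra.
- have [|t2 [t2_near approx]] := @heat_sum_approx t (t + h * (2 * u)) tu'.
    by rewrite hk (addrC t) addrK ger0_norm// mulr_ge0.
  have := heat_le_prob_ge P t (2 * u) mS h0.
  have := @barPhi_ge_shift _ u t t2 u4 tu; move: t2_near approx; rewrite hk.
  move=> /ler_normlP[_ t2_hi] /ler_normlP[approx _] shift.
  have {}shift := shift ltac:(lra).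
  have u_le : barPhi u <= barPhi t by apply: nonincreasing_barPhi; lra.
  have c0 : 0 <= mills_const * u^-1 by rewrite mulr_ge0 ?ltW ?mills_const_gt0.
  by have := ler_wpM2l c0 u_le; lra.
Qed.

End sum_tail.

(** * Truncated observations *)

Section truncation.
Context {R : realType}.
Implicit Types B y p q : R.

Definition trunc B y : R := if `|y| <= B then y else 0.

Lemma measurable_trunc B : measurable_fun setT (trunc B).
Proof. by apply: measurable_fun_if => //; exact: measurable_fun_ler. Qed.

Lemma trunc_le B y : 0 <= B -> `|trunc B y| <= B.
Proof. by move=> B0; rewrite /trunc; case: ifP => //; rewrite normr0. Qed.

Lemma trunc_sqr_le B y : 0 <= B -> trunc B y ^+ 2 <= B ^+ 2.
Proof.
by move=> B0; rewrite -[leLHS]real_normK ?num_real// lerXn2r ?nnegrE ?trunc_le.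
Qed.

Lemma trunc_id B y : `|y| <= B -> trunc B y = y.
Proof. by rewrite /trunc => ->. Qed.

Lemma trunc_eq0 B y : B < `|y| -> trunc B y = 0.
Proof. by rewrite /trunc ltNge => /negbTE ->. Qed.

Lemma powRD_gt0 y p q : 0 < y -> y `^ (p + q) = y `^ p * y `^ q.
Proof. by move=> y0; rewrite powRD// (gt_eqF y0) implybT. Qed.

Lemma powR_tail_le B y p q : 0 < B -> B < `|y| -> q <= p ->
  `|y| `^ q <= B `^ (q - p) * `|y| `^ p.
Proof.
move=> B0 By qp; have y0 : 0 < `|y| by exact: lt_trans By.
have yp : `|y| `^ p = `|y| `^ q * `|y| `^ (p - q).
  by rewrite -powRD_gt0// addrC subrK.
have Bpq : B `^ (q - p) * B `^ (p - q) = 1.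
  by rewrite -powRD_gt0// -opprB addNr powRr0.
rewrite yp mulrCA -[leLHS]mulr1 ler_wpM2l ?powR_ge0// -Bpq ler_wpM2l ?powR_ge0//.
by apply: ge0_ler_powR; rewrite ?nnegrE ?subr_ge0// ltW.
Qed.

End truncation.

Section standardized.
Context {d : measure_display} {T : measurableType d} {R : realType}.
Variable P : probability T R.

Local Notation Ex := (Rexpectation P).

Lemma sqr_integrable_integrable (Y : T -> R) : measurable_fun setT Y ->
  (\int[P]_w (Y w ^+ 2)%:E < +oo)%E -> P.-integrable setT (EFin \o Y).
Proof.
move=> mY EY2.
have iY2 : P.-integrable setT (EFin \o (fun w => Y w ^+ 2)).
  apply/integrableP; split; first by apply/measurable_EFinP; exact: measurable_funX.
  by under eq_integral do rewrite /= ger0_norm ?sqr_ge0//.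
have i1 := bounded_mfun_integrable P (@bounded_mfun_cst _ T _ (1 : R)).
apply: le_integrable (integrableD measurableT i1 iY2) => //; first exact/measurable_EFinP.
move=> w _ /=; rewrite lee_fin [leRHS]ger0_norm; last by rewrite addr_ge0 ?sqr_ge0.
by rewrite -(real_normK (num_real (Y w))); have := normr_ge0 (Y w); nra.
Qed.

Record standardized (p K : R) (Y : T -> R) : Prop := Standardized {
  standardized_measurable : measurable_fun setT Y ;
  standardized_mean : (\int[P]_w (Y w)%:E = 0)%E ;
  standardized_var : (\int[P]_w (Y w ^+ 2)%:E = 1)%E ;
  standardized_moment : (\int[P]_w (`|Y w| `^ p)%:E <= K%:E)%E
}.

Variables (Y : T -> R) (p K B : R).
Hypotheses (Y_std : standardized p K Y) (p2 : 2 <= p) (B0 : 0 < B).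

Let mY : measurable_fun setT Y := standardized_measurable Y_std.

Let iY : P.-integrable setT (EFin \o Y).
Proof. by apply: sqr_integrable_integrable => //; rewrite (standardized_var Y_std) ltry. Qed.

Let iYp : P.-integrable setT (EFin \o (fun w => `|Y w| `^ p)).
Proof.
apply/integrableP; split.
  apply/measurable_EFinP; apply: (measurableT_comp (measurable_powR p)).
  exact: measurableT_comp.
under eq_integral do rewrite /= ger0_norm ?powR_ge0//.
exact: le_lt_trans (standardized_moment Y_std) (ltry K).
Qed.

Let iY2 : P.-integrable setT (EFin \o (fun w => Y w ^+ 2)).
Proof.
apply/integrableP; split; first by apply/measurable_EFinP; exact: measurable_funX.
by under eq_integral do rewrite /= ger0_norm ?sqr_ge0//; rewrite (standardized_var Y_std) ltry.
Qed.

Lemma trunc_bounded : bounded_mfun (fun w => trunc B (Y w)).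
Proof.
split; first exact: (measurableT_comp (measurable_trunc B)).
by exists B => w; rewrite trunc_le// ltW.
Qed.

Lemma tail_moment_le (f : T -> R) (q : R) : q <= p -> P.-integrable setT (EFin \o f) ->
  (forall w, `|Y w| <= B -> f w = 0) -> (forall w, B < `|Y w| -> `|f w| <= `|Y w| `^ q) ->
  `|Ex f| <= K * B `^ (q - p).
Proof.
move=> qp intf f0 f_le.
apply: le_trans (le_normr_Rintegral _ intf) _ => //.
apply: (@le_trans _ _ (\int[P]_w (B `^ (q - p) * `|Y w| `^ p))%R); last first.
  rewrite RintegralZl// mulrC ler_wpM2r ?powR_ge0// -lee_fin /Rintegral fineK.
    exact: standardized_moment Y_std.
  exact: integrable_fin_num.
apply: le_Rintegral => //; [exact: integrable_norm intf|exact: (integrableZl _ _ iYp)|].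
move=> w _; have [YB|BY] := leP `|Y w| B; first by rewrite f0// normr0 mulr_ge0 ?powR_ge0.
exact: le_trans (f_le _ BY) (powR_tail_le B0 BY qp).
Qed.

Lemma trunc_mean_le : `|Ex (fun w => trunc B (Y w))| <= K * B `^ (1 - p).
Proof.
have iT := bounded_mfun_integrable P trunc_bounded.
have -> : Ex (fun w => trunc B (Y w)) = - Ex (fun w => Y w - trunc B (Y w)).
  rewrite /Rexpectation RintegralB// [X in - (X - _)](_ : _ = 0) ?sub0r ?opprK//.
  by rewrite /Rintegral (standardized_mean Y_std).
rewrite normrN; apply: tail_moment_le; first by apply: le_trans p2; rewrite ler1n.
- exact: (integrableB _ iY iT).
- by move=> w YB; rewrite trunc_id// subrr.
- by move=> w BY; rewrite trunc_eq0// subr0 powRr1.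
Qed.

Lemma trunc_sqr_mean_le1 : Ex (fun w => trunc B (Y w) ^+ 2) <= 1.
Proof.
have -> : 1 = Ex (fun w => Y w ^+ 2).
  by rewrite /Rexpectation /Rintegral (standardized_var Y_std).
apply: le_Rintegral => //; first exact/bounded_mfun_integrable/bounded_mfunX/trunc_bounded.
move=> w _; have [YB|BY] := leP `|Y w| B; first by rewrite trunc_id.
by rewrite trunc_eq0// expr0n sqr_ge0.
Qed.

Lemma trunc_sqr_mean_dist :
  `|Ex (fun w => trunc B (Y w) ^+ 2) - 1| <= K * B `^ (2 - p).
Proof.
have iT2 := bounded_mfun_integrable P (bounded_mfunX 2 trunc_bounded).
have -> : Ex (fun w => trunc B (Y w) ^+ 2) - 1 =
    - Ex (fun w => Y w ^+ 2 - trunc B (Y w) ^+ 2).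
  rewrite /Rexpectation RintegralB// opprB; congr (_ - _).
  by rewrite /Rintegral (standardized_var Y_std).
rewrite normrN; apply: tail_moment_le => //.
- exact: (integrableB _ iY2 iT2).
- by move=> w YB; rewrite trunc_id// subrr.
- by move=> w BY; rewrite trunc_eq0// expr0n/= subr0 normrX powR_mulrn.
Qed.

Lemma standardized_tail_le : fine (P [set w | B < `|Y w|]) <= K * B `^ (- p).
Proof.
have mA : measurable [set w | B < `|Y w|].
  by apply: measurable_set_lt => //; exact: measurableT_comp.
rewrite -Rexpectation_indic// -sub0r; apply: le_trans (ler_norm _) _.
apply: tail_moment_le; first by apply: le_trans p2; rewrite ler0n.
- exact: (bounded_mfun_integrable P (bounded_mfun_indic mA)).
- by move=> w YB; rewrite indicE memNset//= ltNge YB.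
- by move=> w BY; rewrite indicE powRr0 ger0_norm// lern1 leq_b1.
Qed.

End standardized.

Section standardized_observations.
Context {R : realType}.
Variables (E : experiment R) (p K : R).
Local Notation m := (ngroups E).
Local Notation idx := {i : 'I_m & 'I_(gsize i)}.
Local Notation P := (prob E).
Implicit Types (i : 'I_m) (z : idx) (w : space E).

Definition tagged_obs z : {RV P >-> R} := obs (tagged z).

Definition standardize i (x : R) : R := (x - mean i) / sd i.

Definition std_obs z w : R := standardize (tag z) (tagged_obs z w).

Definition std_moment_le : Prop := forall i,
  ('E_P[fun w => (`|(obs1 i w - mean i) / sd i| `^ p)%R] <= K%:E)%E.

Lemma tagged_obs_independent : mutually_independent tagged_obs.
Proof. exact: obs_independent. Qed.

Lemma measurable_standardize i : measurable_fun setT (standardize i).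
Proof. by apply: measurable_funM => //; exact: measurable_funB. Qed.

Lemma measurable_std_obs z : measurable_fun setT (std_obs z).
Proof. exact: (measurableT_comp (measurable_standardize _)). Qed.

Lemma obs_standardize i (k : 'I_(gsize i)) w :
  obs k w = mean i + sd i * standardize i (obs k w).
Proof. by rewrite /standardize; field; rewrite gt_eqF// sd_gt0. Qed.

Lemma std_obs_var z : (\int[P]_w (std_obs z w ^+ 2)%:E = 1)%E.
Proof.
have var_obs : (\int[P]_w ((tagged_obs z w - mean (tag z)) ^+ 2)%:E =
    (sd (tag z) ^+ 2)%:E)%E.
  have := obs_variance (tagged z); rewrite /variance unlock obs_mean/= unlock => <-.
  by apply: eq_integral => w _; rewrite expr2.
have m_sqr : measurable_fun setT (fun w => ((tagged_obs z w - mean (tag z)) ^+ 2)%:E).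
  by apply/measurable_EFinP; apply: measurable_funX; exact: measurable_funB.
under eq_integral do rewrite /std_obs /standardize exprMn exprVn mulrC EFinM.
rewrite ge0_integralZl//=; last 2 first.
- by move=> w _; rewrite lee_fin sqr_ge0.
- by rewrite lee_fin invr_ge0 sqr_ge0.
by rewrite var_obs -EFinM mulVf// expf_neq0// gt_eqF// sd_gt0.
Qed.

Lemma std_obs_mean z : (\int[P]_w (std_obs z w)%:E = 0)%E.
Proof.
have iY : P.-integrable setT (EFin \o std_obs z).
  by apply: sqr_integrable_integrable; [exact: measurable_std_obs|rewrite std_obs_var ltry].
have := obs_mean (tagged z); rewrite unlock.
under eq_integral do rewrite obs_standardize addrC EFinD EFinM.
rewrite integralD//=; last 2 first.
- exact: (integrableZl _ (sd (tag z)) iY).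
- exact: (bounded_mfun_integrable P (bounded_mfun_cst (mean (tag z)))).
rewrite (integralZl _ iY)//= integral_cst//= probability_setT mule1.
have : (\int[P]_w (std_obs z w)%:E)%E \is a fin_num by exact: integrable_fin_num.
rewrite /std_obs /tagged_obs/=; case: (\int[P]_w _)%E => //= r _ [].
by rewrite -[RHS]add0r => /addIr/eqP; rewrite mulf_eq0 gt_eqF ?sd_gt0//= => /eqP ->.
Qed.

Hypothesis moment_le : std_moment_le.

Lemma std_obs_moment z : (\int[P]_w (`|std_obs z w| `^ p)%:E <= K%:E)%E.
Proof.
have := moment_le (tag z); rewrite unlock; apply: le_trans.
pose h (x : R) : \bar R := (`|standardize (tag z) x| `^ p)%:E.
have mh : measurable_fun setT h.
  apply/measurable_EFinP; apply: (measurableT_comp (measurable_powR p)).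
  by apply: measurableT_comp => //; exact: measurable_standardize.
have h0 x : (0 <= h x)%E by rewrite lee_fin powR_ge0.
rewrite -(ge0_integral_distribution (tagged_obs z) mh h0).
rewrite -[leRHS](ge0_integral_distribution (obs1 (tag z)) mh h0).
rewrite (@eq_measure_integral _ _ _ _ (distribution P (obs1 (tag z))))//.
by move=> A mA _; exact: obs_identical.
Qed.

Lemma std_obs_standardized z : standardized P p K (std_obs z).
Proof.
split; [exact: measurable_std_obs|exact: std_obs_mean|exact: std_obs_var|].
exact: std_obs_moment.
Qed.

End standardized_observations.

Section weighted_sums.
Context {R : realType}.
Variable E : experiment R.
Local Notation m := (ngroups E).
Local Notation idx := {i : 'I_m & 'I_(gsize i)}.
Local Notation N i := ((gsize i)%:R : R).
Local Notation P := (prob E).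
Local Notation Ex := (Rexpectation P).
Implicit Types (psi : R -> R) (c : 'I_m -> R) (g : R) (z : idx) (w : space E).

Definition weighted_sum psi c w : R := \sum_(z : idx) c (tag z) * psi (std_obs z w).

Definition weighted_norm1 c : R := \sum_i N i * `|c i|.
Definition weighted_norm2 c : R := \sum_i N i * c i ^+ 2.

Lemma weighted_norm1_ge0 c : 0 <= weighted_norm1 c.
Proof. by apply: sumr_ge0 => i _; rewrite mulr_ge0. Qed.

Lemma weighted_norm2_ge0 c : 0 <= weighted_norm2 c.
Proof. by apply: sumr_ge0 => i _; rewrite mulr_ge0 ?sqr_ge0. Qed.

Lemma weighted_sumD psi c1 c2 w :
  weighted_sum psi (fun i => c1 i + c2 i) w =
  weighted_sum psi c1 w + weighted_sum psi c2 w.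
Proof.
by rewrite /weighted_sum -big_split/=; apply: eq_bigr => z _; rewrite mulrDl.
Qed.

Lemma sum_tag (F : 'I_m -> R) : \sum_(z : idx) F (tag z) = \sum_i N i * F i.
Proof.
rewrite -(sig_big_dep xpredT (fun i => xpredT) (fun i _ => F i))/=.
by apply: eq_bigr => i _; rewrite sumr_const card_ord mulr_natl.
Qed.

Lemma measurable_wrt_weighted psi c z : measurable_fun setT psi ->
  measurable_wrt (@tagged_obs R E) [set z]%SET (fun w => c (tag z) * psi (std_obs z w)).
Proof.
move=> mpsi.
have mg : measurable_fun setT (fun x => c (tag z) * psi (standardize (tag z) x)).
  apply: measurable_funM => //; apply: (measurableT_comp mpsi).
  exact: measurable_standardize.
exact: (@measurable_wrt_comp _ _ _ P _ (@tagged_obs R E) _ z mg).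
Qed.

Lemma measurable_wrt_weighted_sum psi c (J : {set idx}) : measurable_fun setT psi ->
  (forall z, z \notin J -> c (tag z) = 0) ->
  measurable_wrt (@tagged_obs R E) J (weighted_sum psi c).
Proof.
move=> mpsi cJ; apply: measurable_wrt_sum => z _.
have [zJ|/cJ c0] := boolP (z \in J).
  by apply: measurable_wrt_sub (@measurable_wrt_weighted psi c z mpsi); rewrite finset.sub1set.
rewrite (_ : (fun w => _) = cst 0); first exact: measurable_cst.
by apply/funext => w; rewrite c0 mul0r.
Qed.

Lemma measurable_weighted_sum psi c :
  measurable_fun setT psi -> measurable_fun setT (weighted_sum psi c).
Proof.
move=> mpsi; apply: (measurable_wrt_measurable (J := [set: idx]%SET)).
by apply: measurable_wrt_weighted_sum => // z; rewrite inE.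
Qed.

Record controlled_statistic (psi : R -> R) (b bias v dist M : R) : Prop :=
  ControlledStatistic {
  statistic_measurable : measurable_fun setT psi ;
  statistic_le : forall y, `|psi y| <= b ;
  statistic_mean : forall z, `|Ex (fun w => psi (std_obs z w))| <= bias ;
  statistic_var : forall z, `|Ex (fun w => psi (std_obs z w) ^+ 2) - v| <= dist ;
  statistic_sqr : forall z, Ex (fun w => psi (std_obs z w) ^+ 2) <= M ;
  statistic_var_ge0 : 0 <= v
}.

Section controlled.
Variables (psi : R -> R) (b bias v dist M : R).
Hypothesis psi_ctl : controlled_statistic psi b bias v dist M.
Variables (c : 'I_m -> R) (g : R).
Hypothesis c_le : forall i, `|c i| <= g.

Definition sqr_err : R := dist + g * b * M + g ^+ 2 * v ^+ 2.

Definition weighted_err : R := weighted_norm1 c * bias + weighted_norm2 c * sqr_err.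

Let summand_err z := `|c (tag z)| * bias + c (tag z) ^+ 2 * sqr_err.

Let sum_err : \sum_z summand_err z = weighted_err.
Proof.
rewrite /summand_err (sum_tag (fun i => `|c i| * bias + c i ^+ 2 * sqr_err)).
rewrite /weighted_err !mulr_suml -big_split/=.
by apply: eq_bigr => i _; ring.
Qed.

Let sum_var : \sum_(z : idx) c (tag z) ^+ 2 * v = weighted_norm2 c * v.
Proof. by rewrite -mulr_suml (sum_tag (fun i => c i ^+ 2)). Qed.

Let weighted_summand z : lindeberg_summand P (g * b) (c (tag z) ^+ 2 * v) (summand_err z)
  (fun w => c (tag z) * psi (std_obs z w)).
Proof.
have [mpsi psi_le mean_le var_le sqr_le v0] := psi_ctl.
have g0 : 0 <= g by exact: le_trans (c_le (tag z)).
have b0 : 0 <= b by exact: le_trans (psi_le 0).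
have b_psi : bounded_mfun (fun w => psi (std_obs z w)).
  split; last by exists b.
  by apply: (measurableT_comp mpsi); exact: measurable_std_obs.
have M0 : 0 <= M.
  by apply: le_trans (sqr_le z); apply: Rexpectation_ge0 => w; exact: sqr_ge0.
have bias0 : 0 <= bias by exact: le_trans (mean_le z).
have dist0 : 0 <= dist by exact: le_trans (var_le z).
have c2_le : c (tag z) ^+ 2 <= g ^+ 2.
  by rewrite -[leLHS]real_normK ?num_real// lerXn2r ?nnegrE.
have gbM : 0 <= g * b * M by rewrite !mulr_ge0.
have gv : 0 <= g ^+ 2 * v ^+ 2 by rewrite mulr_ge0 ?sqr_ge0.
have cb0 : 0 <= `|c (tag z)| * bias by rewrite mulr_ge0.
have sqr_err_le x : x <= sqr_err -> c (tag z) ^+ 2 * x <= summand_err z.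
  by move=> xs; apply: ler_wpDl => //; rewrite ler_wpM2l ?sqr_ge0.
have c_sqr : Ex (fun w => (c (tag z) * psi (std_obs z w)) ^+ 2) =
    c (tag z) ^+ 2 * Ex (fun w => psi (std_obs z w) ^+ 2).
  rewrite -RexpectationZ; last exact: bounded_mfunX.
  by congr (Rexpectation P _); apply/funext => w; rewrite exprMn.
split.
- apply: measurable_funM => //; exact: bounded_mfun_measurable b_psi.
- by move=> w; rewrite normrM ler_pM.
- rewrite RexpectationZ// normrM; apply: ler_wpDr; last by rewrite ler_wpM2l.
  by rewrite mulr_ge0 ?sqr_ge0// !addr_ge0.
- rewrite c_sqr -mulrBr normrM ger0_norm ?sqr_ge0//.
  apply: sqr_err_le; apply: le_trans (var_le z) _.
  by rewrite /sqr_err -addrA lerDl addr_ge0.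
- rewrite c_sqr mulrCA; apply: sqr_err_le.
  apply: (@le_trans _ _ (g * b * M)); first by rewrite ler_wpM2l ?mulr_ge0.
  by rewrite /sqr_err; lra.
- by rewrite mulr_ge0 ?sqr_ge0.
- rewrite exprMn [X in X * _]expr2 -mulrA; apply: sqr_err_le.
  apply: (@le_trans _ _ (g ^+ 2 * v ^+ 2)); first by rewrite ler_wpM2r ?sqr_ge0.
  by rewrite /sqr_err; lra.
Qed.

Let summand_wrt z : measurable_wrt (@tagged_obs R E) [set z]%SET
  (fun w => c (tag z) * psi (std_obs z w)).
Proof. exact: measurable_wrt_weighted (statistic_measurable psi_ctl). Qed.

Lemma weighted_sum_chernoff (l t : R) : 0 <= l -> l * (g * b) <= 1 ->
  fine (P [set w | t <= weighted_sum psi c w]) <=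
  expR (- (l * t) + l ^+ 2 * (weighted_norm2 c * v) / 2 +
    mgf_const * (1 + l) ^+ 3 * weighted_err).
Proof.
move=> l0 lb; rewrite -sum_err -sum_var.
exact: (sum_chernoff (@tagged_obs_independent R E) summand_wrt weighted_summand).
Qed.

Lemma weighted_sum_tail (u t : R) : weighted_norm2 c * v = 1 -> 4 <= u ->
  u ^+ 20 * weighted_err <= 1 -> -1 <= t <= u - 1 ->
  `|fine (P [set w | t <= weighted_sum psi c w]) - barPhi t| <=
  tail_const * (u^-1 + u ^+ 20 * weighted_err) * barPhi t.
Proof.
rewrite -sum_err -sum_var => norm1 u4 u_err tu.
exact: (sum_tail (@tagged_obs_independent R E) summand_wrt weighted_summand).
Qed.

End controlled.

Section truncated_statistics.
Variables (p K B : R).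
Hypotheses (moment_le : std_moment_le E p K) (p2 : 2 <= p) (B0 : 0 < B).

Definition centered_sqr (B y : R) : R := trunc B y ^+ 2 - 1.

Let std z : standardized P p K (std_obs z) := std_obs_standardized moment_le z.

Let b_trunc z : bounded_mfun (fun w => trunc B (std_obs z w)) := trunc_bounded (std z) B0.

Lemma trunc_controlled :
  controlled_statistic (trunc B) B (K * B `^ (1 - p)) 1 (K * B `^ (2 - p)) 1.
Proof.
split => //.
- exact: measurable_trunc.
- by move=> y; rewrite trunc_le// ltW.
- by move=> z; exact: trunc_mean_le (std z) p2 B0.
- by move=> z; exact: trunc_sqr_mean_dist (std z) p2 B0.
- by move=> z; exact: trunc_sqr_mean_le1 (std z) B0.
Qed.

(* Here the second moment is only bounded: centered_sqr is used at moderate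
   deviations, where its variance is negligible. *)
Lemma centered_sqr_controlled :
  controlled_statistic (centered_sqr B) (B ^+ 2 + 1) (K * B `^ (2 - p)) 0
    (B ^+ 2 + 1) (B ^+ 2 + 1).
Proof.
have sqr_le y := trunc_sqr_le y (ltW B0).
have centered_le y : `|centered_sqr B y| <= B ^+ 2 + 1.
  by have := sqr_le y; have := sqr_ge0 (trunc B y); rewrite ler_norml /centered_sqr; lra.
have b_sqr z := bounded_mfunX 2 (b_trunc z).
have b_cst := @bounded_mfun_cst _ (space E) R 1.
have b_centered z : bounded_mfun (fun w => centered_sqr B (std_obs z w)).
  exact: bounded_mfunB.
have var_le z : Ex (fun w => centered_sqr B (std_obs z w) ^+ 2) <= B ^+ 2 + 1.
  apply: (@le_trans _ _ (Ex (fun w => B ^+ 2 * trunc B (std_obs z w) ^+ 2 + 1))).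
    apply: le_Rexpectation; [exact: bounded_mfunX|exact/bounded_mfunD/b_cst/bounded_mfunZ|].
    move=> w; have := sqr_le (std_obs z w); have := sqr_ge0 (trunc B (std_obs z w)).
    by rewrite /centered_sqr; move: (trunc B _ ^+ 2) (B ^+ 2) => x y; nra.
  rewrite RexpectationD// ?(Rexpectation_cst P 1) ?lerD2r; last exact: bounded_mfunZ.
  rewrite RexpectationZ// ler_piMr ?sqr_ge0//.
  exact: trunc_sqr_mean_le1 (std z) B0.
split => //.
- apply: measurable_funB => //; apply: measurable_funX; exact: measurable_trunc.
- move=> z; rewrite /centered_sqr RexpectationB// (Rexpectation_cst P 1).
  exact: trunc_sqr_mean_dist (std z) p2 B0.
- move=> z; rewrite subr0 ger0_norm ?var_le//.
  by apply: Rexpectation_ge0 => w; exact: sqr_ge0.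
Qed.

Lemma std_obs_tail_le z : fine (P [set w | B < `|std_obs z w|]) <= K * B `^ (- p).
Proof. exact: standardized_tail_le (std z) p2 B0. Qed.

End truncated_statistics.
End weighted_sums.

(** * Pair statistics *)

Lemma pair_swap_inj (T : Type) : injective (fun x : T * T => (x.2, x.1)).
Proof. by move=> [a b] [c d] [-> ->]. Qed.

Section contrasts.
Context {R : realType} {m : nat}.
Implicit Types (a i : 'I_m) (x y : 'I_m * 'I_m) (h : 'I_m -> R).

Lemma sum_indicator a h : \sum_i (i == a)%:R * h i = h a.
Proof.
rewrite (bigD1 a)//= eqxx mul1r big1 ?addr0// => i /negbTE ->.
by rewrite mul0r.
Qed.

Definition contrast x i : R := (i == x.1)%:R - (i == x.2)%:R.

Lemma contrast_eq0 x i : i != x.1 -> i != x.2 -> contrast x i = 0.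
Proof. by rewrite /contrast => /negbTE -> /negbTE ->; rewrite subrr. Qed.

Definition disjoint_pairs x y : bool :=
  [&& x.1 != y.1, x.1 != y.2, x.2 != y.1 & x.2 != y.2].

Lemma sum_contrast x h : \sum_i contrast x i * h i = h x.1 - h x.2.
Proof. by under eq_bigr do rewrite mulrBl; rewrite sumrB !sum_indicator. Qed.

Lemma sum_contrast_mul x y h : \sum_i contrast x i * contrast y i * h i =
  (x.1 == y.1)%:R * h x.1 - (x.1 == y.2)%:R * h x.1 -
  (x.2 == y.1)%:R * h x.2 + (x.2 == y.2)%:R * h x.2.
Proof.
by under eq_bigr do rewrite -mulrA; rewrite sum_contrast /contrast; ring.
Qed.

End contrasts.

Section pair_weights.
Context {R : realType}.
Variable E : experiment R.
Local Notation m := (ngroups E).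
Local Notation N i := ((gsize i)%:R : R).
Implicit Types (i : 'I_m) (x y : 'I_m * 'I_m).

Lemma gsize_gt0 i : 0 < N i.
Proof. by rewrite ltr0n; apply: leq_trans (gsize_ge2 i). Qed.

Lemma gsize_neq0 i : N i != 0.
Proof. by rewrite gt_eqF ?gsize_gt0. Qed.

Definition mean_var i : R := sd i ^+ 2 / N i.
Definition diff_sd x : R := Num.sqrt (mean_var x.1 + mean_var x.2).
Definition pair_weight x i : R := contrast x i * (sd i / (N i * diff_sd x)).

Lemma mean_var_gt0 i : 0 < mean_var i.
Proof. by rewrite divr_gt0 ?gsize_gt0 ?exprn_gt0 ?sd_gt0. Qed.

Lemma diff_sd_gt0 x : 0 < diff_sd x.
Proof. by rewrite sqrtr_gt0 addr_gt0 ?mean_var_gt0. Qed.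

Lemma diff_sd_sqr x : diff_sd x ^+ 2 = mean_var x.1 + mean_var x.2.
Proof. by rewrite sqr_sqrtr// ltW// addr_gt0 ?mean_var_gt0. Qed.

Lemma sum_pair_weight x (h : 'I_m -> R) : \sum_i pair_weight x i * h i =
  (sd x.1 * h x.1 / N x.1 - sd x.2 * h x.2 / N x.2) / diff_sd x.
Proof.
have d0 : diff_sd x != 0 by rewrite gt_eqF ?diff_sd_gt0.
under eq_bigr do rewrite /pair_weight -mulrA; rewrite sum_contrast.
have N1 := gsize_neq0 x.1; have N2 := gsize_neq0 x.2.
by field; apply/and3P.
Qed.

Lemma pair_weight_mul x y i : N i * (pair_weight x i * pair_weight y i) =
  contrast x i * contrast y i * (mean_var i / (diff_sd x * diff_sd y)).
Proof.
have ? : diff_sd x != 0 by rewrite gt_eqF ?diff_sd_gt0.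
have ? : diff_sd y != 0 by rewrite gt_eqF ?diff_sd_gt0.
have ? := gsize_neq0 i.
by rewrite /pair_weight /mean_var; field; apply/and3P.
Qed.

Lemma pair_weight_norm2 x : x.1 != x.2 -> weighted_norm2 (pair_weight x) = 1.
Proof.
move=> x12; rewrite /weighted_norm2; under eq_bigr do rewrite expr2 pair_weight_mul.
rewrite sum_contrast_mul !eqxx (negbTE x12) eq_sym (negbTE x12) !mul1r !mul0r !subr0.
by rewrite -mulrDl -expr2 -diff_sd_sqr divff// expf_neq0// gt_eqF// diff_sd_gt0.
Qed.

Section correlation.
Variable rho : R.
Hypotheses (rho0 : 0 <= rho).
Hypothesis var_share : forall i j, i != j -> mean_var i <= rho * (mean_var i + mean_var j).

Let shared_corr x y i : mean_var i <= rho * diff_sd x ^+ 2 ->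
  mean_var i <= rho * diff_sd y ^+ 2 -> mean_var i / (diff_sd x * diff_sd y) <= rho.
Proof.
move=> vx vy; have v0 := mean_var_gt0 i.
have dxy : 0 < diff_sd x * diff_sd y by rewrite mulr_gt0 ?diff_sd_gt0.
have r0 : 0 <= rho * (diff_sd x * diff_sd y) by rewrite mulr_ge0 ?(ltW dxy).
rewrite ler_pdivrMr// -(@ler_sqr _ (mean_var i)) ?nnegrE ?(ltW v0)//.
have -> : (rho * (diff_sd x * diff_sd y)) ^+ 2 =
  (rho * diff_sd x ^+ 2) * (rho * diff_sd y ^+ 2) by ring.
by rewrite expr2 ler_pM// ltW.
Qed.

Let share1 x : x.1 != x.2 -> mean_var x.1 <= rho * diff_sd x ^+ 2.
Proof. by move=> x12; rewrite diff_sd_sqr var_share. Qed.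

Let share2 x : x.1 != x.2 -> mean_var x.2 <= rho * diff_sd x ^+ 2.
Proof. by move=> x12; rewrite diff_sd_sqr addrC var_share// eq_sym. Qed.

Lemma pair_weight_corr x y : x.1 != x.2 -> y.1 != y.2 -> y != x ->
  \sum_i N i * (pair_weight x i * pair_weight y i) <= rho.
Proof.
move=> x12 y12 yx; under eq_bigr do rewrite pair_weight_mul.
rewrite sum_contrast_mul.
have cross i (b : bool) : 0 <= b%:R * (mean_var i / (diff_sd x * diff_sd y)).
  have d0 v := ltW (diff_sd_gt0 v).
  apply: mulr_ge0 => //.
  by apply: divr_ge0; [exact/ltW/mean_var_gt0|exact: mulr_ge0].
have c1 := cross x.1 (x.1 == y.2); have c2 := cross x.2 (x.2 == y.1).
have [x1y1|_] := eqVneq x.1 y.1; have [x2y2|_] := eqVneq x.2 y.2.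
- by move: yx; rewrite [x]surjective_pairing [y]surjective_pairing x1y1 x2y2 eqxx.
- have : mean_var x.1 / (diff_sd x * diff_sd y) <= rho.
    by apply: shared_corr; [exact: share1|rewrite x1y1; exact: share1].
  by rewrite mul1r mul0r; lra.
- have : mean_var x.2 / (diff_sd x * diff_sd y) <= rho.
    by apply: shared_corr; [exact: share2|rewrite x2y2; exact: share2].
  by rewrite mul1r mul0r; lra.
- by rewrite !mul0r; have := rho0; lra.
Qed.

End correlation.

Section weight_bounds.
Variables (g s : R).
Hypotheses (g0 : 0 <= g) (size_lb : forall i, 1 <= g ^+ 2 * N i).
Hypotheses (s0 : 0 <= s) (size_ub : forall i, N i <= s ^+ 2).

Lemma weight_le (a : R) i : N i * a ^+ 2 <= 1 -> `|a| <= g.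
Proof.
move=> Na; rewrite -(@ler_sqr _ `|a|) ?nnegrE// real_normK ?num_real//.
have : a ^+ 2 <= g ^+ 2 * (N i * a ^+ 2) by rewrite mulrA ler_peMl ?sqr_ge0.
by move=> /le_trans; apply; rewrite ler_piMr ?sqr_ge0.
Qed.

Lemma size_weight_le (a : R) i : N i * a ^+ 2 <= 1 -> N i * `|a| <= s.
Proof.
move=> Na; rewrite -(@ler_sqr _ (N i * `|a|)) ?nnegrE ?mulr_ge0//.
rewrite exprMn real_normK ?num_real// expr2 -mulrA.
by apply: le_trans (size_ub i); rewrite ler_piMr.
Qed.

Let pair_weight_sqr x i : x.1 != x.2 -> N i * pair_weight x i ^+ 2 <= 1.
Proof.
move=> x12; rewrite -[leRHS](pair_weight_norm2 x12) /weighted_norm2 (bigD1 i)//= lerDl.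
by apply: sumr_ge0 => j _; rewrite mulr_ge0 ?sqr_ge0.
Qed.

Lemma pair_weight_le x i : x.1 != x.2 -> `|pair_weight x i| <= g.
Proof. by move=> x12; apply: (@weight_le _ i); exact: pair_weight_sqr. Qed.

Lemma pair_weight_norm1 x : x.1 != x.2 -> weighted_norm1 (pair_weight x) <= 2 * s.
Proof.
move=> x12.
apply: (@le_trans _ _ (\sum_i ((i == x.1)%:R * s + (i == x.2)%:R * s))); last first.
  rewrite big_split/= (sum_indicator x.1 (fun=> s)) (sum_indicator x.2 (fun=> s)).
  by rewrite mulrDl mul1r.
apply: ler_sum => i _; have le_s := size_weight_le (pair_weight_sqr i x12).
have [_|i1] := eqVneq i x.1; first by rewrite mul1r (le_trans le_s)// lerDl mulr_ge0.
have [_|i2] := eqVneq i x.2; first by rewrite mul0r add0r mul1r.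
by rewrite /pair_weight contrast_eq0// mul0r normr0 mulr0 !mul0r addr0.
Qed.

End weight_bounds.

(* The t-statistic of the pair x for truncated observations and known variances. *)
Definition pair_stat B x (w : space E) : R := weighted_sum (trunc B) (pair_weight x) w.

Definition exceeds B t x : set (space E) := [set w | t <= pair_stat B x w].

Lemma measurable_exceeds B t x : measurable (exceeds B t x).
Proof.
by apply: measurable_set_le => //; exact: measurable_weighted_sum (measurable_trunc B).
Qed.

Lemma exceeds_independent B t x y : disjoint_pairs x y ->
  prob E (exceeds B t x `&` exceeds B t y) =
  (prob E (exceeds B t x) * prob E (exceeds B t y))%E.
Proof.
move=> /and4P[x1y1 x1y2 x2y1 x2y2].
pose groups_of v := [set z : {i : 'I_m & 'I_(gsize i)} | (tag z == v.1) || (tag z == v.2)]%SET.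
have wrt v : measurable_wrt (@tagged_obs R E) (groups_of v) (pair_stat B v).
  apply: measurable_wrt_weighted_sum (measurable_trunc B) _ => z.
  by rewrite inE negb_or => /andP[z1 z2]; rewrite /pair_weight contrast_eq0 ?mul0r.
have disj : [disjoint groups_of x & groups_of y]%bool.
  apply/pred0P => z /=; rewrite !inE; apply/negbTE/negP => /andP[/orP[]/eqP ->];
    by rewrite ?(negbTE x1y1) ?(negbTE x1y2) ?(negbTE x2y1) ?(negbTE x2y2).
have preimE v : pair_stat B v @^-1` `[t, +oo[ = exceeds B t v.
  by apply/seteqP; split=> w /=; rewrite in_itv/= andbT.
have := measurable_wrt_independent (@tagged_obs_independent R E) disj (@wrt x) (@wrt y)
  (measurable_itv `[t, +oo[) (measurable_itv `[t, +oo[).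
by rewrite !preimE.
Qed.

End pair_weights.

Section ratio_bounds.
Context {R : realType}.
Implicit Types a b q th : R.

Lemma ratio_dist th a b q : 0 < th -> th <= 4^-1 -> `|a| <= th -> 0 <= b <= th / 8 ->
  0 < q -> 64 * q <= th -> `|(1 + a - b) / (1 - q) - 1| <= 2 * th.
Proof.
move=> th0 th4 /ler_normlP[a_lo a_hi] /andP[b0 b8] q0 q_le.
have q1 : 0 < 1 - q by lra.
have thq : th * q <= th * 256^-1 by rewrite ler_wpM2l//; lra.
have thq0 : 0 <= th * q by rewrite mulr_ge0// ltW.
by rewrite ler_norml lerBrDr lerBlDr ler_pdivlMr// ler_pdivrMr//; apply/andP; split; lra.
Qed.

Lemma sqrt_ratio_dist th a b : 0 <= th -> 0 < a -> 0 < b ->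
  (1 - 2 * th) * a <= b <= (1 + 2 * th) * a -> `|Num.sqrt b / Num.sqrt a - 1| <= 2 * th.
Proof.
move=> th0 a0 b0 /andP[lo hi].
set k := _ / _; have k0 : 0 < k by rewrite divr_gt0 ?sqrtr_gt0.
have k2 : k ^+ 2 = b / a by rewrite exprMn exprVn !sqr_sqrtr// ltW.
have : 1 - 2 * th <= k ^+ 2 by rewrite k2 ler_pdivlMr.
have : k ^+ 2 <= 1 + 2 * th by rewrite k2 ler_pdivrMr.
by rewrite ler_norml => k2_hi k2_lo; apply/andP; split; nra.
Qed.

End ratio_bounds.

Section studentization.
Context {R : realType}.
Variable E : experiment R.
Local Notation m := (ngroups E).
Local Notation idx := {i : 'I_m & 'I_(gsize i)}.
Local Notation N i := ((gsize i)%:R : R).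
Implicit Types (i : 'I_m) (x : 'I_m * 'I_m) (w : space E).

Definition std_sum i w : R := \sum_(k < gsize i) standardize i (obs k w).
Definition std_sqr_sum i w : R := \sum_(k < gsize i) standardize i (obs k w) ^+ 2.

Lemma sample_meanE i w : sample_mean i w = mean i + sd i * std_sum i w / N i.
Proof.
rewrite /sample_mean; under eq_bigr do rewrite obs_standardize.
rewrite big_split/= sumr_const card_ord -mulr_sumr -/(std_sum i w) -mulr_natl.
by field; exact: gsize_neq0.
Qed.

Lemma sample_varE i w : sample_var i w =
  sd i ^+ 2 * ((std_sqr_sum i w - std_sum i w ^+ 2 / N i) / (N i - 1)).
Proof.
have N0 := gsize_neq0 i.
have N1 : N i - 1 != 0 by rewrite gt_eqF// subr_gt0 (ltr_nat R 1) gsize_ge2.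
pose y (k : 'I_(gsize i)) : R := standardize i (obs k w); pose av := std_sum i w / N i.
have dev_sqr k : (obs k w - sample_mean i w) ^+ 2 =
    sd i ^+ 2 * (y k ^+ 2 - 2 * av * y k + av ^+ 2).
  by rewrite sample_meanE (obs_standardize k w) /y /av; ring.
rewrite /sample_var; under eq_bigr do rewrite dev_sqr.
rewrite -mulr_sumr big_split/= sumrB -mulr_sumr sumr_const card_ord -mulr_natl /av /y.
by rewrite -/(std_sum i w) -/(std_sqr_sum i w); field; rewrite N0 N1.
Qed.

Lemma sum_idx (F : idx -> R) :
  \sum_z F z = \sum_i \sum_(k < gsize i) F (Tagged (fun i => 'I_(gsize i)) k).
Proof.
rewrite (sig_big_dep xpredT (fun i => xpredT)
  (fun i k => F (Tagged (fun i => 'I_(gsize i)) k)))/=.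
by apply: eq_bigr => -[i k] _.
Qed.

Section untruncated.
Variables (B : R) (w : space E).
Hypothesis obs_le : forall z, `|std_obs z w| <= B.

Lemma weighted_sum_trunc_id (c : 'I_m -> R) :
  weighted_sum (trunc B) c w = \sum_i c i * std_sum i w.
Proof.
rewrite /weighted_sum sum_idx; apply: eq_bigr => i _; rewrite mulr_sumr.
by apply: eq_bigr => k _; rewrite trunc_id.
Qed.

Lemma weighted_sum_centered_sqr_id (c : 'I_m -> R) :
  weighted_sum (centered_sqr B) c w = \sum_i c i * (std_sqr_sum i w - N i).
Proof.
rewrite /weighted_sum sum_idx; apply: eq_bigr => i _.
have -> : N i = \sum_(k < gsize i) (1 : R) by rewrite sumr_const card_ord.
rewrite -sumrB mulr_sumr; apply: eq_bigr => k _.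
by rewrite /centered_sqr trunc_id.
Qed.

End untruncated.

Variables (u : R) (w : space E).
Hypotheses (u4 : 4 <= u) (size_lb : forall i, 64 * u ^+ 6 <= N i).
Hypothesis mean_dev : forall i, `|std_sum i w / Num.sqrt (N i)| <= 2 * u.
Hypothesis var_dev : forall i, `|std_sqr_sum i w / N i - 1| <= u^-1 ^+ 4.

Let th_small : 0 < u^-1 ^+ 4 /\ u^-1 ^+ 4 <= 4^-1.
Proof.
have [i0 i4 _] := inv_ge4 u4; rewrite exprn_gt0//; split => //; apply: le_trans (i4).
by rewrite -[leRHS]expr1 ler_wiXn2l// ?(ltW i0)//; apply: le_trans i4 _; lra.
Qed.

Lemma sample_var_dist i : `|sample_var i w / sd i ^+ 2 - 1| <= 2 * u^-1 ^+ 4.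
Proof.
have [i0 i4 ui] := inv_ge4 u4; have [th0 th4] := th_small.
have N0 := gsize_neq0 i; have N_gt0 := gsize_gt0 i.
have N1 : N i - 1 != 0 by rewrite gt_eqF// subr_gt0 (ltr_nat R 1) gsize_ge2.
have s0 : sd i ^+ 2 != 0 by rewrite expf_neq0// gt_eqF// sd_gt0.
have -> : sample_var i w / sd i ^+ 2 =
    (1 + (std_sqr_sum i w / N i - 1) - (std_sum i w / N i) ^+ 2) / (1 - (N i)^-1).
  by rewrite sample_varE mulrC mulKf//; field; rewrite N0 N1.
have size_inv : 64 * (N i)^-1 <= u^-1 ^+ 6.
  rewrite ler_pdivrMr// -(ler_pM2l (exprn_gt0 6 (lt_le_trans _ u4 : 0 < u)))//.
  by rewrite mulrA -exprMn ui expr1n mul1r mulrC.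
have th6 : u^-1 ^+ 6 <= u^-1 ^+ 4.
  by rewrite ler_wiXn2l// ?(ltW i0)//; apply: le_trans i4 _; lra.
apply: ratio_dist => //; [|by rewrite invr_gt0|exact: le_trans size_inv th6].
rewrite sqr_ge0/=.
have -> : (std_sum i w / N i) ^+ 2 = (std_sum i w / Num.sqrt (N i)) ^+ 2 * (N i)^-1.
  by rewrite !exprMn !exprVn sqr_sqrtr// expr2 invfM mulrA.
have dev2 : (std_sum i w / Num.sqrt (N i)) ^+ 2 <= (2 * u) ^+ 2.
  rewrite -[leLHS]real_normK ?num_real// lerXn2r ?nnegrE ?mean_dev//.
  by rewrite mulr_ge0// (le_trans _ u4).
have Ninv0 : 0 <= (N i)^-1 by rewrite invr_ge0.
apply: le_trans (ler_wpM2r Ninv0 dev2) _.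
have : (2 * u) ^+ 2 * (64 * (N i)^-1) <= (2 * u) ^+ 2 * u^-1 ^+ 6.
  by rewrite ler_wpM2l ?sqr_ge0.
have -> : (2 * u) ^+ 2 * u^-1 ^+ 6 = 4 * u^-1 ^+ 4 * (u * u^-1) ^+ 2 by ring.
rewrite ui expr1n; lra.
Qed.

Variable B : R.
Hypothesis obs_le : forall z, `|std_obs z w| <= B.

Lemma pair_stat_studentized x : exists k : R,
  [/\ 0 < k, `|k - 1| <= 2 * u^-1 ^+ 4 & pair_stat B x w = k * barT x.1 x.2 w].
Proof.
have [th0 th4] := th_small; set th := u^-1 ^+ 4 in th0 th4 *.
pose v := sample_var x.1 w / N x.1 + sample_var x.2 w / N x.2.
have var_ratio i : (1 - 2 * th) * mean_var i <= sample_var i w / N i <=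
    (1 + 2 * th) * mean_var i.
  have /ler_normlP[lo hi] := sample_var_dist i; rewrite -/th in lo hi.
  have -> : sample_var i w / N i = sample_var i w / sd i ^+ 2 * mean_var i.
    by rewrite /mean_var mulrA divfK// expf_neq0// gt_eqF// sd_gt0.
  by rewrite !ler_wpM2r ?(ltW (mean_var_gt0 i))//; lra.
have /andP[lo1 hi1] := var_ratio x.1; have /andP[lo2 hi2] := var_ratio x.2.
have mv1 := mean_var_gt0 x.1; have mv2 := mean_var_gt0 x.2.
have v0 : 0 < v by rewrite /v; nra.
have sd0 := diff_sd_gt0 x; have sv0 : 0 < Num.sqrt v by rewrite sqrtr_gt0.
exists (Num.sqrt v / diff_sd x); split; first by rewrite divr_gt0.
  apply: sqrt_ratio_dist => //; [exact: ltW|exact: addr_gt0|].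
  by rewrite /v; apply/andP; split; lra.
rewrite /pair_stat weighted_sum_trunc_id// sum_pair_weight /barT -/v.
have -> : sample_mean x.1 w - sample_mean x.2 w - (mean x.1 - mean x.2) =
    sd x.1 * std_sum x.1 w / N x.1 - sd x.2 * std_sum x.2 w / N x.2.
  by rewrite !sample_meanE; ring.
move: (sd x.1 * _ / _ - _) => diff.
by field; rewrite (gt_eqF sd0) (gt_eqF sv0).
Qed.

End studentization.

(** * Rejection counts *)

Lemma card_lt_pairs (R : realType) (m : nat) :
  \sum_(x : 'I_m * 'I_m | (x.1 < x.2)%N) (1 : R) = m%:R * (m%:R - 1) / 2.
Proof.
set below := LHS.
have above : \sum_(x : 'I_m * 'I_m | (x.2 < x.1)%N) (1 : R) = below.
  by rewrite (reindex_inj (@pair_swap_inj 'I_m)).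
have diagonal : \sum_(x : 'I_m * 'I_m | x.1 == x.2) (1 : R) = m%:R.
  rewrite -(pair_big_dep xpredT (fun i j => i == j) (fun _ _ => 1))/=.
  under eq_bigr do under eq_bigl do rewrite eq_sym.
  under eq_bigr do rewrite big_pred1_eq.
  by rewrite sumr_const card_ord.
have : \sum_(x : 'I_m * 'I_m) (1 : R) = m%:R * m%:R.
  by rewrite sumr_const card_prod card_ord natrM.
rewrite (bigID (fun x : 'I_m * 'I_m => (x.1 < x.2)%N))/= -/below.
rewrite [X in below + X](bigID (fun x : 'I_m * 'I_m => (x.2 < x.1)%N))/=.
rewrite (eq_bigl (fun x : 'I_m * 'I_m => (x.2 < x.1)%N)); last first.
  by move=> x /=; case: (ltngtP x.1 x.2).
rewrite [X in _ + (_ + X)](eq_bigl (fun x : 'I_m * 'I_m => x.1 == x.2)); last first.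
  by move=> x; rewrite /= -val_eqE/=; case: (ltngtP x.1 x.2).
by rewrite above diagonal; lra.
Qed.

Lemma distribution_function_bounds (R : realType) (F : R -> R) (s : R) :
  distribution_function F -> 0 <= F s <= 1.
Proof.
move=> [F_homo _ F0 F1]; apply/andP; split.
  apply: (ler_cvg_to F0 (cvg_cst (F s))).
  by near=> t; apply: F_homo; near: t; apply: nbhs_ninfty_le; exact: num_real.
apply: (ler_cvg_to (cvg_cst (F s)) F1).
by near=> t; apply: F_homo; near: t; apply: nbhs_pinfty_ge; exact: num_real.
Unshelve. all: by end_near. Qed.

Section oriented_pairs.
Context {R : realType}.
Variable E : experiment R.
Local Notation m := (ngroups E).
Implicit Types (i j : 'I_m) (x : 'I_m * 'I_m) (w : space E).

(* Each unordered pair is oriented so that its first mean is the smaller one;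
   a pair with equal means is kept in both orientations. *)
Definition oriented_pairs : {set 'I_m * 'I_m} :=
  [set x : 'I_m * 'I_m | (x.1 != x.2) && (mean x.1 <= mean x.2)]%SET.

Lemma oriented_pairs_neq x : x \in oriented_pairs -> x.1 != x.2.
Proof. by rewrite inE => /andP[]. Qed.

Lemma sum_oriented_pairs (f : 'I_m * 'I_m -> R) :
  \sum_(x in oriented_pairs) f x =
  \sum_(x in (Hplus E :|: H0 E)%SET) f (x.2, x.1) +
  \sum_(x in (Hminus E :|: H0 E)%SET) f x.
Proof.
rewrite (bigID (fun x => (x.2 < x.1)%N))/=; congr (_ + _).
  rewrite (reindex_inj (@pair_swap_inj 'I_m)); apply: eq_bigl => x /=.
  rewrite !inE/= subr_gt0 subr_eq0 -andb_orr andbC le_eqVlt (eq_sym (mean x.2)) orbC.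
  by rewrite -val_eqE/=; case: (ltngtP x.1 x.2).
apply: eq_bigl => x /=; rewrite !inE/= subr_lt0 subr_eq0 -andb_orr le_eqVlt orbC.
by rewrite -val_eqE/=; case: (ltngtP x.1 x.2); rewrite ?andbT ?andbF// orbC.
Qed.

Lemma card_oriented_pairs : #|oriented_pairs|%:R = q E + (q0 E)%:R :> R.
Proof.
have -> : #|oriented_pairs|%:R = \sum_(x in oriented_pairs) (1 : R) by rewrite sumr_const.
rewrite sum_oriented_pairs /q -card_lt_pairs.
have -> : (q0 E)%:R = \sum_(x in H0 E) (1 : R) by rewrite sumr_const.
rewrite [\sum_(x in _ :|: _) _]big_mkcond/= [X in _ + X = _]big_mkcond/=.
rewrite [X in _ = X + _]big_mkcond/= [X in _ = _ + X]big_mkcond/=.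
rewrite -!big_split/=; apply: eq_bigr => x _.
rewrite !inE subr_gt0 subr_lt0 subr_eq0.
case: (x.1 < x.2)%N => /=; last by rewrite addr0.
by case: (ltgtP (mean x.1) (mean x.2)); rewrite /= ?addr0 ?add0r.
Qed.

Lemma card_oriented_pairs_ge : (2 <= m)%N -> m%:R ^+ 2 <= 4 * #|oriented_pairs|%:R :> R.
Proof.
rewrite -(ler_nat R) => m2; rewrite card_oriented_pairs /q.
by have : 0 <= (q0 E)%:R :> R by []; nra.
Qed.

Lemma barT_swap i j w : barT j i w = - barT i j w.
Proof. by rewrite /barT (addrC (sample_var j w / _)); ring. Qed.

End oriented_pairs.

Section reference_distributions.
Context {R : realType}.
Variable E : experiment R.
Local Notation m := (ngroups E).
Implicit Types (i j : 'I_m) (x : 'I_m * 'I_m) (w : space E) (s t : R).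
Variable F : 'I_m -> 'I_m -> R -> R.

Definition reference_distributions : Prop := forall i j, (i < j)%N ->
  distribution_function (F i j) /\ (forall t, 0 <= t -> F i j t = 1 - F i j (- t)).

Definition refdist x : R -> R := if (x.1 < x.2)%N then F x.1 x.2 else F x.2 x.1.

Hypothesis F_ref : reference_distributions.

Lemma reference_opp i j t : (i < j)%N -> F i j (- t) = 1 - F i j t.
Proof.
move=> /F_ref[_ F_sym]; have [t0|t0] := leP 0 t; first by rewrite [in RHS]F_sym//; ring.
by rewrite F_sym ?opprK// oppr_ge0 ltW.
Qed.

Lemma refdist_df x : x.1 != x.2 -> distribution_function (refdist x).
Proof. by rewrite /refdist -val_eqE/=; case: ltngtP => // /F_ref[]. Qed.

Lemma refdist_swap x : refdist (x.2, x.1) = refdist x.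
Proof.
rewrite /refdist/=; case: ltngtP => // /val_inj x21.
by case: x x21 => i j /= ->.
Qed.

Lemma rejectionsE t w : rejections F t w = \sum_(x in oriented_pairs E)
  ((1 - refdist x (barT x.1 x.2 w) <= barPhi t)%R : nat)%:R.
Proof.
rewrite sum_oriented_pairs /rejections; congr (_ + _); apply: eq_bigr => x;
  rewrite !inE -andb_orr => /andP[x12 _]; have [F_df _] := F_ref x12.
  rewrite le_barPhi_inv ?distribution_function_bounds// /barpL refdist_swap /refdist x12/=.
  by rewrite barT_swap reference_opp// opprB addrC subrK.
rewrite le_barPhi_inv; first by rewrite /barpU /refdist x12.
have /andP[F0 F1] := distribution_function_bounds (barT x.1 x.2 w) F_df.
by rewrite /barpU; apply/andP; split; lra.
Qed.

Lemma null_approx_error_ge0 : 0 <= null_approx_error F.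
Proof.
rewrite /null_approx_error; elim/big_rec: _ => // x y _ y0.
by rewrite le_max y0 orbT.
Qed.

Lemma null_approx_error_ub i j t : (i < j)%N -> 0 <= t <= 2 * Num.sqrt (ln m%:R) ->
  `|(1 - F i j t) / barPhi t - 1| <= null_approx_error F.
Proof.
set L := 2 * _ => ij tL; have [F_df _] := F_ref ij.
rewrite /null_approx_error (bigD1 (i, j))//= le_max; apply/orP; left.
apply: ub_le_sup; last by exists t.
exists (1 + (barPhi L)^-1) => _ [v /= + <-]; rewrite in_itv/= => /andP[_ vL].
have /andP[F0 F1] := distribution_function_bounds v F_df.
apply: le_trans (ler_normB _ _) _; rewrite normr1 addrC lerD2l.
rewrite ger0_norm ?divr_ge0 ?barPhi_ge0 ?subr_ge0//.
apply: (@le_trans _ _ (barPhi v)^-1).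
  by rewrite ler_piMl ?invr_ge0 ?barPhi_ge0// lerBlDr lerDl.
by rewrite lef_pV2 ?posrE ?barPhi_gt0// nonincreasing_barPhi.
Qed.

Lemma refdist_tail x s : x.1 != x.2 -> `|s| <= 2 * Num.sqrt (ln m%:R) ->
  `|1 - refdist x s - barPhi s| <= null_approx_error F * barPhi s.
Proof.
move=> x12 sL; wlog x_lt : x x12 / (x.1 < x.2)%N => [wlog_lt|].
  have := x12; rewrite -val_eqE/=; case: ltngtP => // x_lt _; first exact: wlog_lt.
  by rewrite -refdist_swap; apply: wlog_lt; rewrite //= eq_sym.
rewrite /refdist x_lt.
have tail_ge0 t : 0 <= t <= 2 * Num.sqrt (ln m%:R) ->
    `|1 - F x.1 x.2 t - barPhi t| <= null_approx_error F * barPhi t.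
  move=> tL; have b0 := barPhi_gt0 t.
  have -> : 1 - F x.1 x.2 t - barPhi t =
      ((1 - F x.1 x.2 t) / barPhi t - 1) * barPhi t.
    by rewrite mulrBl mul1r divfK// gt_eqF.
  by rewrite normrM (gtr0_norm b0) ler_pM2r// null_approx_error_ub.
have [s0|s0] := leP 0 s; first by apply: tail_ge0; rewrite s0 (le_trans (ler_norm _)).
have := tail_ge0 (- s); rewrite -(ltr0_norm s0) normr_ge0 sL ltr0_norm// => /(_ isT).
rewrite reference_opp// barPhiN -normrN (_ : - _ = 1 - F x.1 x.2 s - barPhi s); last first.
  by rewrite /barPhi; ring.
move=> /le_trans; apply; rewrite ler_wpM2l ?null_approx_error_ge0// -barPhiN.
by apply: nonincreasing_barPhi; lra.
Qed.

End reference_distributions.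

Section reference_sandwich.
Context {R : realType}.
Implicit Types (F : R -> R) (s t u k L S T eF tau : R).

Definition tail_approx F L eF : Prop :=
  forall s, `|s| <= L -> `|1 - F s - barPhi s| <= eF * barPhi s.

Lemma reference_tail_le F L eF t k : tail_approx F L eF -> -1 <= t -> 0 <= k <= 1 ->
  `|t + k| <= L -> eF <= hazard_lb * k -> 1 - F (t + k) <= barPhi t.
Proof.
move=> F_tail t1 k01 tkL eF_le; have /ler_normlP[_ F_le] := F_tail _ tkL.
apply: le_trans (barPhi_shift_lb t1 k01).
have := ler_wpM2r (barPhi_ge0 (t + k)) eF_le; lra.
Qed.

Lemma reference_tail_gt F L eF t k : tail_approx F L eF -> -1 <= t - k -> 0 < k <= 1 ->
  `|t - k| <= L -> eF <= 4^-1 -> 4 * eF <= hazard_lb * k -> barPhi t < 1 - F (t - k).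
Proof.
move=> F_tail tk1 /andP[k0 k1] tkL eF4 eF_le; have /ler_normlP[F_ge _] := F_tail _ tkL.
have := barPhi_shift_lb tk1 (_ : 0 <= k <= 1); rewrite subrK ltW// => /(_ k1) shift.
have b0 := barPhi_gt0 t; have hk0 : 0 < hazard_lb * k by rewrite mulr_gt0 ?hazard_lb_gt0.
have eF1 : 0 <= 1 - eF by lra.
have := ler_wpM2l eF1 shift.
have : 0 < ((1 - eF) * (1 + hazard_lb * k) - 1) * barPhi t by apply: mulr_gt0 => //; nra.
lra.
Qed.

Lemma scaling_dist k s u : 5 <= u -> `|k - 1| <= 2 * u^-1 ^+ 4 -> `|s| <= u ->
  `|(k - 1) * s| <= u^-1 ^+ 2 / 2.
Proof.
move=> u5 k1 su; have u0 : 0 < u by lra.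
have i0 : 0 < u^-1 by rewrite invr_gt0.
have ui : u * u^-1 = 1 by rewrite divff// gt_eqF.
have i5 : u^-1 <= 5^-1 by rewrite lef_pV2 ?posrE.
rewrite normrM; apply: (@le_trans _ _ (2 * u^-1 ^+ 4 * u)); first by rewrite ler_pM.
have -> : 2 * u^-1 ^+ 4 * u = 2 * u^-1 ^+ 2 * u^-1 * (u * u^-1) by ring.
by rewrite ui; nra.
Qed.

Variables (F : R -> R) (L eF tau u S T k t : R).
Hypotheses (F_homo : {homo F : x y / x <= y}) (F_tail : tail_approx F L eF).
Hypotheses (eF0 : 0 <= eF) (eF4 : eF <= 4^-1) (eF_le : 8 * eF <= hazard_lb * u^-1 ^+ 2).
Hypotheses (tau1 : 1 <= tau) (u_tau : u = tau + 4) (tau_L : tau + u^-1 ^+ 2 <= L).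
Hypotheses (k0 : 0 < k) (k1 : `|k - 1| <= 2 * u^-1 ^+ 4) (SE : S = k * T).
Hypothesis (t_tau : 0 <= t <= tau).

Let u5 : 5 <= u. Proof. by rewrite u_tau; have := tau1; lra. Qed.

Let kap_small : 0 < u^-1 ^+ 2 <= 1.
Proof.
have u0 : 0 < u by rewrite (lt_le_trans _ u5).
rewrite exprn_gt0 ?invr_gt0//= exprn_ile1 ?invr_ge0 ?(ltW u0)//.
by rewrite invf_le1// (le_trans _ u5)// ler1n.
Qed.

Lemma reject_of_stat_ge : t + u^-1 ^+ 2 <= S -> 1 - F T <= barPhi t.
Proof.
have := t_tau; have := tau1; have := u_tau; have := tau_L; have := kap_small.
have := eF_le; have := eF0; set kap := u^-1 ^+ 2.
move=> eF_pos eF8 /andP[kap0 kap1] tauL uE tau_ge1 /andP[t0 tt] tS.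
have sT : t + kap / 2 <= T.
  rewrite leNgt -(ltr_pM2l k0) -SE; apply/negP => Ss.
  have /(scaling_dist u5 k1)/ler_normlP[_] : `|t + kap / 2| <= u.
    by rewrite ger0_norm ?uE; lra.
  by rewrite -/kap; lra.
apply: le_trans (_ : 1 - F (t + kap / 2) <= _); first by rewrite lerD2l lerN2 F_homo.
apply: reference_tail_le F_tail _ _ _ _; [lra|lra|by rewrite ger0_norm; lra|].
by have := hazard_lb_gt0 (R := R); lra.
Qed.

Lemma stat_ge_of_reject : 1 - F T <= barPhi t -> t - u^-1 ^+ 2 <= S.
Proof.
have := t_tau; have := tau1; have := u_tau; have := tau_L; have := kap_small.
have := eF_le; have := eF0; set kap := u^-1 ^+ 2.
move=> eF_pos eF8 /andP[kap0 kap1] tauL uE tau_ge1 /andP[t0 tt].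
apply: contraTT; rewrite -!ltNge => St.
have Ts : T <= t - kap / 2.
  rewrite leNgt -(ltr_pM2l k0) -SE; apply/negP => sS.
  have /(scaling_dist u5 k1)/ler_normlP[] : `|t - kap / 2| <= u.
    by rewrite ler_norml uE; lra.
  by rewrite -/kap; lra.
apply: lt_le_trans (_ : _ < 1 - F (t - kap / 2)) _; last by rewrite lerD2l lerN2 F_homo.
apply: reference_tail_gt F_tail _ _ _ eF4 _; [lra|lra|by rewrite ler_norml; lra|].
by have := hazard_lb_gt0 (R := R); lra.
Qed.

End reference_sandwich.

Section grid_arithmetic.
Context {R : realType}.
Implicit Types (rho eps u tau s t k a M r : R).

Definition corr_exponent rho : R := (1 - rho) / (1 + rho).

Definition joint_tail_bound rho s : R := expR (mgf_const - s ^+ 2 / (1 + rho)).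

Lemma mills_lb u tau s : 1 <= u -> -1 <= s <= u -> s ^+ 2 <= tau ^+ 2 + 2 ->
  1 <= mills_const * expR 1 * u * expR (tau ^+ 2 / 2) * barPhi s.
Proof.
move=> u1 su s_tau.
apply: (@le_trans _ _ (expR (- s ^+ 2 / 2) * (expR 1 * expR (tau ^+ 2 / 2)))).
  by rewrite -!expRD -[leLHS]expR0 ler_expR; lra.
have -> : mills_const * expR 1 * u * expR (tau ^+ 2 / 2) * barPhi s =
  mills_const * u * barPhi s * (expR 1 * expR (tau ^+ 2 / 2)) by ring.
by rewrite ler_wpM2r ?expR_le_mills// mulr_ge0 ?expR_ge0.
Qed.

Lemma joint_tail_le rho u tau s : 0 <= rho -> 1 <= u -> -1 <= s <= u ->
  s ^+ 2 <= tau ^+ 2 + 2 ->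
  joint_tail_bound rho s <= (mills_const * u * barPhi s) ^+ 2 *
    (expR (2 + mgf_const) * expR ((1 - corr_exponent rho) * (tau ^+ 2 / 2))).
Proof.
move=> rho0 u1 su s_tau; have r1 : 0 < 1 + rho by lra.
have mills := expR_le_mills u1 su.
apply: (@le_trans _ _ (expR (- s ^+ 2 / 2) ^+ 2 *
    (expR (2 + mgf_const) * expR ((1 - corr_exponent rho) * (tau ^+ 2 / 2))))); last first.
  rewrite ler_wpM2r ?mulr_ge0 ?expR_ge0// lerXn2r ?nnegrE ?expR_ge0//.
  exact: le_trans (expR_ge0 _) mills.
rewrite expr2 -!expRD ler_expR; set z := rho / (1 + rho).
have -> : s ^+ 2 / (1 + rho) = s ^+ 2 - s ^+ 2 * z by rewrite /z; field; lra.
have -> : 1 - corr_exponent rho = 2 * z by rewrite /corr_exponent /z; field; lra.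
have z0 : 0 <= z by rewrite divr_ge0// ltW.
have z1 : z <= 1 by rewrite ler_pdivrMr// mul1r; lra.
have := ler_wpM2r z0 s_tau; lra.
Qed.

Definition deviation_const : R := 64 * (2 * (mills_const * expR 1) +
  4 * (mills_const ^+ 2 * expR (2 + mgf_const))).

Lemma deviation_const_ge0 : 0 <= deviation_const.
Proof.
have m0 : 0 <= mills_const :> R := ltW mills_const_gt0.
have h1 := mulr_ge0 m0 (expR_ge0 1).
have h2 := mulr_ge0 (sqr_ge0 (mills_const : R)) (expR_ge0 (2 + mgf_const)).
by rewrite /deviation_const; lra.
Qed.

(* The variance of the number of exceedances of s among a statistics built from M
   groups, divided by the square of a fraction eps / 4 of its mean. *)
Lemma grid_deviation_le rho eps u tau s a M : 0 <= rho <= 1 -> 0 < eps -> 1 <= u ->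
  -1 <= s <= u -> s ^+ 2 <= tau ^+ 2 + 2 -> M = expR (tau ^+ 2 / 2) -> M ^+ 2 <= 4 * a ->
  a * (2 * barPhi s + 4 * M * joint_tail_bound rho s) / (eps / 4 * (a * barPhi s)) ^+ 2 <=
  deviation_const / eps ^+ 2 * u ^+ 2 * M `^ (- corr_exponent rho).
Proof.
move=> /andP[rho0 rho1] eps0 u1 su s_tau ME Ma; have b0 := barPhi_gt0 s.
have M0 : 0 < M by rewrite ME expR_gt0.
have a0 : 0 < a by have := exprn_gt0 2 M0; lra.
have m0 : 0 < mills_const :> R := mills_const_gt0.
have -> : M `^ (- corr_exponent rho) = expR (- corr_exponent rho * (tau ^+ 2 / 2)).
  by rewrite /powR gt_eqF// ME expRK.
set D := expR (- corr_exponent rho * _); have D0 : 0 < D := expR_gt0 _.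
have DM : expR ((1 - corr_exponent rho) * (tau ^+ 2 / 2)) = D * M.
  by rewrite /D ME -expRD; congr expR; ring.
have DM1 : 1 <= D * M.
  rewrite -DM -[leLHS]expR0 ler_expR mulr_ge0 ?divr_ge0 ?sqr_ge0// subr_ge0.
  by rewrite ler_pdivrMr ?mul1r; lra.
have mills := mills_lb u1 su s_tau; rewrite -ME in mills.
have joint := joint_tail_le rho0 u1 su s_tau; rewrite DM in joint.
have uDM : 1 <= u * (D * M) by rewrite -[leLHS]mulr1 ler_pM.
rewrite ler_pdivrMr ?exprn_gt0 ?mulr_gt0 ?divr_gt0//.
have single : 2 * barPhi s <= 2 * (mills_const * expR 1) * u ^+ 2 * D * M ^+ 2 *
    barPhi s ^+ 2.
  have : 1 * 1 <= mills_const * expR 1 * u * M * barPhi s * (u * (D * M)) by rewrite ler_pM.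
  rewrite mul1r => /(ler_wpM2l (ltW b0)); lra.
have pairs := ler_wpM2l (ltW M0) joint.
apply: (@le_trans _ _ (a * (deviation_const / 64 * u ^+ 2 * D * M ^+ 2 * barPhi s ^+ 2))).
  by rewrite ler_pM2l// /deviation_const; lra.
have -> : deviation_const / eps ^+ 2 * u ^+ 2 * D * (eps / 4 * (a * barPhi s)) ^+ 2 =
    a * (deviation_const / 64 * u ^+ 2 * D * (4 * a) * barPhi s ^+ 2).
  by field; rewrite gt_eqF.
rewrite ler_pM2l// ler_pM2r ?exprn_gt0// ler_wpM2l//.
apply: mulr_ge0 (ltW D0); apply: mulr_ge0 (sqr_ge0 u).
exact: divr_ge0 deviation_const_ge0 (ler0n R 64).
Qed.

Lemma barPhi_shift_small eps u t k : 1 <= u -> -1 <= t <= u -> 0 <= k -> k * u <= 1 ->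
  hazard_ub * (k * u) <= eps -> barPhi (t - k) <= (1 + eps) * barPhi t.
Proof.
move=> u1 tu k0 ku eps_ge; apply: le_trans (barPhi_shift_ub u1 tu k0 ku) _.
by rewrite ler_wpM2r ?barPhi_ge0// lerD2l.
Qed.

(* A count r lies between the counts lo and up at the levels s' and s next to t. *)
Lemma grid_sandwich a eps u t k s s' r up lo : 0 < a -> 0 < eps <= 1 -> 1 <= u ->
  0 <= t -> 0 <= k -> t + k <= u -> k * u <= 1 -> hazard_ub * (k * u) <= eps / 4 ->
  t - k <= s -> s' <= t + k -> lo <= r <= up ->
  `|up - a * barPhi s| <= eps / 2 * (a * barPhi s) ->
  `|lo - a * barPhi s'| <= eps / 2 * (a * barPhi s') ->
  `|r / (barPhi t * a) - 1| <= eps.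
Proof.
move=> a0 /andP[eps0 eps1] u1 t0 k0 tk ku eps_ge ts ts' /andP[lo_r r_up].
move=> /ler_normlP[_ up_le] /ler_normlP[lo_ge _].
have ta0 : 0 < barPhi t * a by rewrite mulr_gt0 ?barPhi_gt0.
have up_t : a * barPhi s <= (1 + eps / 4) * (barPhi t * a).
  rewrite mulrC mulrA ler_pM2r//; apply: le_trans (nonincreasing_barPhi ts) _.
  by apply: barPhi_shift_small eps_ge => //; lra.
have lo_t : barPhi t * a <= (1 + eps / 4) * (a * barPhi s').
  rewrite mulrCA (mulrC _ a) ler_pM2l//.
  have := @barPhi_shift_small (eps / 4) u (t + k) k u1; rewrite addrK => shift.
  apply: le_trans (shift _ k0 ku eps_ge) _; first lra.
  by rewrite ler_wpM2l ?nonincreasing_barPhi//; lra.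
have ub : r <= (1 + eps) * (barPhi t * a).
  apply: (le_trans r_up).
  have c0 : 0 <= 1 + eps / 2 by lra.
  have c_le : (1 + eps / 2) * (1 + eps / 4) <= 1 + eps by nra.
  by have := ler_wpM2l c0 up_t; have := ler_wpM2r (ltW ta0) c_le; lra.
have lb : (1 - eps) * (barPhi t * a) <= r.
  apply: le_trans lo_r; have c0 : 0 <= 1 - eps by lra.
  apply: (@le_trans _ _ ((1 - eps / 2) * (a * barPhi s'))); last lra.
  have c_le : (1 - eps) * (1 + eps / 4) <= 1 - eps / 2 by nra.
  have s0 : 0 <= a * barPhi s' by rewrite mulr_ge0 ?barPhi_ge0 ?ltW.
  by have := ler_wpM2l c0 lo_t; have := ler_wpM2r s0 c_le; lra.
by rewrite ler_norml lerBrDr lerBlDr ler_pdivlMr// ler_pdivrMr//; apply/andP; split; lra.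
Qed.

End grid_arithmetic.

(** * Concentration *)

Section regime.
Context {R : realType}.
Variable E : experiment R.
Local Notation m := (ngroups E).
Local Notation N i := ((gsize i)%:R : R).
Local Notation P := (prob E).
Implicit Types (i j : 'I_m) (x y : 'I_m * 'I_m) (c : 'I_m -> R) (w : space E).

(* The observations are truncated at B; g bounds the (gsize i)^(-1/2), s the
   (gsize i)^(1/2), rho the correlation of two distinct pair statistics, and zeta the
   Lindeberg errors of all the sums considered. *)
Record truncation_regime (p K B g s zeta u rho : R) : Prop := TruncationRegime {
  regime_moment : std_moment_le E p K ;
  regime_p : 2 <= p ;
  regime_K : 0 <= K ;
  regime_B : 0 < B ;
  regime_g : 0 <= g ;
  regime_s : 0 <= s ;
  regime_u : 4 <= u ;
  regime_rho : 0 <= rho <= 1 ;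
  regime_size_lb : forall i, 1 <= g ^+ 2 * N i ;
  regime_size_ub : forall i, N i <= s ^+ 2 ;
  regime_var_share : forall i j, i != j -> mean_var i <= rho * (mean_var i + mean_var j) ;
  regime_err : 4 * s * (K * B `^ (1 - p)) + 4 * (K * B `^ (2 - p)) + 8 * (g * B) +
    16 * g ^+ 2 + 2 * (g ^+ 2 * (B ^+ 2 + 1)) <= zeta ;
  regime_zeta : u ^+ 24 * zeta <= 1
}.

Variables (p K B g s zeta u rho : R).
Hypothesis reg : truncation_regime p K B g s zeta u rho.

Let u4 : 4 <= u := regime_u reg.
Let B0 : 0 < B := regime_B reg.
Let g0 : 0 <= g := regime_g reg.
Let size_lb i : 1 <= g ^+ 2 * N i := regime_size_lb reg i.
Let rho01 : 0 <= rho <= 1 := regime_rho reg.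
Let u1 : 1 <= u. Proof. by apply: le_trans u4; rewrite ler1n. Qed.
Let u0 : 0 <= u. Proof. exact: le_trans u1. Qed.
Let u_le6 : u <= u ^+ 6. Proof. by rewrite -[leLHS]expr1 ler_weXn2l. Qed.

Local Notation bias := (K * B `^ (1 - p)).
Local Notation dist := (K * B `^ (2 - p)).
Local Notation trunc_err c gm := (weighted_err B bias 1 dist 1 c gm).
Local Notation sqr_dev_err c gm :=
  (weighted_err (B ^+ 2 + 1) dist 0 (B ^+ 2 + 1) (B ^+ 2 + 1) c gm).

Let trunc_ctl := trunc_controlled (regime_moment reg) (regime_p reg) B0.
Let sqr_ctl := centered_sqr_controlled (regime_moment reg) (regime_p reg) B0.

Let bias_ge0 : 0 <= bias. Proof. by rewrite mulr_ge0 ?powR_ge0 ?(regime_K reg). Qed.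
Let dist_ge0 : 0 <= dist. Proof. by rewrite mulr_ge0 ?powR_ge0 ?(regime_K reg). Qed.

Let zeta_parts : [/\ 0 <= zeta, 8 * (g * B) <= zeta, 16 * g ^+ 2 <= zeta &
  dist + 2 * (g ^+ 2 * (B ^+ 2 + 1)) <= zeta].
Proof.
have b0 := bias_ge0; have d0 := dist_ge0; have := regime_err reg.
have sb := mulr_ge0 (regime_s reg) b0; have gB := mulr_ge0 g0 (ltW B0).
have gg := sqr_ge0 g.
have gB2 : 0 <= g ^+ 2 * (B ^+ 2 + 1) by rewrite mulr_ge0 ?addr_ge0 ?sqr_ge0.
by split; lra.
Qed.

Let pow_zeta k l : (k + l <= 24)%N -> 4 ^+ l * (u ^+ k * zeta) <= 1.
Proof. by have [z0 _ _ _] := zeta_parts; exact: pow_absorb u4 z0 (regime_zeta reg). Qed.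

Lemma trunc_err_le c gm : weighted_norm1 c <= 4 * s -> weighted_norm2 c <= 4 ->
  0 <= gm <= 2 * g -> 0 <= trunc_err c gm <= zeta.
Proof.
move=> norm1 norm2 /andP[gm0 gm_le].
have b0 := bias_ge0; have d0 := dist_ge0.
have n1 := weighted_norm1_ge0 c; have n2 := weighted_norm2_ge0 c.
have gB : gm * B * 1 <= 2 * (g * B) by rewrite mulr1 mulrA ler_wpM2r// ltW.
have gg : gm ^+ 2 * 1 ^+ 2 <= 4 * g ^+ 2.
  by rewrite expr1n mulr1 (_ : 4 * g ^+ 2 = (2 * g) ^+ 2); [rewrite lerXn2r ?nnegrE ?mulr_ge0|ring].
have e0 : 0 <= sqr_err B 1 dist 1 gm.
  have gmB : 0 <= gm * B by rewrite mulr_ge0 ?(ltW B0).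
  by rewrite /sqr_err mulr1 expr1n mulr1 !addr_ge0 ?sqr_ge0.
apply/andP; split; first by rewrite addr_ge0// mulr_ge0.
apply: le_trans (regime_err reg); rewrite /weighted_err.
have gB2 : 0 <= g ^+ 2 * (B ^+ 2 + 1) by rewrite mulr_ge0 ?addr_ge0 ?sqr_ge0.
have linear := ler_wpM2r b0 norm1.
have quadratic : weighted_norm2 c * sqr_err B 1 dist 1 gm <=
    4 * (dist + 2 * (g * B) + 4 * g ^+ 2).
  by rewrite ler_pM// /sqr_err; lra.
lra.
Qed.

Let chernoff_err (l e : R) : 0 <= l <= 2 * u ^+ 6 -> 0 <= e <= zeta ->
  mgf_const * (1 + l) ^+ 3 * e <= mgf_const.
Proof.
move=> /andP[l0 lu] /andP[e0 ez]; have := @pow_zeta 18 3 isT => small.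
rewrite -mulrA ler_piMr ?(le_trans ler01 mgf_const_ge1)//; apply: le_trans small.
have u60 : 1 <= u ^+ 6 by rewrite exprn_ege1.
rewrite mulrA ler_pM ?exprn_ge0 ?addr_ge0//.
rewrite (_ : 4 ^+ 3 * u ^+ 18 = (4 * u ^+ 6) ^+ 3); last by rewrite exprMn -exprM.
by rewrite lerXn2r ?nnegrE ?addr_ge0 ?mulr_ge0//; lra.
Qed.

Let gB_small : 2 * u * (2 * g * B) <= 1.
Proof.
have [z0 gBz _ _] := zeta_parts; have := @pow_zeta 1 1 isT; rewrite !expr1.
have := ler_wpM2l u0 gBz; lra.
Qed.

Lemma regime_size_lb6 i : 64 * u ^+ 6 <= N i.
Proof.
have [z0 _ gz _] := zeta_parts; have u60 : 0 <= u ^+ 6 by rewrite exprn_ge0.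
have small : 64 * u ^+ 6 * g ^+ 2 <= 1.
  by have := @pow_zeta 6 1 isT; have := ler_wpM2l u60 gz; have := mulr_ge0 u60 z0; lra.
apply: (@le_trans _ _ (64 * u ^+ 6 * (g ^+ 2 * N i))).
  by rewrite ler_peMr ?size_lb// mulr_ge0.
by rewrite mulrA ler_piMl.
Qed.

Lemma pair_tail x (t : R) : x.1 != x.2 -> -1 <= t <= u - 1 ->
  `|fine (P (exceeds B t x)) - barPhi t| <=
  tail_const * (u^-1 + u ^+ 20 * zeta) * barPhi t.
Proof.
move=> x12 tu.
have /andP[err0 err_le] : 0 <= trunc_err (pair_weight x) g <= zeta.
  have := pair_weight_norm1 (regime_s reg) (regime_size_ub reg) x12.
  have := regime_s reg; have := g0 => ? ? ?.
  by apply: trunc_err_le; rewrite ?pair_weight_norm2//; lra.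
have u20 : 0 <= u ^+ 20 by rewrite exprn_ge0.
have := weighted_sum_tail trunc_ctl (fun i => pair_weight_le g0 size_lb i x12)
  (u := u) (t := t).
rewrite mulr1 => /(_ (pair_weight_norm2 x12) u4 _ tu) tail.
apply: le_trans (tail _) _.
  have := @pow_zeta 20 1 isT; have := ler_wpM2l u20 err_le.
  have [z0 _ _ _] := zeta_parts; have := mulr_ge0 u20 z0; lra.
rewrite ler_wpM2r ?barPhi_ge0// ler_wpM2l ?tail_const_ge0//.
by rewrite lerD2l ler_wpM2l.
Qed.

Let pair_sum_norm2 x y : x.1 != x.2 -> y.1 != y.2 -> y != x ->
  weighted_norm2 (fun i => pair_weight x i + pair_weight y i) <= 2 + 2 * rho.
Proof.
move=> x12 y12 yx.
have -> : weighted_norm2 (fun i => pair_weight x i + pair_weight y i) =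
    weighted_norm2 (pair_weight x) + weighted_norm2 (pair_weight y) +
    2 * \sum_i N i * (pair_weight x i * pair_weight y i).
  rewrite mulr_sumr /weighted_norm2 -!big_split/=.
  by apply: eq_bigr => i _; ring.
rewrite !pair_weight_norm2//; have [rho0 _] := andP rho01.
have := pair_weight_corr rho0 (regime_var_share reg) x12 y12 yx; lra.
Qed.

Lemma pair_joint x y (t : R) : x.1 != x.2 -> y.1 != y.2 -> y != x -> -1 <= t <= u ->
  fine (P (exceeds B t x `&` exceeds B t y)) <=
  joint_tail_bound rho t.
Proof.
move=> x12 y12 yx /andP[t1 tu]; have /andP[rho0 rho1] := rho01.
have r0 : 0 < 1 + rho by lra.
have mxy := measurableI _ _ (measurable_exceeds B t x) (measurable_exceeds B t y).
have [t0|t0] := ltP t 0.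
  apply: (le_trans (prob_le1 P mxy)); rewrite -[leLHS]expR0 ler_expR subr_ge0.
  by rewrite ler_pdivrMr//; have := @mgf_const_ge1 R; nra.
pose c i := pair_weight x i + pair_weight y i; pose l := t / (1 + rho).
have le_g (v : 'I_m * 'I_m) i : v.1 != v.2 -> `|pair_weight v i| <= g by exact: pair_weight_le.
have c_le i : `|c i| <= 2 * g.
  by apply: (le_trans (ler_normD _ _)); have := le_g x i x12; have := le_g y i y12; lra.
have norm1 : weighted_norm1 c <= 4 * s.
  have le_s (v : 'I_m * 'I_m) : v.1 != v.2 -> weighted_norm1 (pair_weight v) <= 2 * s.
    exact: (pair_weight_norm1 (regime_s reg) (regime_size_ub reg)).
  apply: (@le_trans _ _ (weighted_norm1 (pair_weight x) + weighted_norm1 (pair_weight y))).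
    by rewrite -big_split/=; apply: ler_sum => i _; rewrite -mulrDr ler_wpM2l ?ler_normD.
  by have := le_s x x12; have := le_s y y12; lra.
have norm2 := pair_sum_norm2 x12 y12 yx; rewrite -/c in norm2.
have err_le : 0 <= trunc_err c (2 * g) <= zeta.
  by apply: trunc_err_le => //; [lra|rewrite mulr_ge0 ?lexx].
have l0 : 0 <= l by rewrite divr_ge0// ltW.
have l_le : l <= u by rewrite ler_pdivrMr//; have := mulr_ge0 u0 rho0; lra.
have lE : l * (1 + rho) = t by rewrite divfK// gt_eqF.
have lb : l * (2 * g * B) <= 1.
  apply: le_trans gB_small; rewrite ler_wpM2r ?mulr_ge0 ?(ltW B0)//.
  by have := u0; lra.
apply: (@le_trans _ _ (fine (P [set w | 2 * t <= weighted_sum (trunc B) c w]))).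
  apply: prob_le => //.
    by apply: measurable_set_le => //; exact: measurable_weighted_sum (measurable_trunc B).
  move=> w []; rewrite /exceeds/= /pair_stat => tx ty.
  by rewrite weighted_sumD; lra.
apply: le_trans (weighted_sum_chernoff trunc_ctl c_le _ l0 lb) _; rewrite ler_expR mulr1.
have l_le6 : 0 <= l <= 2 * u ^+ 6 by rewrite l0; have := u_le6; have := u0; lra.
have := chernoff_err l_le6 err_le.
have := ler_wpM2l (sqr_ge0 l) norm2.
have -> : l ^+ 2 * (2 + 2 * rho) = 2 * (l * t) by rewrite -lE; ring.
have -> : t ^+ 2 / (1 + rho) = l * t by rewrite /l expr2 mulrAC.
lra.
Qed.

Definition single_weight (a : R) i0 i : R := (i == i0)%:R * a.

Lemma single_weight_norm1 a i0 : weighted_norm1 (single_weight a i0) = N i0 * `|a|.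
Proof.
rewrite -(sum_indicator i0 (fun i => N i * `|a|)); apply: eq_bigr => i _.
by rewrite /single_weight normrM ger0_norm// mulrCA.
Qed.

Lemma single_weight_norm2 a i0 : weighted_norm2 (single_weight a i0) = N i0 * a ^+ 2.
Proof.
rewrite -(sum_indicator i0 (fun i => N i * a ^+ 2)); apply: eq_bigr => i _.
by rewrite /single_weight; case: eqP => _; rewrite ?mul1r ?mul0r// expr0n mulr0.
Qed.

Lemma single_weight_le a i0 gm : `|a| <= gm -> forall i, `|single_weight a i0 i| <= gm.
Proof.
move=> a_le i; rewrite /single_weight; case: eqP; rewrite ?mul1r// mul0r normr0 => _.
exact: le_trans a_le.
Qed.

Lemma group_mean_tail a i0 : N i0 * a ^+ 2 = 1 ->
  fine (P [set w | 2 * u <= weighted_sum (trunc B) (single_weight a i0) w]) <=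
  expR (mgf_const - 2 * u ^+ 2).
Proof.
move=> Na2; have Na2_le : N i0 * a ^+ 2 <= 1 by rewrite Na2.
have a_le := single_weight_le i0 (weight_le g0 size_lb Na2_le).
have norm2 := single_weight_norm2 a i0; rewrite Na2 in norm2.
have err_le : 0 <= trunc_err (single_weight a i0) g <= zeta.
  have := size_weight_le (regime_s reg) (regime_size_ub reg) Na2_le.
  have := regime_s reg; have := g0 => ? ? ?.
  by apply: trunc_err_le; rewrite ?single_weight_norm1 ?norm2//; lra.
have l0 : 0 <= 2 * u by rewrite mulr_ge0.
have lb : 2 * u * (g * B) <= 1.
  apply: le_trans gB_small; rewrite ler_wpM2l// -mulrA.
  by have := mulr_ge0 g0 (ltW B0); lra.
apply: le_trans (weighted_sum_chernoff trunc_ctl a_le _ l0 lb) _.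
have l_le6 : 0 <= 2 * u <= 2 * u ^+ 6 by rewrite l0 ler_wpM2l.
by rewrite ler_expR norm2; have := chernoff_err l_le6 err_le; lra.
Qed.

Lemma group_var_tail a i0 : N i0 * `|a| = 1 ->
  fine (P [set w | u^-1 ^+ 4 <= weighted_sum (centered_sqr B) (single_weight a i0) w]) <=
  expR (mgf_const - 2 * u ^+ 2).
Proof.
move=> Na; have [_ _ ui] := inv_ge4 u4; have [z0 _ _ parts] := zeta_parts.
have a_inv : `|a| = (N i0)^-1.
  by apply: (mulfI (gsize_neq0 i0)); rewrite Na divff ?gsize_neq0.
have a_le : `|a| <= g ^+ 2 by rewrite a_inv -[leLHS]mul1r ler_pdivrMr ?gsize_gt0.
have B2_ge0 : 0 <= B ^+ 2 + 1 by rewrite addr_ge0 ?sqr_ge0.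
have gB2_ge0 : 0 <= g ^+ 2 * (B ^+ 2 + 1) by rewrite mulr_ge0 ?sqr_ge0.
have zeta4 := @pow_zeta 0 1 isT; rewrite expr1 expr0 mul1r in zeta4.
have d0 := dist_ge0.
have err_le : 0 <= sqr_dev_err (single_weight a i0) (g ^+ 2) <= zeta.
  have norm2 : weighted_norm2 (single_weight a i0) <= g ^+ 2.
    rewrite single_weight_norm2 -(real_normK (num_real a)) expr2 mulrA Na mul1r.
    exact: a_le.
  have n2 := weighted_norm2_ge0 (single_weight a i0).
  rewrite /weighted_err /sqr_err single_weight_norm1 Na mul1r expr0n mulr0 addr0.
  have -> : B ^+ 2 + 1 + g ^+ 2 * (B ^+ 2 + 1) * (B ^+ 2 + 1) =
    (B ^+ 2 + 1) * (1 + g ^+ 2 * (B ^+ 2 + 1)) by ring.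
  have sqr_part0 : 0 <= (B ^+ 2 + 1) * (1 + g ^+ 2 * (B ^+ 2 + 1)).
    by rewrite mulr_ge0// addr_ge0.
  apply/andP; split; first by rewrite addr_ge0// mulr_ge0.
  apply: le_trans (parts); rewrite lerD2l.
  apply: (@le_trans _ _ (g ^+ 2 * ((B ^+ 2 + 1) * 2))); last by lra.
  by rewrite ler_pM// ler_wpM2l//; lra.
have l0 : 0 <= 2 * u ^+ 6 by rewrite mulr_ge0 ?exprn_ge0.
have lb : 2 * u ^+ 6 * (g ^+ 2 * (B ^+ 2 + 1)) <= 1.
  have u60 : 0 <= u ^+ 6 by rewrite exprn_ge0.
  have gB2_le : 2 * (g ^+ 2 * (B ^+ 2 + 1)) <= zeta by lra.
  have := ler_wpM2l u60 gB2_le; have := @pow_zeta 6 1 isT.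
  by have := mulr_ge0 u60 z0; lra.
apply: le_trans (weighted_sum_chernoff sqr_ctl (single_weight_le i0 a_le) _ l0 lb) _.
have l_le6 : 0 <= 2 * u ^+ 6 <= 2 * u ^+ 6 by rewrite l0 lexx.
rewrite ler_expR mulr0 mulr0 mul0r addr0.
have -> : 2 * u ^+ 6 * u^-1 ^+ 4 = 2 * u ^+ 2 * (u * u^-1) ^+ 4 by ring.
by rewrite ui expr1n mulr1; have := chernoff_err l_le6 err_le; lra.
Qed.
End regime.

Section atypical.
Context {R : realType}.
Variables (E : experiment R) (p K B g s zeta u rho : R).
Local Notation m := (ngroups E).
Local Notation idx := {i : 'I_m & 'I_(gsize i)}.
Local Notation N i := ((gsize i)%:R : R).
Local Notation P := (prob E).
Implicit Types (x : 'I_m * 'I_m) (w : space E) (v : 'I_m * bool).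

Definition mean_weight v : 'I_m -> R :=
  single_weight ((-1) ^+ v.2 / Num.sqrt (N v.1)) v.1.

Definition var_weight v : 'I_m -> R := single_weight ((-1) ^+ v.2 / N v.1) v.1.

(* Outside this event nothing is truncated, and sample means and variances are close
   to their targets. *)
Definition atypical : set (space E) :=
  [set w | exists z : idx, B < `|std_obs z w|] `|`
  ([set w | exists v, 2 * u <= weighted_sum (trunc B) (mean_weight v) w] `|`
   [set w | exists v, u^-1 ^+ 4 <= weighted_sum (centered_sqr B) (var_weight v) w]).

Let measurable_truncated (z : idx) : measurable [set w | B < `|std_obs z w|].
Proof.
apply: measurable_set_lt => //; apply: measurableT_comp => //.
exact: measurable_std_obs.
Qed.

Let measurable_mean_dev v :
  measurable [set w | 2 * u <= weighted_sum (trunc B) (mean_weight v) w].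
Proof.
by apply: measurable_set_le => //; exact: measurable_weighted_sum (measurable_trunc B).
Qed.

Let measurable_var_dev v :
  measurable [set w | u^-1 ^+ 4 <= weighted_sum (centered_sqr B) (var_weight v) w].
Proof.
apply: measurable_set_le => //; apply: measurable_weighted_sum.
by apply: measurable_funB => //; apply: measurable_funX; exact: measurable_trunc.
Qed.

Lemma measurable_atypical : measurable atypical.
Proof. by apply: measurableU; [|apply: measurableU]; exact: measurable_exists_fin. Qed.

Hypothesis reg : truncation_regime E p K B g s zeta u rho.

Let mean_weight_norm v : N v.1 * ((-1) ^+ v.2 / Num.sqrt (N v.1)) ^+ 2 = 1.
Proof.
by rewrite exprMn sqrr_sign mul1r exprVn sqr_sqrtr// divff// gsize_neq0.
Qed.

Let var_weight_norm v : N v.1 * `|(-1) ^+ v.2 / N v.1| = 1.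
Proof.
by rewrite normrM normr_sign mul1r ger0_norm ?invr_ge0// divff// gsize_neq0.
Qed.

Lemma atypical_prob : fine (P atypical) <=
  m%:R * (s ^+ 2 * (K * B `^ (- p))) + m%:R * (4 * expR (mgf_const - 2 * u ^+ 2)).
Proof.
have m_trunc := measurable_exists_fin measurable_truncated.
have m_mean := measurable_exists_fin measurable_mean_dev.
have m_var := measurable_exists_fin measurable_var_dev.
apply: le_trans (prob_setU_le P m_trunc (measurableU _ _ m_mean m_var)) _.
apply: lerD.
  apply: le_trans (prob_exists_le P measurable_truncated) _.
  apply: (@le_trans _ _ (\sum_(z : idx) (K * B `^ (- p)))).
    apply: ler_sum => z _.
    exact: (std_obs_tail_le (regime_moment reg) (regime_p reg) (regime_B reg) z).
  rewrite (sum_tag (fun=> K * B `^ (- p))).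
  apply: (@le_trans _ _ (\sum_(i < m) s ^+ 2 * (K * B `^ (- p)))).
    apply: ler_sum => i _; rewrite ler_wpM2r ?(regime_size_ub reg)//.
    by rewrite mulr_ge0 ?powR_ge0 ?(regime_K reg).
  by rewrite sumr_const card_ord mulr_natl.
apply: le_trans (prob_setU_le P m_mean m_var) _.
have -> : m%:R * (4 * expR (mgf_const - 2 * u ^+ 2)) =
    \sum_(v : 'I_m * bool) expR (mgf_const - 2 * u ^+ 2) +
    \sum_(v : 'I_m * bool) expR (mgf_const - 2 * u ^+ 2).
  by rewrite sumr_const card_prod card_ord card_bool -(mulr_natl (expR _)) natrM; ring.
apply: lerD.
  apply: le_trans (prob_exists_le P measurable_mean_dev) _; apply: ler_sum => v _.
  exact: group_mean_tail reg _ _ (mean_weight_norm v).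
apply: le_trans (prob_exists_le P measurable_var_dev) _; apply: ler_sum => v _.
exact: group_var_tail reg _ _ (var_weight_norm v).
Qed.

Let size_lb6 (i : 'I_m) : 64 * u ^+ 6 <= N i.
Proof. exact: (regime_size_lb6 reg). Qed.

Let norm_le_of_signs (a b : R) : (forall e : bool, (-1) ^+ e * a < b) -> `|a| <= b.
Proof.
move=> signs; have := signs false; have := signs true.
by rewrite expr0 expr1 mulN1r mul1r ler_norml => ? ?; apply/andP; split; lra.
Qed.

Lemma typical_pair_stat w x : ~ atypical w -> exists k : R,
  [/\ 0 < k, `|k - 1| <= 2 * u^-1 ^+ 4 & pair_stat B x w = k * barT x.1 x.2 w].
Proof.
move=> /not_orP[no_trunc /not_orP[no_mean no_var]].
have obs_le z : `|std_obs z w| <= B.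
  by rewrite leNgt; apply/negP => Bz; apply: no_trunc; exists z.
apply: (pair_stat_studentized (regime_u reg) size_lb6) => // i; apply: norm_le_of_signs => e.
- rewrite ltNge; apply/negP => dev; apply: no_mean; exists (i, e).
  rewrite (weighted_sum_trunc_id obs_le) /mean_weight /single_weight/=.
  by under eq_bigr do rewrite -mulrA; rewrite sum_indicator -mulrA (mulrC _^-1).
- rewrite ltNge; apply/negP => dev; apply: no_var; exists (i, e).
  rewrite (weighted_sum_centered_sqr_id obs_le) /var_weight /single_weight/=.
  under eq_bigr do rewrite -mulrA; rewrite sum_indicator -mulrA (mulrC _^-1) mulrBl divff//.
  exact: gsize_neq0.
Qed.

End atypical.

Section exceedances.
Context {R : realType}.
Variables (E : experiment R) (p K B g s zeta u rho : R).
Local Notation m := (ngroups E).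
Local Notation P := (prob E).
Implicit Types (x y : 'I_m * 'I_m) (w : space E) (A : {set 'I_m * 'I_m}) (t : R).
Hypothesis reg : truncation_regime E p K B g s zeta u rho.

Definition shared_groups x y : R :=
  (y.1 == x.1)%:R + (y.1 == x.2)%:R + (y.2 == x.1)%:R + (y.2 == x.2)%:R.

Lemma shared_groups_ge0 x y : 0 <= shared_groups x y.
Proof. by rewrite !addr_ge0. Qed.

Lemma shared_groups_ge1 x y :
  ~~ disjoint_pairs x y -> 1 <= shared_groups x y.
Proof.
rewrite /shared_groups /disjoint_pairs !negb_and !negbK !(eq_sym x.1) !(eq_sym x.2).
case: (y.1 == x.1); case: (y.2 == x.1); case: (y.1 == x.2); case: (y.2 == x.2) => //= _;
  lra.
Qed.

Lemma sum_shared_groups x : \sum_y shared_groups x y = 4 * m%:R.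
Proof.
have sum1 (a : 'I_m) : \sum_(y : 'I_m * 'I_m) (y.1 == a)%:R = m%:R :> R.
  rewrite -(pair_bigA _ (fun i j => (i == a)%:R))/=.
  under eq_bigr => i _ do rewrite sumr_const card_ord -(mulr_natr _ m).
  exact: (sum_indicator a (fun=> m%:R)).
have sum2 (a : 'I_m) : \sum_(y : 'I_m * 'I_m) (y.2 == a)%:R = m%:R :> R.
  by rewrite (reindex_inj (@pair_swap_inj 'I_m)) /= sum1.
by rewrite /shared_groups !big_split/= !sum1 !sum2; ring.
Qed.

Lemma exceeds_covariance_le t pm x y : x.1 != x.2 -> y.1 != y.2 -> -1 <= t <= u ->
  0 <= pm -> fine (P (exceeds B t x)) <= pm ->
  fine (P (exceeds B t x `&` exceeds B t y)) -
    fine (P (exceeds B t x)) * fine (P (exceeds B t y)) <=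
  (y == x)%:R * pm + shared_groups x y * joint_tail_bound rho t.
Proof.
move=> x12 y12 tu pm0 p_le.
have J0 : 0 <= joint_tail_bound rho t := expR_ge0 _.
have sJ0 : 0 <= shared_groups x y * joint_tail_bound rho t.
  exact: mulr_ge0 (shared_groups_ge0 x y) J0.
have pp0 : 0 <= fine (P (exceeds B t x)) * fine (P (exceeds B t y)).
  by rewrite mulr_ge0// fine_ge0.
have [xy|yx] := eqVneq y x; first by rewrite mul1r {1}xy setIid; lra.
rewrite mul0r add0r.
have [disj|/shared_groups_ge1 share1] :=
  boolP (disjoint_pairs x y).
  rewrite exceeds_independent// fineM ?subrr//; apply: fin_num_measure;
    exact: measurable_exceeds.
have := pair_joint reg x12 y12 yx tu.
have := ler_wpM2r J0 share1; rewrite mul1r; lra.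
Qed.

Lemma exceeds_deviation A t pm delta : (forall x, x \in A -> x.1 != x.2) ->
  -1 <= t <= u -> 0 <= pm -> (forall x, x \in A -> fine (P (exceeds B t x)) <= pm) ->
  0 < delta ->
  fine (P [set w | delta <= `|event_count A (exceeds B t) w -
    \sum_(x in A) fine (P (exceeds B t x))|]) <=
  #|A|%:R * (pm + 4 * m%:R * joint_tail_bound rho t) / delta ^+ 2.
Proof.
move=> A12 tu pm0 p_le delta0.
have m_exceeds x : measurable (exceeds B t x) by exact: measurable_exceeds.
apply: le_trans (event_count_chebyshev P A m_exceeds delta0) _.
have J0 : 0 <= joint_tail_bound rho t := expR_ge0 _.
rewrite ler_wpM2r ?invr_ge0 ?exprn_ge0 ?(ltW delta0)//.
rewrite mulr_natl -sumr_const; apply: ler_sum => x xA.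
apply: (@le_trans _ _
  (\sum_y ((y == x)%:R * pm + shared_groups x y * joint_tail_bound rho t))); last first.
  rewrite big_split/= -!mulr_suml sum_shared_groups.
  by rewrite (bigD1 x)//= eqxx big1 ?addr0 ?mul1r// => y /negbTE ->.
rewrite big_mkcond/=; apply: ler_sum => y _; case: ifP => [yA|_].
  exact: exceeds_covariance_le (A12 x xA) (A12 y yA) tu pm0 (p_le x xA).
by rewrite addr_ge0 ?mulr_ge0 ?shared_groups_ge0.
Qed.

End exceedances.

Section extreme_level.
Context {R : realType}.
Implicit Types x a : R.

(* The level reached by the maximum of x independent standard normal variables. *)
Definition extreme_level x : R := Num.sqrt (2 * ln x).

Definition log_scale x : R := extreme_level x + 4.

Lemma log_scale_ge4 x : 4 <= log_scale x.
Proof. by rewrite /log_scale lerDr sqrtr_ge0. Qed.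

Lemma extreme_level_sqr x : 1 <= x -> extreme_level x ^+ 2 = 2 * ln x.
Proof. by move=> x1; rewrite sqr_sqrtr// mulr_ge0// ln_ge0. Qed.

Lemma expR_extreme_level x : 1 <= x -> expR (extreme_level x ^+ 2 / 2) = x.
Proof.
move=> x1; rewrite extreme_level_sqr// mulrC mulKf// lnK// posrE.
exact: lt_le_trans x1.
Qed.

Lemma extreme_level_ge a x : 0 <= a -> expR (a ^+ 2 / 2) <= x -> a <= extreme_level x.
Proof.
move=> a0 ax; have x0 : 0 < x by apply: lt_le_trans ax; exact: expR_gt0.
have a2 : a ^+ 2 <= 2 * ln x.
  by have : a ^+ 2 / 2 <= ln x by [rewrite -ler_expR lnK]; lra.
by have := ler_wsqrtr a2; rewrite sqrtr_sqr ger0_norm.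
Qed.

Lemma extreme_level_double x k : 1 <= x -> 1 <= extreme_level x -> 0 <= k <= 4^-1 ->
  extreme_level x + k <= 2 * Num.sqrt (ln x).
Proof.
move=> x1 tau1 /andP[k0 k4]; have l0 : 0 <= ln x by rewrite ln_ge0.
have tau2 := extreme_level_sqr x1; set tau := extreme_level x in tau1 tau2 *.
have tau0 : 0 <= tau by apply: le_trans tau1.
rewrite -ler_sqr ?nnegrE ?mulr_ge0 ?addr_ge0// exprMn sqr_sqrtr//.
have -> : 2 ^+ 2 * ln x = 2 * tau ^+ 2 by rewrite tau2; ring.
have : k * tau <= 4^-1 * tau by rewrite ler_wpM2r.
by nra.
Qed.

End extreme_level.

Section grid.
Context {R : realType}.
Variables tau u : R.
Hypotheses (tau1 : 1 <= tau) (u_tau : u = tau + 4).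
Implicit Types (j : nat) (t : R).

Definition grid_size : nat := (Num.truncn (tau * u ^+ 2) + 4)%N.

Definition grid_point j : R := (j%:R - 1) * u^-1 ^+ 2.

Let u4 : 4 <= u. Proof. by rewrite u_tau; have := tau1; lra. Qed.

Let step_small : [/\ 0 < u^-1 ^+ 2, 16 * u^-1 ^+ 2 <= 1 & u^-1 ^+ 2 * u = u^-1].
Proof.
have [i0 i4 ui] := inv_ge4 u4; rewrite exprn_gt0//; split => //; first nra.
by rewrite expr2 -mulrA (mulrC _ u) ui mulr1.
Qed.

Let stepK t : t * u ^+ 2 * u^-1 ^+ 2 = t.
Proof. by have [_ _ ui] := inv_ge4 u4; rewrite -mulrA -exprMn ui expr1n mulr1. Qed.

Let tau_u2_ge0 : 0 <= tau * u ^+ 2.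
Proof. by rewrite mulr_ge0 ?sqr_ge0// (le_trans ler01). Qed.

Lemma grid_size_le : grid_size%:R <= u ^+ 3.
Proof.
have /andP[trunc_le _] := truncn_itv tau_u2_ge0.
rewrite /grid_size natrD; apply: le_trans (lerD trunc_le (lexx _)) _.
have u2 : 1 <= u ^+ 2 by rewrite exprn_ege1// (le_trans _ u4)// ler1n.
by rewrite [u ^+ 3]exprS {2}u_tau mulrDl; lra.
Qed.

Lemma grid_point_le j : (j < grid_size)%N -> -1 <= grid_point j <= tau + 2 * u^-1 ^+ 2.
Proof.
have /andP[trunc_le _] := truncn_itv tau_u2_ge0; have [k0 k1 _] := step_small.
rewrite /grid_size addnS ltnS -(ler_nat R) natrD => j_le; apply/andP; split.
  by have : 0 <= j%:R * u^-1 ^+ 2 by [rewrite mulr_ge0// ltW]; rewrite /grid_point; lra.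
have -> : tau + 2 * u^-1 ^+ 2 = (tau * u ^+ 2 + 2) * u^-1 ^+ 2 by rewrite [RHS]mulrDl stepK.
by rewrite /grid_point ler_pM2r//; lra.
Qed.

Lemma grid_point_sqr j : (j < grid_size)%N -> grid_point j ^+ 2 <= tau ^+ 2 + 2.
Proof.
move=> /grid_point_le; set t := grid_point j => /andP[t1 t2].
have [i0 i4 ui] := inv_ge4 u4; have [k0 k1 ku] := step_small.
have tau_ge1 := tau1; set k := u^-1 ^+ 2 in t2 k0 k1 ku.
have k_tau : 4 * (k * tau) <= 1.
  have : k * tau <= k * u by rewrite ler_pM2l// u_tau; lra.
  by rewrite ku; lra.
have [t0|t0] := leP 0 t; last by nra.
have : t ^+ 2 <= (tau + 2 * k) ^+ 2 by rewrite lerXn2r ?nnegrE//; lra.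
by nra.
Qed.

Lemma grid_bracket t : 0 <= t <= tau -> exists2 j, (j + 3 < grid_size)%N &
  [/\ t - 2 * u^-1 ^+ 2 <= grid_point j, grid_point j <= t - u^-1 ^+ 2,
      t + u^-1 ^+ 2 <= grid_point (j + 3) & grid_point (j + 3) <= t + 2 * u^-1 ^+ 2].
Proof.
move=> /andP[t0 tt]; have [k0 _ _] := step_small.
have tu0 : 0 <= t * u ^+ 2 by rewrite mulr_ge0 ?sqr_ge0.
have /andP[j_le j_gt] := truncn_itv tu0; have /andP[_ top_gt] := truncn_itv tau_u2_ge0.
exists (Num.truncn (t * u ^+ 2)).
  rewrite /grid_size addn3 addn4 !ltnS -ltnS -(ltr_nat R).
  by apply: le_lt_trans top_gt; apply: (le_trans j_le); rewrite ler_wpM2r ?sqr_ge0.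
set j := Num.truncn _ in j_le j_gt *.
have lo : j%:R * u^-1 ^+ 2 <= t by rewrite -[leRHS]stepK ler_wpM2r// ltW.
have hi : t <= j.+1%:R * u^-1 ^+ 2 by rewrite -[leLHS]stepK ler_wpM2r// ltW.
by rewrite -natr1 in hi; rewrite /grid_point natrD; split; lra.
Qed.

End grid.

Section rejection_bound.
Context {R : realType}.
Variables (E : experiment R) (p K B g s zeta rho eps : R).
Local Notation m := (ngroups E).
Local Notation P := (prob E).
Local Notation A := (oriented_pairs E).
Local Notation tau := (extreme_level (m%:R : R)).
Local Notation u := (log_scale (m%:R : R)).
Local Notation size := (grid_size tau u).
Local Notation level := (grid_point u).
Implicit Types (x : 'I_m * 'I_m) (w : space E) (t : R) (j : nat).
Variable F : 'I_m -> 'I_m -> R -> R.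

Definition exceed_count t (w : space E) : R := event_count A (exceeds B t) w.

Definition exceed_mean t : R := \sum_(x in A) fine (P (exceeds B t x)).

Definition deviating j : set (space E) :=
  [set w | eps / 4 * (#|A|%:R * barPhi (level j)) <=
           `|exceed_count (level j) w - exceed_mean (level j)|].

Definition exceptional : set (space E) :=
  atypical B u `|` [set w | exists j : 'I_size, deviating j w].

Lemma measurable_deviating j : measurable (deviating j).
Proof. by apply: measurable_event_count_dev => x; exact: measurable_exceeds. Qed.

Lemma measurable_exceptional : measurable exceptional.
Proof.
apply: measurableU; first exact: measurable_atypical.
by apply: measurable_exists_fin => j; exact: measurable_deviating.
Qed.

Hypothesis reg : truncation_regime E p K B g s zeta u rho.
Hypotheses (m2 : (2 <= m)%N) (tau1 : 1 <= tau) (eps01 : 0 < eps <= 1).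
Hypothesis tail_eps : 4 * (tail_const * (u^-1 + u ^+ 20 * zeta)) <= eps.

Let A_neq x : x \in A -> x.1 != x.2. Proof. exact: oriented_pairs_neq. Qed.

Let A_gt0 : 0 < #|A|%:R :> R.
Proof.
have := @card_oriented_pairs_ge R E m2; have : 2 <= m%:R :> R by rewrite ler_nat.
by nra.
Qed.

Let level_lt t : t <= tau + 2 * u^-1 ^+ 2 -> t <= u - 1.
Proof.
have [i0 i4 _] := inv_ge4 (regime_u reg); have : u^-1 ^+ 2 <= 1 by nra.
by rewrite /log_scale; lra.
Qed.

Lemma exceed_mean_approx t : -1 <= t <= u - 1 ->
  `|exceed_mean t - #|A|%:R * barPhi t| <= eps / 4 * (#|A|%:R * barPhi t).
Proof.
move=> tu; have -> : #|A|%:R * barPhi t = \sum_(x in A) barPhi t.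
  by rewrite sumr_const mulr_natl.
rewrite -sumrB mulr_sumr; apply: le_trans (ler_norm_sum _ _ _) _.
apply: ler_sum => x xA; apply: le_trans (pair_tail reg (A_neq xA) tu) _.
by rewrite ler_wpM2r ?barPhi_ge0//; have := tail_eps; lra.
Qed.

Lemma deviating_prob j : (j < size)%N -> fine (P (deviating j)) <=
  deviation_const / eps ^+ 2 * u ^+ 2 * m%:R `^ (- corr_exponent rho).
Proof.
move=> j_lt; have /andP[lo hi] := grid_point_le tau1 erefl j_lt.
have sqr_le := grid_point_sqr tau1 erefl j_lt.
have := level_lt hi; set t := level j in lo hi sqr_le * => t_le.
have b0 := barPhi_gt0 t; have [eps0 eps1] := andP eps01.
have m1 : 1 <= m%:R :> R by rewrite ler1n ltnW.
have u1 : 1 <= u by apply: le_trans (log_scale_ge4 _); rewrite ler1n.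
have p_le x : x \in A -> fine (P (exceeds B t x)) <= 2 * barPhi t.
  move=> xA; have tu : -1 <= t <= u - 1 by rewrite lo.
  have /ler_normlP[_] := pair_tail reg (A_neq xA) tu.
  have : tail_const * (u^-1 + u ^+ 20 * zeta) * barPhi t <= 1 * barPhi t.
    by rewrite ler_wpM2r ?(ltW b0)//; have := tail_eps; lra.
  by lra.
have tu : -1 <= t <= u by lra.
have delta0 : 0 < eps / 4 * (#|A|%:R * barPhi t) by rewrite !mulr_gt0.
have twice0 : 0 <= 2 * barPhi t by rewrite mulr_ge0// ltW.
apply: le_trans (exceeds_deviation reg A_neq tu twice0 p_le delta0) _.
apply: grid_deviation_le (regime_rho reg) eps0 u1 tu sqr_le _ _.
  by rewrite expR_extreme_level.
exact: card_oriented_pairs_ge.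
Qed.

Lemma exceptional_prob : fine (P exceptional) <=
  m%:R * (s ^+ 2 * (K * B `^ (- p))) + m%:R * (4 * expR (mgf_const - 2 * u ^+ 2)) +
  deviation_const / eps ^+ 2 * (u ^+ 5 * m%:R `^ (- corr_exponent rho)).
Proof.
have m_dev (j : 'I_size) : measurable (deviating j) by exact: measurable_deviating.
have m_some := measurable_exists_fin m_dev.
apply: le_trans (prob_setU_le P (@measurable_atypical _ E B u) m_some) _.
apply: lerD; first exact: atypical_prob reg.
apply: le_trans (prob_exists_le P m_dev) _.
set b := deviation_const / eps ^+ 2 * u ^+ 2 * m%:R `^ (- corr_exponent rho).
apply: (@le_trans _ _ (\sum_(j < size) b)).
  by apply: ler_sum => j _; exact: deviating_prob.
have b0 : 0 <= b.
  apply: mulr_ge0 (powR_ge0 _ _); apply: mulr_ge0 (sqr_ge0 _).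
  exact: divr_ge0 deviation_const_ge0 (sqr_ge0 _).
rewrite sumr_const card_ord -(mulr_natl b).
apply: le_trans (ler_wpM2r b0 (grid_size_le tau1 (erefl u))) _.
by rewrite /b le_eqVlt; apply/orP; left; apply/eqP; ring.
Qed.

Lemma exceed_count_approx w j : ~ exceptional w -> (j < size)%N ->
  `|exceed_count (level j) w - #|A|%:R * barPhi (level j)| <=
  eps / 2 * (#|A|%:R * barPhi (level j)).
Proof.
move=> /not_orP[_ no_dev] j_lt.
have /negP : ~ deviating j w by move=> dev; apply: no_dev; exists (Ordinal j_lt).
rewrite -ltNge; have /andP[lo hi] := grid_point_le tau1 erefl j_lt.
have := @exceed_mean_approx (level j); rewrite lo level_lt// => /(_ isT).
have := ler_normD (exceed_count (level j) w - exceed_mean (level j))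
  (exceed_mean (level j) - #|A|%:R * barPhi (level j)).
by rewrite addrA subrK; lra.
Qed.

Hypothesis F_ref : reference_distributions F.
Hypothesis F_approx : 8 * null_approx_error F <= hazard_lb * u^-1 ^+ 2.

Let F_approx4 : null_approx_error F <= 4^-1.
Proof.
have [i0 i4 _] := inv_ge4 (regime_u reg).
have i21 : u^-1 ^+ 2 <= 1 by nra.
have := F_approx; have := ler_pM (ltW hazard_lb_gt0) (sqr_ge0 u^-1) hazard_lb_le1 i21.
by rewrite mulr1; lra.
Qed.

Let step_level : tau + u^-1 ^+ 2 <= 2 * Num.sqrt (ln m%:R).
Proof.
have [i0 i4 _] := inv_ge4 (regime_u reg).
have m1 : 1 <= m%:R :> R by rewrite ler1n ltnW.
have step4 : 0 <= u^-1 ^+ 2 <= 4^-1 by rewrite sqr_ge0/=; nra.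
exact: extreme_level_double m1 tau1 step4.
Qed.

Let refdist_tail_approx x : x.1 != x.2 ->
  tail_approx (refdist F x) (2 * Num.sqrt (ln m%:R)) (null_approx_error F).
Proof. by move=> x12 t; exact: refdist_tail. Qed.

Lemma reject_of_exceeds w x t : ~ exceptional w -> x \in A -> 0 <= t <= tau ->
  exceeds B (t + u^-1 ^+ 2) x w -> 1 - refdist F x (barT x.1 x.2 w) <= barPhi t.
Proof.
move=> /not_orP[typ _] /A_neq x12 tt.
have [k [k0 k1 kS]] := typical_pair_stat reg x typ.
have [F_homo _ _ _] := refdist_df F_ref x12.
exact: (reject_of_stat_ge F_homo (refdist_tail_approx x12) (null_approx_error_ge0 F)
  F_approx tau1 erefl step_level k0 k1 kS tt).
Qed.

Lemma exceeds_of_reject w x t : ~ exceptional w -> x \in A -> 0 <= t <= tau ->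
  1 - refdist F x (barT x.1 x.2 w) <= barPhi t -> exceeds B (t - u^-1 ^+ 2) x w.
Proof.
move=> /not_orP[typ _] /A_neq x12 tt.
have [k [k0 k1 kS]] := typical_pair_stat reg x typ.
have [F_homo _ _ _] := refdist_df F_ref x12.
exact: (stat_ge_of_reject F_homo (refdist_tail_approx x12) (null_approx_error_ge0 F)
  F_approx4 F_approx tau1 erefl step_level k0 k1 kS tt).
Qed.

Lemma rejections_bracket w t t1 t2 : ~ exceptional w -> 0 <= t <= tau ->
  t1 <= t - u^-1 ^+ 2 -> t + u^-1 ^+ 2 <= t2 ->
  exceed_count t2 w <= rejections F t w <= exceed_count t1 w.
Proof.
move=> typ tt t1t tt2; rewrite (rejectionsE F_ref) /exceed_count /event_count.
apply/andP; split; apply: ler_sum => x xA; rewrite indicE.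
  case: (boolP (w \in _)) => // /set_mem exc.
  by rewrite (@reject_of_exceeds w x t)// /exceeds/= (le_trans tt2).
case: (boolP (_ <= barPhi t)) => // /(exceeds_of_reject typ xA tt) exc.
by rewrite mem_set//; exact: le_trans t1t exc.
Qed.

Hypothesis hazard_eps : 8 * (hazard_ub * u^-1) <= eps.

Lemma rejections_approx w t : ~ exceptional w -> 0 <= t <= tau ->
  `|rejections F t w / (barPhi t * (q E + (q0 E)%:R)) - 1| <= eps.
Proof.
move=> typ tt; have /andP[t0 t_tau] := tt.
have [i0 i4 ui] := inv_ge4 (regime_u reg).
have [j j_lt [lo1 hi1 lo2 hi2]] := grid_bracket tau1 erefl tt.
have j_lt' : (j < size)%N by apply: leq_ltn_trans j_lt; exact: leq_addr.
have u1 : 1 <= u by apply: le_trans (log_scale_ge4 _); rewrite ler1n.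
have ku : 2 * u^-1 ^+ 2 * u = 2 * u^-1.
  by rewrite expr2 -!mulrA (mulrC _ u) ui mulr1.
rewrite -card_oriented_pairs.
apply: (grid_sandwich A_gt0 eps01 u1 t0 _ _ _ _ lo1 hi2
  (rejections_bracket typ tt hi1 lo2)
  (exceed_count_approx typ j_lt') (exceed_count_approx typ j_lt)).
- by rewrite mulr_ge0 ?sqr_ge0.
- by rewrite /log_scale; nra.
- by rewrite ku; lra.
- by rewrite ku; have := hazard_eps; lra.
Qed.

Lemma sup_relative_error_le w : ~ exceptional w -> `|sup_relative_error F w| <= eps.
Proof.
move=> typ; rewrite /sup_relative_error; set S := [set _ | _ in _].
have S_ub : ubound S eps.
  by move=> _ [t /= + <-]; rewrite in_itv/= => tt; exact: rejections_approx.
have S0 : S `|rejections F 0 w / (barPhi 0 * (q E + (q0 E)%:R)) - 1|.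
  by exists 0 => //=; rewrite in_itv/= lexx sqrtr_ge0.
rewrite ger0_norm; first by apply: ge_sup => //; eexists; exact: S0.
by apply: le_trans (ub_le_sup _ S0) => //; exists eps.
Qed.

End rejection_bound.

(** * Measurability of the supremum *)

Section measurable_sup.
Context {d : measure_display} {T : measurableType d} {R : realType}.
Variables (f : R -> T -> R) (a b : R).
Implicit Types (t c : R) (w : T).
Hypothesis ab : a <= b.
Hypothesis measurable_f : forall t, measurable_fun setT (f t).
Hypothesis f_bounded : forall w, has_ubound [set f t w | t in `[a, b]].
Hypothesis f_left : forall t c w, c < f t w -> \forall s \near t^'-, c < f s w.

Let sup_gt_rat c w : c < sup [set f t w | t in `[a, b]] <->
  c < f a w \/ exists r : rat, a < ratr r <= b /\ c < f (ratr r) w.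
Proof.
have mem_values t : a <= t <= b -> [set f t w | t in `[a, b]] (f t w).
  by move=> tab; exists t; rewrite //= in_itv.
split=> [|c_f]; last first.
  have [t [tab ct]] : exists t, a <= t <= b /\ c < f t w.
    case: c_f => [ca|[r [/andP[ar rb] cr]]]; first by exists a; rewrite lexx ab.
    by exists (ratr r); rewrite (ltW ar) rb.
  by apply: lt_le_trans ct _; apply: ub_le_sup => //; exact: mem_values.
have nonempty : [set f t w | t in `[a, b]] !=set0.
  by exists (f a w); apply: mem_values; rewrite lexx ab.
move=> /(sup_gt nonempty)[_ [t /= + <-]]; rewrite in_itv/= => /andP[].
rewrite le_eqVlt => /predU1P[<- _ ca|a_t tb ct]; [by left|right].
have := f_left ct; rewrite /at_left /within/= => /nbhs_ballP[e /= e0 near_t].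
have : Num.max a (t - e) < t by rewrite gt_max a_t/= ltrBlDr ltrDl.
move=> /rat_in_itvoo[r]; rewrite in_itv/= gt_max => /andP[/andP[ar er] rt].
exists r; rewrite ar (le_trans (ltW rt))//; split=> //; apply: near_t => //.
by rewrite /ball/= gtr0_norm ?subr_gt0// ltrBlDr addrC -ltrBlDr.
Qed.

Lemma measurable_sup_gt c : measurable [set w | c < sup [set f t w | t in `[a, b]]].
Proof.
rewrite (_ : [set w | _] = [set w | c < f a w] `|`
    \bigcup_(r : rat) [set w | a < ratr r <= b /\ c < f (ratr r) w]); last first.
  apply/seteqP; split=> w /=.
    by move=> /sup_gt_rat[ca|[r cr]]; [left|right; exists r].
  by case=> [ca|[r _ cr]]; apply/sup_gt_rat; [left|right; exists r].
apply: measurableU; first exact: measurable_set_lt.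
apply: bigcupT_measurable_rat => r.
have [r_ab|r_ab] := boolP (a < ratr r <= b).
  rewrite (_ : [set w | _] = [set w | c < f (ratr r) w]); first exact: measurable_set_lt.
  by apply/seteqP; split=> w //= [].
by rewrite (_ : [set w | _] = set0)//; apply/seteqP; split=> w //= [].
Qed.

End measurable_sup.

Lemma measurable_inv_sqrt (R : realType) :
  measurable_fun [set: R] (fun v => (Num.sqrt v)^-1).
Proof.
rewrite (_ : (fun v => _) = (fun v : R => \1_`]0, +oo[ v * (v `^ (- 2^-1)))).
  apply: measurable_funM; last exact: measurable_powR.
  by apply: measurable_indic; exact: measurable_itv.
apply/funext => v; rewrite indicE; have [v0|v0] := leP v 0.
  by rewrite ler0_sqrtr// invr0 memNset ?mul0r//= in_itv/= andbT ltNge v0.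
by rewrite mem_set ?mul1r ?powRN ?powR12_sqrt ?(ltW v0)//= in_itv/= v0.
Qed.

Section measurable_statistics.
Context {R : realType}.
Variable E : experiment R.
Local Notation m := (ngroups E).
Implicit Types (i j : 'I_m) (w : space E) (s t : R).

Lemma measurable_sample_mean i : measurable_fun setT (@sample_mean R E i).
Proof. by apply: measurable_funM => //; apply: measurable_sum => k. Qed.

Lemma measurable_sample_var i : measurable_fun setT (@sample_var R E i).
Proof.
apply: measurable_funM => //; apply: measurable_sum => k; apply: measurable_funX.
by apply: measurable_funB => //; exact: measurable_sample_mean.
Qed.

Lemma measurable_barT i j : measurable_fun setT (@barT R E i j).
Proof.
apply: measurable_funM.
  by apply: measurable_funB => //; apply: measurable_funB; exact: measurable_sample_mean.
apply: (measurableT_comp (@measurable_inv_sqrt R)).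
by apply: measurable_funD; apply: measurable_funM => //; exact: measurable_sample_var.
Qed.

Variable F : 'I_m -> 'I_m -> R -> R.
Hypothesis F_ref : reference_distributions F.

Local Notation total := (q E + (q0 E)%:R).
Local Notation tau := (extreme_level (m%:R : R)).

Let relative_error t w : R := `|rejections F t w / (barPhi t * total) - 1|.

Lemma measurable_rejections t : measurable_fun setT (rejections F t).
Proof.
have -> : rejections F t = (fun w => \sum_x if x \in oriented_pairs E then
    \1_[set w' | 1 - refdist F x (barT x.1 x.2 w') <= barPhi t] w else 0).
  apply/funext => w; rewrite (rejectionsE F_ref) big_mkcond/=.
  apply: eq_bigr => x _; case: ifP => // _; rewrite indicE.
  congr (_%:R); congr nat_of_bool.
  by apply/idP/idP => [rej|/set_mem//]; exact: mem_set.
apply: measurable_sum => x.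
have [/oriented_pairs_neq x12|_] := boolP (x \in _); last exact: measurable_cst.
have [F_homo _ _ _] := refdist_df F_ref x12.
apply/measurable_indic/measurable_set_le => //; apply: measurable_funB => //.
apply: (measurableT_comp _ (measurable_barT _ _)).
exact: nondecreasing_measurable.
Qed.

Let rejections_left t w :
  \forall s \near t^'-, rejections F s w = rejections F t w.
Proof.
have : \forall s \near t^'-, forall x,
    (1 - refdist F x (barT x.1 x.2 w) <= barPhi s) =
    (1 - refdist F x (barT x.1 x.2 w) <= barPhi t).
  apply: filter_forall => x; set v := 1 - _.
  have [vt|vt] := leP v (barPhi t).
    near=> s; apply: le_trans vt _; apply: nonincreasing_barPhi; apply: ltW.
    by near: s; exact: nbhs_left_lt.
  have barPhi_cvg : barPhi s @[s --> t^'-] --> barPhi t.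
    exact: cvg_at_left_filter (@continuous_barPhi R t).
  near=> s; apply/negbTE; rewrite -ltNge.
  by near: s; exact: cvgr_lt _ barPhi_cvg _ vt.
apply: filterS => s same; rewrite !(rejectionsE F_ref).
by apply: eq_bigr => x _; rewrite same.
Unshelve. all: by end_near. Qed.

Let relative_error_left t c w :
  c < relative_error t w -> \forall s \near t^'-, c < relative_error s w.
Proof.
move=> ct.
have cvg_err : `|rejections F t w / (barPhi s * total) - 1| @[s --> t^'-] -->
    relative_error t w.
  apply: cvg_at_left_filter; apply: cvg_norm; apply: cvgB; last exact: cvg_cst.
  apply: cvgM; first exact: cvg_cst.
  have [->|total0] := eqVneq total (0 : R).
    by under eq_fun do rewrite mulr0; rewrite mulr0; exact: cvg_cst.
  apply: cvgV; first by rewrite mulf_neq0// gt_eqF// barPhi_gt0.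
  by apply: cvgM; [exact: continuous_barPhi|exact: cvg_cst].
near=> s; rewrite /relative_error (_ : rejections F s w = rejections F t w).
  by near: s; exact: cvgr_gt _ cvg_err _ ct.
by near: s; exact: rejections_left.
Unshelve. all: by end_near. Qed.

Let relative_error_bounded w : has_ubound [set relative_error t w | t in `[0, tau]].
Proof.
have rej_le t : 0 <= rejections F t w <= total.
  rewrite (rejectionsE F_ref) sumr_ge0//= -card_oriented_pairs -sumr_const.
  by apply: ler_sum => x _; rewrite lern1 leq_b1.
exists (total / total / barPhi tau + 1) => _ [t /= + <-].
rewrite in_itv/= => /andP[_ t_tau]; have /andP[rej0 rej_total] := rej_le t.
apply: le_trans (ler_normB _ _) _; rewrite normr1 lerD2r.
have total0 : 0 <= total :> R by exact: le_trans rej_total.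
rewrite (mulrC (barPhi t)) invfM mulrA.
have bt : 0 <= (barPhi t)^-1 by rewrite invr_ge0 barPhi_ge0.
have share0 : 0 <= rejections F t w / total by rewrite divr_ge0.
rewrite (ger0_norm (mulr_ge0 share0 bt)).
apply: (ler_pM share0 bt); first by rewrite ler_wpM2r ?invr_ge0.
by rewrite lef_pV2 ?posrE ?barPhi_gt0// nonincreasing_barPhi.
Qed.

Lemma measurable_sup_relative_error c :
  measurable [set w | c < `|sup_relative_error F w|].
Proof.
rewrite (_ : [set w | _] = [set w | c < sup [set relative_error t w | t in `[0, tau]]]).
  apply: measurable_sup_gt relative_error_bounded relative_error_left c.
    exact: sqrtr_ge0.
  move=> t; apply: measurableT_comp => //; apply: measurable_funB => //.
  by apply: measurable_funM => //; exact: measurable_rejections.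
suff sup_ge0 w : 0 <= sup_relative_error F w.
  by apply/seteqP; split=> w /=; rewrite ger0_norm.
apply: (@le_trans _ _ (relative_error 0 w)); first exact: normr_ge0.
apply: (ub_le_sup (relative_error_bounded w)).
by exists 0; rewrite //= in_itv/= lexx sqrtr_ge0.
Qed.

End measurable_statistics.

(** * Asymptotics *)

Section powers.
Context {R : realType}.
Implicit Types x a b : R.

Lemma powRrMn x a (k : nat) : x `^ (a * k%:R) = (x `^ a) ^+ k.
Proof. by rewrite powRrM powR_mulrn ?powR_ge0. Qed.

Lemma ln_le_powR b x : 0 < b -> 1 <= x -> ln x <= x `^ b / b.
Proof.
move=> b0 x1; rewrite ler_pdivlMr// mulrC -ln_powR; apply/ltW/ln_sublinear.
by rewrite powR_gt0// (lt_le_trans ltr01).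
Qed.

Lemma log_scale_le b x : 0 < b -> 1 <= x -> log_scale x <= (5 + 2 / b) * x `^ b.
Proof.
move=> b0 x1; have x_b : 1 <= x `^ b by have := ler_powR x1 (ltW b0); rewrite powRr0.
have tau_le : extreme_level x <= 1 + 2 * ln x.
  rewrite -extreme_level_sqr//; set tau := extreme_level x.
  by have := sqr_ge0 (tau - 1); have : 0 <= tau := sqrtr_ge0 _; nra.
rewrite /log_scale mulrDl -mulrA (mulrC b^-1); have := ln_le_powR b0 x1.
by move: (x `^ b) (x `^ b / b) x_b => y z; lra.
Qed.

End powers.

Section asymptotics.
Context {R : realType}.
Implicit Types (x y : nat -> R) (a C r : R).

Lemma cvg_powRN x a : x l @[l --> \oo] --> +oo -> 0 < a ->
  x l `^ (- a) @[l --> \oo] --> 0.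
Proof.
move=> /cvgryPge x_oo a0; under eq_fun do rewrite powRN.
have x_gt0 : \forall l \near \oo, 0 < x l by apply: filterS (x_oo 1) => l; exact: lt_le_trans.
apply/gtr0_cvgV0; first by apply: filterS x_gt0 => l; exact: powR_gt0.
apply/cvgryPge => M; near=> l.
apply: le_trans (ler_norm M) _.
rewrite -[leLHS](powRr1 (normr_ge0 M)) -(mulVf (lt0r_neq0 a0)) powRrM.
apply: ge0_ler_powR; rewrite ?nnegrE ?powR_ge0 ?(ltW a0)//.
  by apply: ltW; near: l.
by near: l; exact: x_oo.
Unshelve. all: by end_near. Qed.

Lemma cvg_log_scaleV x : x l @[l --> \oo] --> +oo ->
  (log_scale (x l))^-1 @[l --> \oo] --> 0.
Proof.
move=> /cvgryPge x_oo; apply/gtr0_cvgV0.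
  by near=> l; exact: lt_le_trans (log_scale_ge4 _).
apply/cvgryPge => M; near=> l; apply: le_trans (ler_norm M) _.
apply: (@le_trans _ _ (extreme_level (x l))); last by rewrite lerDl.
by apply: extreme_level_ge => //; near: l; exact: x_oo.
Unshelve. all: by end_near. Qed.

Section polynomial_growth.
Variables (x y : nat -> R) (C r : R).
Hypotheses (x_oo : x l @[l --> \oo] --> +oo) (y_oo : y l @[l --> \oo] --> +oo).
Hypotheses (C0 : 0 <= C) (r0 : 0 < r) (x_le : forall l, x l <= C * y l `^ r).

Let cvg_log_scale1 a : 0 < a -> log_scale (x l) * y l `^ (- a) @[l --> \oo] --> 0.
Proof.
move=> a0; pose b := a / (2 * r); have b0 : 0 < b by rewrite divr_gt0// mulr_gt0.
have factor0 : 0 <= 5 + 2 / b := addr_ge0 (ler0n _ _) (divr_ge0 (ler0n _ _) (ltW b0)).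
pose D := (5 + 2 / b) * C `^ b.
apply: (@squeeze_cvgr _ _ _ _ (cst 0) (fun l => D * y l `^ (- (a / 2)))).
- have /cvgryPge x_large := x_oo; have /cvgryPge y_large := y_oo; near=> l.
  have x1 : 1 <= x l by near: l; exact: x_large.
  have y1 : 1 <= y l by near: l; exact: y_large.
  have y0 : 0 < y l by exact: lt_le_trans y1.
  have log_ge0 : 0 <= log_scale (x l) by apply: le_trans (log_scale_ge4 _).
  rewrite mulr_ge0 ?powR_ge0//=.
  have -> : D * y l `^ (- (a / 2)) = (5 + 2 / b) * (C * y l `^ r) `^ b * y l `^ (- a).
    rewrite powRM ?powR_ge0// -powRrM /D -!mulrA -powRD_gt0//.
    by congr (_ * (_ * _ `^ _)); rewrite /b; field; rewrite gt_eqF.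
  rewrite ler_wpM2r ?powR_ge0//; apply: le_trans (log_scale_le b0 x1) _.
  rewrite ler_wpM2l// ge0_ler_powR ?nnegrE ?(ltW b0) ?(le_trans ler01 x1)//.
  exact: mulr_ge0 C0 (powR_ge0 _ _).
- exact: cvg_cst.
- rewrite -[X in _ --> X](mulr0 D); apply: cvgM; first exact: cvg_cst.
  by apply: cvg_powRN; rewrite ?divr_gt0.
Unshelve. all: by end_near. Qed.

Lemma cvg_log_scale_powRN (k : nat) a : 0 < a ->
  log_scale (x l) ^+ k * y l `^ (- a) @[l --> \oo] --> 0.
Proof.
move=> a0; pose b := a / k.+1%:R; have b0 : 0 < b by rewrite divr_gt0.
rewrite (_ : (fun l => _) =
    (fun l => (log_scale (x l) * y l `^ (- b)) ^+ k * y l `^ (- b))); last first.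
  apply/funext => l; rewrite exprMn -mulrA -exprSr -powRrMn.
  by rewrite mulNr divfK// pnatr_eq0.
rewrite -[X in _ --> X](mulr0 (0 ^+ k)); apply: cvgM; last exact: cvg_powRN.
exact: (continuous_cvg _ (@exprn_continuous R k 0) (cvg_log_scale1 b0)).
Qed.

End polynomial_growth.

End asymptotics.

Section truncation_parameters.
Context {R : realType}.
Variables (r nu K cL n : R).
Hypotheses (r0 : 0 < r) (nu0 : 0 < nu) (K0 : 0 < K) (cL0 : 0 < cL) (n1 : 1 <= n).

Definition moment_exponent : R := 2 + 4 * r + nu.

Local Notation p := moment_exponent.

(* With this gap the expected number n * trunc_level `^ (- moment_exponent) of truncated
   observations of a group is of order n `^ (- 2 * r - nu / 4), which beats the number
   n `^ r of groups. *)
Definition trunc_gap : R := nu / (4 * p).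

Local Notation gap := trunc_gap.

Definition trunc_level : R := n `^ (2^-1 - gap).

Local Notation B := trunc_level.
Local Notation g := (Num.sqrt (cL * n))^-1.

Definition lindeberg_const : R := 8 * K + 8 * (Num.sqrt cL)^-1 + 20 * cL^-1.

Definition lindeberg_error : R := lindeberg_const * n `^ (- gap).

Let n0 : 0 < n. Proof. by rewrite (lt_le_trans _ n1). Qed.

Lemma moment_exponent_ge2 : 2 <= p.
Proof. by rewrite /p; have := r0; have := nu0; lra. Qed.

Lemma trunc_gap_gt0 : 0 < gap.
Proof. by rewrite divr_gt0// mulr_gt0// (lt_le_trans _ moment_exponent_ge2). Qed.

Let gapM : gap * p = nu / 4.
Proof. by rewrite /gap; field; rewrite gt_eqF// (lt_le_trans _ moment_exponent_ge2). Qed.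

Let gap_le1 : 4 * gap <= 1.
Proof.
rewrite /gap mulrA ler_pdivrMr ?mulr_gt0 ?(lt_le_trans _ moment_exponent_ge2)//.
by rewrite /p; have := r0; have := nu0; lra.
Qed.

Lemma trunc_level_gt0 : 0 < B. Proof. exact: powR_gt0. Qed.

Lemma size_scale_sqr : g ^+ 2 = cL^-1 * n^-1.
Proof. by rewrite exprVn sqr_sqrtr ?mulr_ge0 ?ltW// invfM. Qed.

Let le_gap (a : R) : a <= - gap -> n `^ a <= n `^ (- gap).
Proof. exact: ler_powR. Qed.

Let trunc_levelX (a : R) : B `^ a = n `^ ((2^-1 - gap) * a).
Proof. by rewrite -powRrM. Qed.

Let trunc_bias_le : Num.sqrt n * B `^ (1 - p) <= n `^ (- gap).
Proof.
rewrite trunc_levelX -(powR12_sqrt (ltW n0)) -powRD_gt0//; apply: le_gap.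
have -> : 2^-1 + (2^-1 - gap) * (1 - p) = 1 - p / 2 - gap + gap * p by field.
by rewrite gapM /p; have := r0; have := nu0; lra.
Qed.

Let trunc_dist_le : B `^ (2 - p) <= n `^ (- gap).
Proof.
rewrite trunc_levelX; apply: le_gap.
have -> : (2^-1 - gap) * (2 - p) = 1 - p / 2 - 2 * gap + gap * p by field.
by rewrite gapM /p; have := r0; have := nu0; have := trunc_gap_gt0; lra.
Qed.

Let inv_le : n^-1 <= n `^ (- gap).
Proof.
rewrite -(powR_inv1 (ltW n0)); apply: le_gap.
by have := trunc_gap_gt0; have := gap_le1; lra.
Qed.

Let trunc_sqr_le : n^-1 * B ^+ 2 <= n `^ (- gap).
Proof.
rewrite -(powR_inv1 (ltW n0)) -powRrMn -powRD_gt0//; apply: le_gap.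
by have := trunc_gap_gt0; lra.
Qed.

Let trunc_scaleE : g * B = (Num.sqrt cL)^-1 * n `^ (- gap).
Proof.
rewrite sqrtrM ?ltW// invfM -mulrA -(powR12_sqrt (ltW n0)) -powRN -powRD_gt0//.
by congr (_ * _ `^ _); ring.
Qed.

Lemma lindeberg_error_ge :
  4 * Num.sqrt n * (K * B `^ (1 - p)) + 4 * (K * B `^ (2 - p)) + 8 * (g * B) +
  16 * g ^+ 2 + 2 * (g ^+ 2 * (B ^+ 2 + 1)) <= lindeberg_error.
Proof.
have cLV0 : 0 <= cL^-1 by rewrite invr_ge0 ltW.
have bias := ler_wpM2l (ltW K0) trunc_bias_le.
have dist := ler_wpM2l (ltW K0) trunc_dist_le.
have scale := ler_wpM2l cLV0 inv_le; have scale_sqr := ler_wpM2l cLV0 trunc_sqr_le.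
rewrite trunc_scaleE size_scale_sqr /lindeberg_error /lindeberg_const.
move: (n `^ (- gap)) bias dist scale scale_sqr => z bias dist scale scale_sqr.
have -> : 4 * Num.sqrt n * (K * B `^ (1 - p)) = 4 * (K * (Num.sqrt n * B `^ (1 - p))).
  by ring.
have -> : cL^-1 * n^-1 * (B ^+ 2 + 1) = cL^-1 * (n^-1 * B ^+ 2) + cL^-1 * n^-1 by ring.
lra.
Qed.

Lemma truncated_prob_le (M C : R) : 0 <= C -> M <= C * n `^ r ->
  M * (Num.sqrt n ^+ 2 * (K * B `^ (- p))) <= C * K * n `^ (- r).
Proof.
move=> C0 MC; rewrite sqr_sqrtr ?(ltW n0)// trunc_levelX.
have -> : (2^-1 - gap) * - p = - p / 2 + gap * p by field.
rewrite gapM; set e := - p / 2 + _.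
have e0 : 0 <= n * (K * n `^ e) by rewrite !mulr_ge0 ?powR_ge0// ltW.
apply: le_trans (ler_wpM2r e0 MC) _.
have -> : C * n `^ r * (n * (K * n `^ e)) = C * K * (n `^ r * n `^ 1 * n `^ e).
  by rewrite (powRr1 (ltW n0)); ring.
rewrite ler_wpM2l ?mulr_ge0 ?(ltW K0)// -!powRD_gt0//; apply: ler_powR => //.
by rewrite /e /p; have := nu0; lra.
Qed.

End truncation_parameters.

Section comparable_groups.
Context {R : realType}.
Variables (E : experiment R) (cL cU : R).
Local Notation m := (ngroups E).
Implicit Types i j : 'I_m.
Hypothesis cL_le1 : cL <= 1.
Hypothesis var_ratio : forall i j, i != j -> cL <= sd i ^+ 2 / sd j ^+ 2 <= cU.
Hypothesis size_ratio : forall i j, i != j ->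
  cL <= ((gsize i)%:R / (gsize j)%:R : R) <= cU.

Lemma gsize_le_max i : (gsize i)%:R <= (maxsize E)%:R :> R.
Proof. by rewrite ler_nat; exact: (leq_bigmax i). Qed.

Lemma gsize_ge_max i : cL * (maxsize E)%:R <= (gsize i)%:R.
Proof.
have i0 : (0 < #|'I_m|)%N by apply/card_gt0P; exists i.
have [j jE] := @bigop.eq_bigmax 'I_m (fun i => gsize i) i0; rewrite /maxsize jE.
have [->|ij] := eqVneq i j; first by rewrite ler_piMl.
by have /andP[+ _] := size_ratio ij; rewrite ler_pdivlMr ?gsize_gt0.
Qed.

(* Bounds the correlation of two distinct pair statistics sharing a group. *)
Definition corr_bound : R := cU ^+ 2 / (1 + cU ^+ 2).

Let denom_gt0 : 0 < 1 + cU ^+ 2. Proof. by rewrite ltr_wpDr// sqr_ge0. Qed.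

Lemma corr_bound_ge0 : 0 <= corr_bound.
Proof. by rewrite divr_ge0 ?sqr_ge0// ltW. Qed.

Lemma corr_bound_lt1 : corr_bound < 1.
Proof. by rewrite ltr_pdivrMr// mul1r ltrDr. Qed.

Lemma corr_exponent_gt0 : 0 < corr_exponent corr_bound.
Proof.
have := corr_bound_ge0; have := corr_bound_lt1 => lt1 ge0.
by rewrite /corr_exponent divr_gt0//; lra.
Qed.

Lemma mean_var_share i j : i != j -> mean_var i <= corr_bound * (mean_var i + mean_var j).
Proof.
move=> ij; have ji : j != i by rewrite eq_sym.
have wi0 := mean_var_gt0 i; have wj0 := mean_var_gt0 j.
suff : mean_var i <= cU ^+ 2 * mean_var j.
  by move=> le_j; rewrite /corr_bound mulrAC ler_pdivlMr//; lra.
rewrite -ler_pdivrMr//.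
have -> : mean_var i / mean_var j =
    sd i ^+ 2 / sd j ^+ 2 * ((gsize j)%:R / (gsize i)%:R).
  by rewrite /mean_var; field; rewrite !gsize_neq0 gt_eqF ?sd_gt0.
have /andP[_ var_le] := var_ratio ij; have /andP[_ size_le] := size_ratio ji.
by rewrite expr2; apply: ler_pM => //; apply: divr_ge0; rewrite ?sqr_ge0.
Qed.

End comparable_groups.

Lemma group_deviation_total_le (R : realType) (x : R) : 1 <= x ->
  x * (4 * expR (mgf_const - 2 * log_scale x ^+ 2)) <= 4 * expR mgf_const * x `^ (-1).
Proof.
move=> x1; have l0 : 0 <= ln x by rewrite ln_ge0.
have log_le : 2 * ln x <= log_scale x ^+ 2.
  rewrite -extreme_level_sqr// /log_scale; have : 0 <= extreme_level x := sqrtr_ge0 _.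
  by nra.
have xE : x = expR (ln x) by rewrite lnK// posrE (lt_le_trans ltr01).
rewrite mulrCA -mulrA ler_pM2l// [in leRHS]xE -expRM {1}xE -!expRD ler_expR; lra.
Qed.

Section experiment_sequence.
Context {R : realType}.
Variable E : nat -> experiment R.
Variable F : forall l, 'I_(ngroups (E l)) -> 'I_(ngroups (E l)) -> R -> R.
Variables cL cU r C nu K c : R.
Local Notation m l := ((ngroups (E l))%:R : R).
Local Notation n l := ((maxsize (E l))%:R : R).
Local Notation u l := (log_scale (m l)).
Local Notation p := (moment_exponent r nu).
Local Notation B l := (trunc_level r nu (n l)).
Local Notation g l := (Num.sqrt (cL * n l))^-1.
Local Notation s l := (Num.sqrt (n l)).
Local Notation zeta l := (lindeberg_error r nu K cL (n l)).
Local Notation rho := (corr_bound cU).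
Hypotheses (m_oo : m l @[l --> \oo] --> +oo) (n_oo : n l @[l --> \oo] --> +oo).
Hypotheses (cL_gt0 : 0 < cL) (cL_le1 : cL <= 1).
Hypothesis var_ratio : forall l (i j : 'I_(ngroups (E l))), i != j ->
  cL <= sd i ^+ 2 / sd j ^+ 2 <= cU.
Hypothesis size_ratio : forall l (i j : 'I_(ngroups (E l))), i != j ->
  cL <= (gsize i)%:R / (gsize j)%:R <= cU.
Hypotheses (r_gt0 : 0 < r) (C_gt0 : 0 < C) (nu_gt0 : 0 < nu) (K_gt0 : 0 < K).
Hypothesis m_le : forall l, m l <= C * n l `^ r.
Hypothesis moment_le : forall l, std_moment_le (E l) p K.
Hypothesis F_ref : forall l, reference_distributions (@F l).
Hypothesis c_gt0 : 0 < c.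
Hypothesis F_approx : (fun l => null_approx_error (@F l) : R^o) =O_\oo
  (fun l => n l `^ (- c) : R^o).

Let cvg_scale (k : R) (f : nat -> R) :
  f l @[l --> \oo] --> 0 -> k * f l @[l --> \oo] --> 0.
Proof. by move=> f0; rewrite -[X in _ --> X](mulr0 k); apply: cvgM => //; exact: cvg_cst. Qed.

Let cvg_lindeberg_error (k : nat) : u l ^+ k * zeta l @[l --> \oo] --> 0.
Proof.
under eq_fun do rewrite mulrCA; apply: cvg_scale.
exact: (cvg_log_scale_powRN m_oo n_oo (ltW C_gt0) r_gt0 (@m_le) k (trunc_gap_gt0 r_gt0 nu_gt0)).
Qed.

Let near_ge (f : nat -> R) (a : R) :
  f l @[l --> \oo] --> +oo -> \forall l \near \oo, a <= f l.
Proof. by move=> /cvgryPge; exact. Qed.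

Lemma eventually_truncation_regime : \forall l \near \oo,
  truncation_regime (E l) p K (B l) (g l) (s l) (zeta l) (u l) rho.
Proof.
near=> l; have n1 : 1 <= n l by near: l; exact: near_ge.
have n0 : 0 < n l by exact: lt_le_trans n1.
have rho01 : 0 <= rho <= 1 by rewrite corr_bound_ge0 ltW ?corr_bound_lt1.
split=> //.
- exact: moment_exponent_ge2.
- exact: ltW.
- exact: trunc_level_gt0.
- exact: log_scale_ge4.
- move=> i; rewrite (size_scale_sqr cL_gt0 n1) -invfM mulrC ler_pdivlMr ?mulr_gt0//.
  by rewrite mul1r (gsize_ge_max cL_le1 (@size_ratio l)).
- by move=> i; rewrite sqr_sqrtr// gsize_le_max.
- exact: (mean_var_share (@var_ratio l) (@size_ratio l)).
- exact: (lindeberg_error_ge r_gt0 nu_gt0 K_gt0 cL_gt0 n1).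
- by near: l; apply: (cvgr_le 0); [exact: cvg_lindeberg_error|exact: ltr01].
Unshelve. all: by end_near. Qed.

Lemma eventually_null_approx : \forall l \near \oo,
  8 * null_approx_error (@F l) <= hazard_lb * (u l)^-1 ^+ 2.
Proof.
have /eqO_exP[k k0 approx_le] := F_approx.
have approx_cvg : 8 * k * (u l ^+ 2 * n l `^ (- c)) @[l --> \oo] --> 0.
  exact/cvg_scale/(cvg_log_scale_powRN m_oo n_oo (ltW C_gt0) r_gt0 (@m_le)).
near=> l; have u0 : 0 < u l by exact: lt_le_trans (log_scale_ge4 _).
rewrite exprVn ler_pdivlMr ?exprn_gt0//.
apply: (@le_trans _ _ (8 * k * (u l ^+ 2 * n l `^ (- c)))); last first.
  by near: l; exact: cvgr_le approx_cvg _ hazard_lb_gt0.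
rewrite [leRHS](_ : _ = 8 * (k * n l `^ (- c)) * u l ^+ 2); last by ring.
rewrite ler_pM2r ?exprn_gt0// ler_pM2l//.
apply: le_trans (ler_norm _) _; rewrite -(ger0_norm (powR_ge0 (n l) (- c))).
by near: l.
Unshelve. all: by end_near. Qed.

Definition error_prob_bound (eps : R) (l : nat) : R :=
  C * K * n l `^ (- r) + 4 * expR mgf_const * m l `^ (-1) +
  deviation_const / eps ^+ 2 * (u l ^+ 5 * m l `^ (- corr_exponent rho)).

Lemma cvg_error_prob_bound eps : error_prob_bound eps l @[l --> \oo] --> 0.
Proof.
have m_le1 l : m l <= 1 * m l `^ 1 by rewrite mul1r powRr1.
rewrite -[X in _ --> X](addr0 0); apply: cvgD.
  rewrite -[X in _ --> X](addr0 0); apply: cvgD; apply: cvg_scale.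
    exact: cvg_powRN.
  exact: cvg_powRN.
apply: cvg_scale.
exact: (cvg_log_scale_powRN m_oo m_oo ler01 ltr01 m_le1 5 (corr_exponent_gt0 cU)).
Qed.

Lemma eventually_error_prob_le eps : 0 < eps <= 1 -> \forall l \near \oo,
  fine (prob (E l) [set w | eps < `|sup_relative_error (@F l) w|]) <= error_prob_bound eps l.
Proof.
move=> eps01; have [eps0 _] := andP eps01.
have tail_cvg : 4 * (tail_const * ((u l)^-1 + u l ^+ 20 * zeta l)) @[l --> \oo] --> 0.
  do 2!apply: cvg_scale; rewrite -[X in _ --> X](addr0 0); apply: cvgD => //.
  exact: cvg_log_scaleV.
have hazard_cvg : 8 * (hazard_ub * (u l)^-1) @[l --> \oo] --> 0.
  by do 2!apply: cvg_scale; exact: cvg_log_scaleV.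
near=> l.
have reg : truncation_regime (E l) p K (B l) (g l) (s l) (zeta l) (u l) rho.
  by near: l; exact: eventually_truncation_regime.
have m2 : (2 <= ngroups (E l))%N by rewrite -(ler_nat R); near: l; exact: near_ge.
have n1 : 1 <= n l by near: l; exact: near_ge.
have tau1 : 1 <= extreme_level (m l).
  by apply: extreme_level_ge => //; near: l; exact: near_ge.
have tail_eps : 4 * (tail_const * ((u l)^-1 + u l ^+ 20 * zeta l)) <= eps.
  by near: l; exact: cvgr_le tail_cvg _ eps0.
have hazard_eps : 8 * (hazard_ub * (u l)^-1) <= eps.
  by near: l; exact: cvgr_le hazard_cvg _ eps0.
have null_approx : 8 * null_approx_error (@F l) <= hazard_lb * (u l)^-1 ^+ 2.
  by near: l; exact: eventually_null_approx.
have mS := measurable_sup_relative_error (@F_ref l) eps.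
apply: (le_trans (prob_le (prob (E l)) mS (measurable_exceptional (E l) (B l) eps) _)).
  move=> w /=; apply: contraPP => typ; apply/negP; rewrite -leNgt.
  exact: (sup_relative_error_le reg).
apply: le_trans (exceptional_prob reg m2 tau1 eps01 tail_eps) _.
rewrite lerD2r; apply: lerD.
  exact: (truncated_prob_le r_gt0 nu_gt0 K_gt0 n1 (ltW C_gt0) (@m_le l)).
by apply: group_deviation_total_le; rewrite ler1n ltnW.
Unshelve. all: by end_near. Qed.

End experiment_sequence.

Theorem lemma3p1 (R : realType) (E : nat -> experiment R)
  (F : forall l, 'I_(ngroups (E l)) -> 'I_(ngroups (E l)) -> R -> R)
  (cL cU r C nu K c : R)
  (m_oo : ngroups (E l) @[l --> \oo] --> \oo)
  (n_oo : maxsize (E l) @[l --> \oo] --> \oo)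
  (cL_gt0 : 0 < cL) (cL_le1 : cL <= 1) (cU_ge1 : 1 <= cU)
  (var_ratio : forall l (i j : 'I_(ngroups (E l))), i != j ->
     cL <= sd i ^+ 2 / sd j ^+ 2 <= cU)
  (size_ratio : forall l (i j : 'I_(ngroups (E l))), i != j ->
     cL <= (gsize i)%:R / (gsize j)%:R <= cU)
  (r_gt0 : 0 < r) (C_gt0 : 0 < C) (nu_gt0 : 0 < nu) (K_gt0 : 0 < K)
  (m_le : forall l, (ngroups (E l))%:R <= C * (maxsize (E l))%:R `^ r)
  (moment_le : forall l (i : 'I_(ngroups (E l))),
     ('E_(prob (E l))[fun w =>
        (`|(obs1 i w - mean i) / sd i| `^ (2 + 4 * r + nu))%R] <= K%:E)%E)
  (F_df : forall l (i j : 'I_(ngroups (E l))), (i < j)%N ->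
     distribution_function (F l i j))
  (F_sym : forall l (i j : 'I_(ngroups (E l))), (i < j)%N ->
     forall t : R, 0 <= t -> F l i j t = 1 - F l i j (- t))
  (c_gt0 : 0 < c)
  (F_approx : (fun l => null_approx_error (F l) : R^o) =O_\oo
              (fun l => (maxsize (E l))%:R `^ (- c) : R^o)) :
  cvg0_in_probability (fun l => prob (E l))
    (fun l => sup_relative_error (F l)).
Proof.
have F_ref l : reference_distributions (F l).
  by move=> i j ij; split; [exact: F_df|exact: F_sym].
have m_oo_R : (ngroups (E l))%:R @[l --> \oo] --> (+oo : set_system R) by apply/cvgrnyP.
have n_oo_R : (maxsize (E l))%:R @[l --> \oo] --> (+oo : set_system R) by apply/cvgrnyP.
move=> eps eps0; pose e := Num.min eps 1.
have e01 : 0 < e <= 1 by rewrite lt_min eps0 ltr01 ge_min lexx orbT.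
apply: cvg_EFin; first by near=> l; rewrite fin_num_measure//;
  exact: measurable_sup_relative_error.
apply: (@squeeze_cvgr _ _ _ _ (cst 0) (error_prob_bound E cU r C K e)).
- near=> l; rewrite fine_ge0//=.
  apply: (@le_trans _ _ (fine (prob (E l) [set w | e < `|sup_relative_error (F l) w|]))).
    apply: prob_le; [exact: measurable_sup_relative_error..|].
    by move=> w /=; apply: le_lt_trans; rewrite ge_min lexx.
  near: l; exact: (eventually_error_prob_le m_oo_R n_oo_R cL_gt0 cL_le1 var_ratio size_ratio
    r_gt0 C_gt0 nu_gt0 K_gt0 m_le moment_le F_ref c_gt0 F_approx e01).
- exact: cvg_cst.
- exact: cvg_error_prob_bound.
Unshelve. all: by end_near. Qed.
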